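(* Let $\varepsilon=1/N$, $x=yN$, $y=q+\xi\sqrt{2pq\varepsilon}$ and $n=N-j$ with $j\in\mathbb{Z}$, $j\ge-1$. For $n\approx N$ (that is, $n/N=1-O(\varepsilon)$) and $\xi=O(1)$, as $N\to\infty$, $$K_n(x)\sim\exp\left[\frac{p\ln(p)+q\ln(q)}{\varepsilon}+\xi\sqrt{\frac{2pq}{\varepsilon}}\ln\left(\frac{q}{p}\right)-\frac{j}{2}\ln(pq\varepsilon)\right]\exp\left(\frac{\xi^{2}}{2}\right)$$ $$\times\left[\frac{1}{j!}\mathrm{D}_{j}\left(\sqrt{2}\,\xi\right)\cos\left(\frac{p\pi}{\varepsilon}-\xi\pi\sqrt{\frac{2pq}{\varepsilon}}\right)-\frac{1}{\sqrt{2\pi}}\Lambda_{j}(\xi)\sin\left(\frac{p\pi}{\varepsilon}-\xi\pi\sqrt{\frac{2pq}{\varepsilon}}\right)\right],$$ where the function $\Lambda_j:\mathbb{R}\to\mathbb{R}$ is defined by $$\Lambda_{j}(\xi)=\mathrm{i}^{\,j+1}\left[\mathrm{D}_{-j-1}\left(\sqrt{2}\,\mathrm{i}\xi\right)+(-1)^{j+1}\mathrm{D}_{-j-1}\left(-\sqrt{2}\,\mathrm{i}\xi\right)\right].$$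
   Context: Fix real $0<p,q<1$ with $p+q=1$. For integers $n,N\ge 0$ and real $x$, the Krawtchouk polynomial is $$K_n(x)=K_n(x,N,p,q)=\sum_{k=0}^{n}\binom{x}{k}\binom{N-x}{n-k}q^{k}(-p)^{n-k},$$ where $\binom{a}{k}=a(a-1)\cdots(a-k+1)/k!$ for real $a$ and integer $k\geq 0$. $\mathrm{D}_\nu(t)$ is the (Whittaker) parabolic cylinder function of order $\nu$ (entire in $t$): the solution of $w''+\left(\nu+\tfrac12-\tfrac{t^2}{4}\right)w=0$ with $\mathrm{D}_\nu(t)\sim t^{\nu}e^{-t^2/4}$ as $t\to+\infty$. For $j=-1$, $1/j!$ is read as $0$.
   Formalization: ''∼'' is not taken as ratio → 1, which fails at zeros of the oscillating right side; instead D_j and Λ_j are each replaced by D_j + o(1) and Λ_j + o(1), uniformly for bounded j and ξ, which gives ratio → 1 wherever the bracket stays away from zero. *)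

(* Defs.v *)
From Stdlib Require Export Reals ZArith.
From Coquelicot Require Export Coquelicot.
Open Scope R_scope.

(** [falling a k] is [a (a - 1) ... (a - k + 1)]. *)
Fixpoint falling (a : R) (k : nat) : R :=
  match k with
  | O => 1
  | S k' => falling a k' * (a - INR k')
  end.

Definition binomial (a : R) (k : nat) : R := falling a k / INR (fact k).

Definition Krawtchouk (n : nat) (x : R) (N : nat) (p q : R) : R :=
  sum_f_R0 (fun k => binomial x k * binomial (INR N - x) (n - k)
                     * q ^ k * (- p) ^ (n - k)) n.

(** [1 / j!], extended by [0] to negative [j]. *)
Definition inv_fact (j : Z) : R :=
  if (j <? 0)%Z then 0 else / INR (fact (Z.to_nat j)).

(** [w] is the parabolic cylinder function of order [nu]: the entire solution of
    [w'' + (nu + 1/2 - t^2/4) w = 0] with [w(t) ~ t^nu exp(-t^2/4)] as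
    [t -> +oo] along the reals.  The asymptotic condition determines [w]
    uniquely, since every solution independent of it grows like
    [t^(-nu-1) exp(t^2/4)]. *)
Definition is_parabolic_cylinder (nu : R) (w : C -> C) : Prop :=
  (exists dw : C -> C,
     (forall t : C,
        is_derive (K := C_AbsRing) (V := C_NormedModule) w t (dw t)) /\
     (forall t : C,
        is_derive (K := C_AbsRing) (V := C_NormedModule) dw t
          (- (RtoC (nu + 1 / 2) - t * t / RtoC 4) * w t)%C)) /\
  filterlim
    (fun t : R => (w (RtoC t) / RtoC (Rpower t nu * exp (- t ^ 2 / 4)))%C)
    (Rbar_locally p_infty) (locally (RtoC 1)).

(** The function [Lambda_j], for [j >= -1], built from a family [D] of parabolic
    cylinder functions indexed by their order.  Its values lie on the real
    axis, but the defining expression is complex. *)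
Definition Lambda (D : R -> C -> C) (j : Z) (xi : R) : C :=
  let m := Z.to_nat (j + 1) in
  (Ci ^ m *
   (D (IZR (- j - 1)) (RtoC (sqrt 2) * Ci * RtoC xi)
    + (- RtoC 1) ^ m * D (IZR (- j - 1)) (- (RtoC (sqrt 2) * Ci * RtoC xi))))%C.

(* Main.v *)
Require Import Defs.
From Stdlib Require Import Lia Lra Psatz.

(** Why the expansion holds. The Krawtchouk polynomials of degrees [N + 1] and [N] have
    closed forms: the first is the product of all [x - m], [0 <= m <= N], divided by
    [(N + 1)!] ([Krawtchouk_top]), and the second is this product times the expectation
    of [1 / (x - B)], [B] being binomial with mean [q N], up to a factorial
    ([Krawtchouk_diag_frac]). All other degrees follow from the three-term recurrence in
    the degree ([Krawtchouk_recurrence]), whose coefficients, after scaling, converge to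
    those of the recurrence satisfied by both [D_j / j!] and [Lambda_j]. So it is enough
    to treat [j = -1] and [j = 0].

    Three ingredients give these two cases uniformly for bounded [xi].

    - Multiplied by [sin (PI x)], the expectation of [1 / (x - B)] is a Fourier integral
      over [[0, PI]] of the characteristic function of [B] ([Ebin_frac_fourier]).
      Its cosine part would be [PI] times the probability of [x] if [x] were an integer;
      its sine part is a discrete Hilbert transform. Laplace's method ([fourier_limit])
      turns it into the half-line Fourier transform of a Gaussian, that is, a Gaussian in
      [xi] and a Dawson integral.

    - The product of the [x - m] is compared with factorials through Euler's product for
      the sine, proved with a remainder from the moments of [cos (psi / 2) ^ (2 M)]
      ([cos_moment_product], [falling_sin]). The binomial weight that appears is again
      given by the Fourier integral, so Stirling's formula is never used.

    - The functions [D_nu] are known only through Weber's equation and their behaviour at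
      infinity. A Wronskian argument on the real axis shows that
      [D_nu' - (z / 2) D_nu = - D_(nu + 1)] ([pcf_raise]); the lowering relation, the
      recurrence in [nu], the value of [D_0] and the first order equation of [D_(-1)]
      follow from it algebraically. *)

(** * Falling factorials and closed forms in degrees N and N + 1 *)

Lemma falling_add (a : R) (k l : nat) :
  falling a (k + l) = falling a k * falling (a - INR k) l.
Proof.
  induction l as [|l IH].
  - rewrite Nat.add_0_r; simpl; ring.
  - rewrite Nat.add_succ_r; cbn [falling]; rewrite IH, plus_INR; ring.
Qed.

(** The falling factorial over the nodes [0, ..., N] with the node [m] left out: the
    numerator of a Lagrange basis polynomial. *)
Definition punctured (x : R) (N m : nat) : R :=
  falling x m * falling (x - INR (S m)) (N - m).

Lemma punctured_spec (x : R) (N m : nat) :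
  (m <= N)%nat -> punctured x N m * (x - INR m) = falling x (S N).
Proof.
  intros H; unfold punctured.
  replace (S N) with (S m + (N - m))%nat by lia.
  rewrite falling_add; cbn [falling]; ring.
Qed.

Lemma falling_reflect (a : R) (k : nat) :
  falling a k = (-1) ^ k * falling (INR k - 1 - a) k.
Proof.
  revert a; induction k as [|k IH]; intros a; [simpl; ring|].
  replace (S k) with (1 + k)%nat by lia.
  rewrite falling_add, (IH (a - INR 1)).
  replace (1 + k)%nat with (k + 1)%nat by lia.
  rewrite falling_add, plus_INR.
  replace (INR k + INR 1 - 1 - a) with (INR k - 1 - (a - INR 1)) by (simpl; ring).
  rewrite pow_add; simpl; ring.
Qed.

Lemma fact_neq_0_R (n : nat) : INR (fact n) <> 0.
Proof. apply not_0_INR, fact_neq_0. Qed.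

Lemma pow_opp (p : R) (n : nat) : (- p) ^ n = (-1) ^ n * p ^ n.
Proof. rewrite <- Rpow_mult_distr; f_equal; ring. Qed.

Lemma pow_m1_sq (n : nat) : (-1) ^ n * (-1) ^ n = 1.
Proof. rewrite <- Rpow_mult_distr; replace (-1 * -1) with 1 by ring; apply pow1. Qed.

(** The summand factors: [binomial (N - x) (N + 1 - k)] supplies, up to sign, the
    factors [x - k, ..., x - N] missing from [binomial x k], so each term is the full
    product over the nodes and the binomial theorem sums the coefficients. *)
Lemma Krawtchouk_top (x p q : R) (N : nat) :
  p + q = 1 ->
  Krawtchouk (S N) x N p q = falling x (S N) / INR (fact (S N)).
Proof.
  intros hpq.
  assert (H : forall k, (k <= S N)%nat ->
    binomial x k * binomial (INR N - x) (S N - k) * q ^ k * (- p) ^ (S N - k)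
    = falling x (S N) / INR (fact (S N)) * (Binomial.C (S N) k * q ^ k * p ^ (S N - k))).
  { intros k Hk; unfold binomial, Binomial.C.
    rewrite (falling_reflect (INR N - x)), pow_opp.
    replace (INR (S N - k) - 1 - (INR N - x)) with (x - INR k)
      by (rewrite minus_INR, S_INR by lia; ring).
    replace (falling x (S N)) with (falling x k * falling (x - INR k) (S N - k))
      by (rewrite <- falling_add; f_equal; lia).
    replace (falling x k / INR (fact k) *
      ((-1) ^ (S N - k) * falling (x - INR k) (S N - k) / INR (fact (S N - k))) *
      q ^ k * ((-1) ^ (S N - k) * p ^ (S N - k)))
      with (((-1) ^ (S N - k) * (-1) ^ (S N - k)) * (falling x k / INR (fact k) *
      (falling (x - INR k) (S N - k) / INR (fact (S N - k))) *
      q ^ k * p ^ (S N - k))) by (unfold Rdiv; ring).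
    rewrite pow_m1_sq; field; repeat split; apply fact_neq_0_R. }
  unfold Krawtchouk; rewrite (sum_eq _ _ _ H).
  transitivity (falling x (S N) / INR (fact (S N)) * (q + p) ^ (S N)).
  - rewrite Binomial.binomial, scal_sum; apply sum_eq; intros; ring.
  - rewrite Rplus_comm, hpq, pow1; ring.
Qed.

(** One degree lower, the factor [x - k] is the only one missing from the [k]-th term,
    so the definition is already the Lagrange interpolation formula at [0, ..., N]. *)
Lemma Krawtchouk_diag (x p q : R) (N : nat) :
  Krawtchouk N x N p q =
  sum_f_R0 (fun m => punctured x N m / INR (fact N)
                     * (Binomial.C N m * q ^ m * p ^ (N - m))) N.
Proof.
  unfold Krawtchouk; apply sum_eq; intros k Hk; unfold binomial, Binomial.C, punctured.
  rewrite (falling_reflect (INR N - x)), pow_opp.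
  replace (INR (N - k) - 1 - (INR N - x)) with (x - INR (S k))
    by (rewrite minus_INR, S_INR by lia; ring).
  replace (falling x k / INR (fact k) *
    ((-1) ^ (N - k) * falling (x - INR (S k)) (N - k) / INR (fact (N - k))) *
    q ^ k * ((-1) ^ (N - k) * p ^ (N - k)))
    with (((-1) ^ (N - k) * (-1) ^ (N - k)) * (falling x k / INR (fact k) *
    (falling (x - INR (S k)) (N - k) / INR (fact (N - k))) *
    q ^ k * p ^ (N - k))) by (unfold Rdiv; ring).
  rewrite pow_m1_sq; field; repeat split; apply fact_neq_0_R.
Qed.

(** * The three-term recurrence *)

Section Convolution.
Variables u v : nat -> R.

(** Cauchy product of coefficient sequences. *)
Definition conv (u v : nat -> R) (n : nat) : R :=
  sum_f_R0 (fun k => u k * v (n - k)%nat) n.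

Lemma conv_S_l (n : nat) :
  conv u v (S n) = u 0%nat * v (S n) + conv (fun k => u (S k)) v n.
Proof. unfold conv; rewrite decomp_sum by lia; f_equal. Qed.

Lemma conv_S_r (n : nat) :
  conv u v (S n) = conv u (fun k => v (S k)) n + u (S n) * v 0%nat.
Proof.
  unfold conv; rewrite tech5, Nat.sub_diag; f_equal.
  apply sum_eq; intros i Hi; now replace (S n - i)%nat with (S (n - i)) by lia.
Qed.

(** Leibniz rule for the product of the generating functions. *)
Lemma conv_derive (n : nat) :
  INR (S n) * conv u v (S n) =
  conv (fun k => INR (S k) * u (S k)) v n + conv u (fun k => INR (S k) * v (S k)) n.
Proof.
  transitivity (conv (fun k => INR k * u k) v (S n) + conv u (fun k => INR k * v k) (S n)).
  - unfold conv; rewrite scal_sum, <- plus_sum; apply sum_eq; intros i Hi.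
    rewrite (minus_INR (S n) i) by lia; ring.
  - f_equal.
    + unfold conv; rewrite decomp_sum by lia; cbn [INR pred].
      rewrite !Rmult_0_l, Rplus_0_l; reflexivity.
    + unfold conv; rewrite tech5, Nat.sub_diag; cbn [INR].
      rewrite Rmult_0_l, Rmult_0_r, Rplus_0_r; apply sum_eq; intros i Hi.
      now replace (S n - i)%nat with (S (n - i)) by lia.
Qed.

Lemma conv_ext (u' v' : nat -> R) (n : nat) :
  (forall k, u k = u' k) -> (forall k, v k = v' k) -> conv u v n = conv u' v' n.
Proof. intros H1 H2; apply sum_eq; intros; now rewrite H1, H2. Qed.

Lemma conv_lin_l (a b : R) (u' : nat -> R) (n : nat) :
  conv (fun k => a * u k + b * u' k) v n = a * conv u v n + b * conv u' v n.
Proof. unfold conv; rewrite !scal_sum, <- plus_sum; apply sum_eq; intros; ring. Qed.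

Lemma conv_lin_r (a b : R) (v' : nat -> R) (n : nat) :
  conv u (fun k => a * v k + b * v' k) n = a * conv u v n + b * conv u v' n.
Proof. unfold conv; rewrite !scal_sum, <- plus_sum; apply sum_eq; intros; ring. Qed.
End Convolution.

Lemma binomial_S (a : R) (k : nat) :
  INR (S k) * binomial a (S k) = (a - INR k) * binomial a k.
Proof.
  unfold binomial; cbn [falling]; rewrite fact_simpl, mult_INR; field.
  split; [apply fact_neq_0_R | apply not_0_INR; lia].
Qed.

(** The hypothesis says that the generating function [U] satisfies
    [(1 + d z) U' = d c U], as a power [(1 + d z)^c] does; multiply by [V]. *)
Lemma conv_ode_l (u v : nat -> R) (c d : R) (n : nat) :
  (forall k, INR (S k) * u (S k) = d * (c - INR k) * u k) ->
  conv (fun k => INR (S k) * u (S k)) v (S n) + d * conv (fun k => INR (S k) * u (S k)) v n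
  = d * c * conv u v (S n).
Proof.
  intros H.
  rewrite conv_S_l, (conv_S_l u).
  set (X := conv (fun k => INR (S (S k)) * u (S (S k))) v n).
  assert (HX : X = (d * c) * conv (fun k => u (S k)) v n
                   + (- d) * conv (fun k => INR (S k) * u (S k)) v n).
  { rewrite <- conv_lin_l; apply conv_ext; [intros k; rewrite H; ring|reflexivity]. }
  rewrite HX, H; simpl; ring.
Qed.

Lemma conv_ode_r (u v : nat -> R) (c d : R) (n : nat) :
  (forall k, INR (S k) * v (S k) = d * (c - INR k) * v k) ->
  conv u (fun k => INR (S k) * v (S k)) (S n) + d * conv u (fun k => INR (S k) * v (S k)) n
  = d * c * conv u v (S n).
Proof.
  intros H.
  rewrite conv_S_r, (conv_S_r u v).
  set (X := conv u (fun k => INR (S (S k)) * v (S (S k))) n).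
  assert (HX : X = (d * c) * conv u (fun k => v (S k)) n
                   + (- d) * conv u (fun k => INR (S k) * v (S k)) n).
  { rewrite <- conv_lin_r; apply conv_ext; [reflexivity|intros k; rewrite H; ring]. }
  rewrite HX, H; simpl; ring.
Qed.

(** Coefficients of the differential equation of the generating function
    [G = (1 + q z)^x (1 - p z)^(N - x)], namely
    [(1 + q z) (1 - p z) G' = (x - N p - N p q z) G]. *)
Lemma Krawtchouk_recurrence (x p q : R) (N n : nat) :
  p + q = 1 ->
  INR (S (S (S n))) * Krawtchouk (S (S (S n))) x N p q =
  (x - INR N * p - (q - p) * INR (S (S n))) * Krawtchouk (S (S n)) x N p q
  - p * q * (INR N - INR (S n)) * Krawtchouk (S n) x N p q.
Proof.
  intros hpq.
  pose (u := fun k => binomial x k * q ^ k).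
  pose (v := fun k => binomial (INR N - x) k * (- p) ^ k).
  assert (HK : forall m, Krawtchouk m x N p q = conv u v m).
  { intros m; unfold Krawtchouk, conv, u, v; apply sum_eq; intros; ring. }
  rewrite !HK.
  assert (Hu : forall k, INR (S k) * u (S k) = q * (x - INR k) * u k).
  { intros k; unfold u.
    replace (INR (S k) * (binomial x (S k) * q ^ S k))
      with (INR (S k) * binomial x (S k) * q ^ S k) by ring.
    rewrite binomial_S; simpl; ring. }
  assert (Hv : forall k, INR (S k) * v (S k) = (- p) * (INR N - x - INR k) * v k).
  { intros k; unfold v.
    replace (INR (S k) * (binomial (INR N - x) (S k) * (- p) ^ S k))
      with (INR (S k) * binomial (INR N - x) (S k) * (- p) ^ S k) by ring.
    rewrite binomial_S; simpl; ring. }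
  pose proof (conv_ode_l u v x q (S n) Hu) as A1.
  pose proof (conv_ode_l u v x q n Hu) as A2.
  pose proof (conv_ode_r u v (INR N - x) (- p) (S n) Hv) as B1.
  pose proof (conv_ode_r u v (INR N - x) (- p) n Hv) as B2.
  pose proof (conv_derive u v (S (S n))) as D2.
  pose proof (conv_derive u v (S n)) as D1.
  pose proof (conv_derive u v n) as D0.
  set (X2 := conv (fun k => INR (S k) * u (S k)) v (S (S n))) in *.
  set (X1 := conv (fun k => INR (S k) * u (S k)) v (S n)) in *.
  set (X0 := conv (fun k => INR (S k) * u (S k)) v n) in *.
  set (Y2 := conv u (fun k => INR (S k) * v (S k)) (S (S n))) in *.
  set (Y1 := conv u (fun k => INR (S k) * v (S k)) (S n)) in *.
  set (Y0 := conv u (fun k => INR (S k) * v (S k)) n) in *.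
  set (K3 := conv u v (S (S (S n)))) in *.
  set (K2 := conv u v (S (S n))) in *.
  set (K1 := conv u v (S n)) in *.
  assert (G : INR (S (S (S n))) * K3 + (q - p) * (INR (S (S n)) * K2)
      - p * q * (INR (S n) * K1) = (x * (q + p) - p * INR N) * K2 - p * q * INR N * K1).
  { rewrite D2, D1, D0.
    replace (X2 + Y2 + (q - p) * (X1 + Y1) - p * q * (X0 + Y0)) with
      ((X2 + q * X1) - p * (X1 + q * X0) + (Y2 + - p * Y1) + q * (Y1 + - p * Y0)) by ring.
    rewrite A1, A2, B1, B2; ring. }
  replace (q + p) with 1 in G by lra.
  replace (INR (S (S (S n))) * K3) with
    (INR (S (S (S n))) * K3 + (q - p) * (INR (S (S n)) * K2) - p * q * (INR (S n) * K1)
     - (q - p) * (INR (S (S n)) * K2) + p * q * (INR (S n) * K1)) by ring.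
  rewrite G; ring.
Qed.

(** * Binomial expectations *)

(** Expectation under the binomial law with [N] trials. Sums over the nodes are kept in
    this form because conditioning on one trial, [Ebin_S], gives the characteristic
    function by induction on [N]. *)
Definition Ebin (p q : R) (N : nat) (phi : nat -> R) : R :=
  sum_f_R0 (fun m => Binomial.C N m * q ^ m * p ^ (N - m) * phi m) N.

Lemma Ebin_S (p q : R) (N : nat) (phi : nat -> R) :
  Ebin p q (S N) phi = p * Ebin p q N phi + q * Ebin p q N (fun m => phi (S m)).
Proof.
  assert (H0 : forall n, Binomial.C n 0 = 1).
  { intros n; unfold Binomial.C; rewrite Nat.sub_0_r; simpl; field; apply fact_neq_0_R. }
  assert (Hn : forall n, Binomial.C n n = 1).
  { intros n; unfold Binomial.C; rewrite Nat.sub_diag; simpl; field; apply fact_neq_0_R. }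
  destruct N as [|N].
  { unfold Ebin; cbn [sum_f_R0]; rewrite !H0, !Hn; simpl; ring. }
  unfold Ebin.
  rewrite (decomp_sum _ (S (S N))) by lia; cbn [pred].
  rewrite (tech5 _ N).
  rewrite (sum_eq _ (fun m => (Binomial.C (S N) (S m) * q ^ S m * p ^ (N - m) * phi (S m)) * p
     + (Binomial.C (S N) m * q ^ m * p ^ (S N - m) * phi (S m)) * q) N).
  2:{ intros i Hi. rewrite <- (pascal (S N) i) by lia.
      replace (S (S N) - S i)%nat with (S (N - i)) by lia.
      replace (S N - i)%nat with (S (N - i)) by lia. simpl; ring. }
  rewrite plus_sum, <- !scal_sum.
  rewrite (decomp_sum _ (S N)) by lia; cbn [pred].
  rewrite (tech5 _ N), !H0, !Hn, !Nat.sub_diag, !Nat.sub_0_r.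
  replace (fun m : nat => Binomial.C (S N) (S m) * q ^ S m * p ^ (N - m) * phi (S m))
    with (fun i : nat => Binomial.C (S N) (S i) * q ^ S i * p ^ (S N - S i) * phi (S i))
    by reflexivity.
  simpl pow; ring.
Qed.

Lemma sum_f_R0_single (g : nat -> R) (m N : nat) : (m <= N)%nat ->
  (forall k, (k <= N)%nat -> k <> m -> g k = 0) -> sum_f_R0 g N = g m.
Proof.
  induction N as [|N IH]; intros Hm Hg.
  - replace m with 0%nat by lia; reflexivity.
  - rewrite tech5; destruct (Nat.eq_dec m (S N)) as [->|Hne].
    + rewrite (sum_eq _ (fun _ => 0)) by (intros; apply Hg; lia); rewrite sum_cte; ring.
    + rewrite IH, (Hg (S N)) by (try lia; intros; apply Hg; lia); ring.
Qed.

Lemma Ebin_ext (p q : R) (N : nat) (phi psi : nat -> R) :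
  (forall m, (m <= N)%nat -> phi m = psi m) -> Ebin p q N phi = Ebin p q N psi.
Proof. intros H; apply sum_eq; intros i Hi; now rewrite H. Qed.

Lemma Ebin_scal (p q : R) (N : nat) (c : R) (phi : nat -> R) :
  Ebin p q N (fun m => c * phi m) = c * Ebin p q N phi.
Proof. unfold Ebin; rewrite scal_sum; apply sum_eq; intros; ring. Qed.

Lemma Ebin_plus (p q : R) (N : nat) (phi psi : nat -> R) :
  Ebin p q N (fun m => phi m + psi m) = Ebin p q N phi + Ebin p q N psi.
Proof. unfold Ebin; rewrite <- plus_sum; apply sum_eq; intros; ring. Qed.

(** Off the nodes the interpolation formula becomes an expectation of a Cauchy kernel,
    the discrete counterpart of a principal value integral. *)
Lemma Krawtchouk_diag_frac (x p q : R) (N : nat) :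
  (forall m, (m <= N)%nat -> x <> INR m) ->
  Krawtchouk N x N p q =
  falling x (S N) / INR (fact N) * Ebin p q N (fun m => / (x - INR m)).
Proof.
  intros Hx; rewrite Krawtchouk_diag; unfold Ebin; rewrite scal_sum.
  apply sum_eq; intros m Hm; rewrite <- (punctured_spec x N m Hm); field.
  split; [apply fact_neq_0_R | apply Rminus_eq_contra, Hx, Hm].
Qed.

(** * Elementary inequalities *)

Lemma le_of_derive_nonneg (f df : R -> R) (a b : R) :
  a <= b -> (forall x, a <= x <= b -> is_derive f x (df x)) ->
  (forall x, a <= x <= b -> 0 <= df x) -> f a <= f b.
Proof.
  intros Hab Hd Hp.
  destruct (MVT_gen f a b df) as [c [Hc E]].
  - intros x Hx; apply Hd; rewrite Rmin_left, Rmax_right in Hx by lra; lra.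
  - intros x Hx; rewrite Rmin_left, Rmax_right in Hx by lra.
    apply derivable_continuous_pt; exists (df x); apply is_derive_Reals, Hd; lra.
  - rewrite Rmin_left, Rmax_right in Hc by lra.
    assert (0 <= df c * (b - a)) by (apply Rmult_le_pos; [apply Hp; lra | lra]); lra.
Qed.

Lemma const_of_derive_0 (f : R -> R) : (forall t, is_derive f t 0) -> forall a b, f a = f b.
Proof.
  intros H a b; destruct (MVT_gen f a b (fun _ => 0)) as [c [_ E]]; [intros; apply H| |lra].
  intros x _; apply derivable_continuous_pt; exists 0; apply is_derive_Reals, H.
Qed.

Lemma sin_upper (y : R) : 0 <= y -> sin y <= y.
Proof.
  intros Hy.
  enough (H : 0 - sin 0 <= y - sin y) by (rewrite sin_0 in H; lra).
  apply (le_of_derive_nonneg (fun y => y - sin y) (fun y => 1 - cos y)); [lra| |].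
  - intros; auto_derive; [exact I|ring].
  - intros x _; pose proof (COS_bound x); lra.
Qed.

Lemma cos_lower (y : R) : 0 <= y -> 1 - y ^ 2 / 2 <= cos y.
Proof.
  intros Hy.
  enough (H : cos 0 - 1 + 0 ^ 2 / 2 <= cos y - 1 + y ^ 2 / 2) by (rewrite cos_0 in H; lra).
  apply (le_of_derive_nonneg (fun y => cos y - 1 + y ^ 2 / 2) (fun y => y - sin y)); [lra| |].
  - intros; auto_derive; [exact I|field].
  - intros x Hx; pose proof (sin_upper x); lra.
Qed.

Lemma sin_lower (y : R) : 0 <= y -> y - y ^ 3 / 6 <= sin y.
Proof.
  intros Hy.
  enough (H : sin 0 - 0 + 0 ^ 3 / 6 <= sin y - y + y ^ 3 / 6) by (rewrite sin_0 in H; lra).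
  apply (le_of_derive_nonneg (fun y => sin y - y + y ^ 3 / 6) (fun y => cos y - 1 + y ^ 2 / 2)); [lra| |].
  - intros; auto_derive; [exact I|field].
  - intros x Hx; pose proof (cos_lower x); lra.
Qed.

Lemma cos_upper (y : R) : 0 <= y -> cos y <= 1 - y ^ 2 / 2 + y ^ 4 / 24.
Proof.
  intros Hy.
  enough (H : 1 - 0 ^ 2 / 2 + 0 ^ 4 / 24 - cos 0 <= 1 - y ^ 2 / 2 + y ^ 4 / 24 - cos y)
    by (rewrite cos_0 in H; lra).
  apply (le_of_derive_nonneg (fun y => 1 - y ^ 2 / 2 + y ^ 4 / 24 - cos y)
           (fun y => sin y - y + y ^ 3 / 6)); [lra| |].
  - intros; auto_derive; [exact I|field].
  - intros x Hx; pose proof (sin_lower x); lra.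
Qed.

Lemma exp_neg_upper (s : R) : 0 <= s -> exp (- s) <= 1 - s + s ^ 2 / 2.
Proof.
  intros Hy.
  enough (H : 1 - 0 + 0 ^ 2 / 2 - exp (- 0) <= 1 - s + s ^ 2 / 2 - exp (- s))
    by (rewrite Ropp_0, exp_0 in H; lra).
  apply (le_of_derive_nonneg (fun s => 1 - s + s ^ 2 / 2 - exp (- s))
           (fun s => exp (- s) - 1 + s)); [lra| |].
  - intros; auto_derive; [exact I|field].
  - intros x Hx; pose proof (exp_ineq1_le (- x)); lra.
Qed.

(** Jordan's inequality in a weak form; it makes the characteristic function decay like
    a Gaussian on the whole range of integration. *)
Lemma cos_quadratic_upper (psi : R) : 0 <= psi <= PI -> cos psi <= 1 - psi ^ 2 / 18.
Proof.
  intros [H0 H1]; pose proof PI_4.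
  replace psi with (2 * (psi / 2)) at 1 by field.
  rewrite cos_2a_sin.
  pose proof (sin_lower (psi / 2) ltac:(lra)) as H2.
  assert (H3 : psi / 2 / 3 <= sin (psi / 2)).
  { eapply Rle_trans; [|exact H2].
    enough (0 <= psi / 2 * (2 / 3 - (psi / 2) ^ 2 / 6)) by nra.
    apply Rmult_le_pos; nra. }
  nra.
Qed.

Lemma exp_pow (x : R) (n : nat) : exp x ^ n = exp (INR n * x).
Proof.
  induction n as [|n IH]; [simpl; now rewrite Rmult_0_l, exp_0|].
  rewrite S_INR; simpl pow; rewrite IH, <- exp_plus; f_equal; ring.
Qed.

(** * The characteristic function of the binomial law *)

Definition cis (t : R) : C := (cos t, sin t).

Lemma cis_plus (a b : R) : cis (a + b) = (cis a * cis b)%C.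
Proof. unfold cis, Cmult; cbn [fst snd]; rewrite cos_plus, sin_plus; f_equal; ring. Qed.

Lemma Cmod_cis (t : R) : Cmod (cis t) = 1.
Proof.
  unfold Cmod, cis; cbn [fst snd]; rewrite <- sqrt_1; f_equal.
  pose proof (sin2_cos2 t); unfold Rsqr in *; nra.
Qed.

(** Characteristic function of one centred trial, taking [p] with probability [q] and
    [- q] with probability [p]. *)
Definition charfun (p q psi : R) : C := (RtoC p * cis (- (q * psi)) + RtoC q * cis (p * psi))%C.

Lemma Ebin_cos (p q psi : R) (hpq : p + q = 1) (N : nat) (t : R) :
  Ebin p q N (fun m => cos (psi * (INR m - q * INR N) - t))
  = Re (cis (- t) * charfun p q psi ^ N)%C.
Proof.
  revert t; induction N as [|N IH]; intros t.
  - unfold Ebin, Binomial.C, charfun, cis; cbn [sum_f_R0 Nat.sub fact INR pow].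
    simpl. replace (psi * (0 - q * 0) - t) with (- t) by ring. field.
  - rewrite Ebin_S.
    rewrite (Ebin_ext _ _ _ _ (fun m => cos (psi * (INR m - q * INR N) - (t + q * psi)))).
    2:{ intros m _; f_equal; rewrite S_INR; ring. }
    rewrite (Ebin_ext _ _ _ (fun m => cos (psi * (INR (S m) - q * INR (S N)) - t))
       (fun m => cos (psi * (INR m - q * INR N) - (t - p * psi)))).
    2:{ intros m _; f_equal; rewrite !S_INR; replace p with (1 - q) by lra; ring. }
    rewrite !IH, Cpow_S.
    replace (cis (- t) * (charfun p q psi * charfun p q psi ^ N))%C with
      (RtoC p * (cis (- (t + q * psi)) * charfun p q psi ^ N)
        + RtoC q * (cis (- (t - p * psi)) * charfun p q psi ^ N))%C.
    + set (A := (cis (- (t + q * psi)) * charfun p q psi ^ N)%C).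
      set (B := (cis (- (t - p * psi)) * charfun p q psi ^ N)%C).
      unfold Re; simpl; ring.
    + replace (- (t + q * psi)) with (- t + - (q * psi)) by ring.
      replace (- (t - p * psi)) with (- t + p * psi) by ring.
      rewrite !cis_plus; unfold charfun; ring.
Qed.

Lemma Cmod_charfun (p q psi : R) (hp : 0 < p) (hq : 0 < q) (hpq : p + q = 1) :
  0 <= psi <= PI -> Cmod (charfun p q psi) <= exp (- (p * q * psi ^ 2 / 18)).
Proof.
  intros Hpsi.
  apply Rsqr_incr_0_var; [|left; apply exp_pos].
  rewrite !Rsqr_pow2, Cmod2_alt, exp_pow.
  assert (E : Re (charfun p q psi) ^ 2 + Im (charfun p q psi) ^ 2
     = 1 - 2 * (p * q) * (1 - cos psi)).
  { replace (cos psi) with (cos (p * psi + q * psi)) by (f_equal; rewrite <- Rmult_plus_distr_r, hpq; ring).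
    rewrite cos_plus; unfold charfun, Re, Im, cis; simpl.
    rewrite cos_neg, sin_neg.
    pose proof (sin2_cos2 (q * psi)) as A; pose proof (sin2_cos2 (p * psi)) as B.
    unfold Rsqr in *.
    set (c1 := cos (q * psi)) in *; set (s1 := sin (q * psi)) in *.
    set (c2 := cos (p * psi)) in *; set (s2 := sin (p * psi)) in *.
    transitivity (p ^ 2 * (s1 * s1 + c1 * c1) + q ^ 2 * (s2 * s2 + c2 * c2)
      + 2 * (p * q) * (c2 * c1 - s2 * s1)); [ring|].
    rewrite A, B; replace p with (1 - q) by lra; ring. }
  rewrite E.
  pose proof (cos_quadratic_upper psi Hpsi).
  assert (0 < p * q) by nra.
  eapply Rle_trans; [|apply exp_ineq1_le]. simpl INR. nra.
Qed.

Lemma Cmod_le_sum (c : C) : Cmod c <= Rabs (Re c) + Rabs (Im c).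
Proof.
  destruct c as [a b].
  replace (a, b) with (RtoC a + RtoC b * Ci)%C
    by (unfold RtoC, Ci, Cplus, Cmult; simpl; f_equal; ring).
  eapply Rle_trans; [apply Cmod_triangle|].
  rewrite Cmod_mult, Cmod_Ci, !Cmod_R; unfold Re, Im; simpl.
  right; f_equal; [f_equal; ring | rewrite Rmult_1_r; f_equal; ring].
Qed.

Lemma charfun_gauss (p q psi : R) (hp : 0 < p) (hq : 0 < q) (hpq : p + q = 1) :
  0 <= psi <= 1 ->
  Cmod (charfun p q psi - RtoC (exp (- (p * q * psi ^ 2 / 2)))) <= psi ^ 3.
Proof.
  intros Hpsi; eapply Rle_trans; [apply Cmod_le_sum|].
  unfold charfun, cis, Re, Im; simpl; rewrite cos_neg, sin_neg.
  set (a := q * psi); set (b := p * psi).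
  replace (psi * (psi * 1)) with (psi ^ 2) by ring.
  replace (psi * (psi ^ 2)) with (psi ^ 3) by ring.
  assert (Ha : 0 <= a <= psi) by (unfold a; nra).
  assert (Hb : 0 <= b <= psi) by (unfold b; nra).
  pose proof (sin_upper a ltac:(lra)); pose proof (sin_lower a ltac:(lra)).
  pose proof (sin_upper b ltac:(lra)); pose proof (sin_lower b ltac:(lra)).
  pose proof (cos_upper a ltac:(lra)); pose proof (cos_lower a ltac:(lra)).
  pose proof (cos_upper b ltac:(lra)); pose proof (cos_lower b ltac:(lra)).
  assert (Hpq : 0 < p * q <= 1) by nra.
  assert (Hs : 0 <= p * q * psi ^ 2 / 2) by nra.
  pose proof (exp_neg_upper _ Hs) as He1.
  pose proof (exp_ineq1_le (- (p * q * psi ^ 2 / 2))) as He2.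
  set (e := exp (- (p * q * psi ^ 2 / 2))) in *.
  assert (P3 : 0 <= psi ^ 3) by (apply pow_le; lra).
  assert (P4 : 0 <= psi ^ 4 <= psi ^ 3) by (simpl in *; nra).
  assert (A3 : a ^ 3 <= psi ^ 3) by (apply pow_incr; lra).
  assert (B3 : b ^ 3 <= psi ^ 3) by (apply pow_incr; lra).
  assert (A4 : a ^ 4 <= psi ^ 4) by (apply pow_incr; lra).
  assert (B4 : b ^ 4 <= psi ^ 4) by (apply pow_incr; lra).
  assert (S2 : (p * q * psi ^ 2 / 2) ^ 2 <= psi ^ 4 / 4).
  { replace ((p * q * psi ^ 2 / 2) ^ 2) with ((p * q) ^ 2 * psi ^ 4 / 4) by field.
    assert ((p * q) ^ 2 <= 1) by nra. nra. }
  assert (Eq : p * (a ^ 2 / 2) + q * (b ^ 2 / 2) = p * q * psi ^ 2 / 2).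
  { unfold a, b; transitivity (p * q * (p + q) * psi ^ 2 / 2); [field|rewrite hpq; field]. }
  assert (Es : p * a = q * b) by (unfold a, b; ring).
  assert (C1 : 1 - p * q * psi ^ 2 / 2 <= p * cos a + q * cos b).
  { rewrite <- Eq; replace 1 with (p + q) at 1. nra. }
  assert (C2 : p * cos a + q * cos b <= 1 - p * q * psi ^ 2 / 2 + psi ^ 4 / 24).
  { rewrite <- Eq.
    apply Rle_trans with (p * (1 - a ^ 2 / 2 + psi ^ 4 / 24) + q * (1 - b ^ 2 / 2 + psi ^ 4 / 24)).
    - apply Rplus_le_compat; apply Rmult_le_compat_l; lra.
    - right. transitivity ((p + q) - (p * (a ^ 2 / 2) + q * (b ^ 2 / 2)) + (p + q) * (psi ^ 4 / 24));
      [ring|rewrite hpq; ring]. }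
  assert (S1 : Rabs (p * - sin a + 0 * cos a + (q * sin b + 0 * cos b) + - 0) <= psi ^ 3 / 6).
  { apply Rabs_le; split; nra. }
  assert (R1 : Rabs (p * cos a - 0 * - sin a + (q * cos b - 0 * sin b) + - e) <= psi ^ 3 / 6).
  { apply Rabs_le; split; nra. }
  simpl in *; lra.
Qed.

(** Telescoping: the usual step from one trial to [N] trials in the central limit theorem. *)
Lemma Cmod_pow_diff (a b : C) (N : nat) :
  Cmod a <= 1 -> Cmod b <= 1 -> Cmod (a ^ N - b ^ N) <= INR N * Cmod (a - b).
Proof.
  intros Ha Hb; induction N as [|N IH].
  - simpl; replace (RtoC 1 - RtoC 1)%C with (RtoC 0) by ring; rewrite Cmod_0; lra.
  - rewrite !Cpow_S.
    replace (a * a ^ N - b * b ^ N)%C with (a * (a ^ N - b ^ N) + (a - b) * b ^ N)%C by ring.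
    eapply Rle_trans; [apply Cmod_triangle|]; rewrite !Cmod_mult, Cmod_pow, S_INR.
    assert (Cmod b ^ N <= 1) by (rewrite <- (pow1 N); apply pow_incr; split; [apply Cmod_ge_0|lra]).
    assert (0 <= Cmod b ^ N) by (apply pow_le, Cmod_ge_0).
    pose proof (Cmod_ge_0 (a ^ N - b ^ N)); pose proof (Cmod_ge_0 (a - b)); pose proof (Cmod_ge_0 a).
    nra.
Qed.

Lemma exp_mono (x y : R) : x <= y -> exp x <= exp y.
Proof. intros [H| ->]; [left; now apply exp_increasing|right; reflexivity]. Qed.

Lemma exp_neg_le_1 (s : R) : 0 <= s -> exp (- s) <= 1.
Proof. intros H; rewrite <- exp_0; apply exp_mono; lra. Qed.

Lemma Ebin_cos_bound (p q psi t : R) (hp : 0 < p) (hq : 0 < q) (hpq : p + q = 1) (N : nat) :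
  0 <= psi <= PI ->
  Rabs (Ebin p q N (fun m => cos (psi * (INR m - q * INR N) - t)))
  <= exp (- (p * q * INR N * psi ^ 2 / 18)).
Proof.
  intros Hpsi; rewrite Ebin_cos by exact hpq.
  eapply Rle_trans; [apply re_le_Cmod|].
  rewrite Cmod_mult, Cmod_cis, Cmod_pow, Rmult_1_l.
  replace (- (p * q * INR N * psi ^ 2 / 18)) with (INR N * - (p * q * psi ^ 2 / 18)) by field.
  rewrite <- (exp_pow _ N); apply pow_incr; split; [apply Cmod_ge_0|now apply Cmod_charfun].
Qed.

Lemma Ebin_cos_gauss (p q psi t : R) (hp : 0 < p) (hq : 0 < q) (hpq : p + q = 1) (N : nat) :
  0 <= psi <= 1 ->
  Rabs (Ebin p q N (fun m => cos (psi * (INR m - q * INR N) - t))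
        - cos t * exp (- (p * q * INR N * psi ^ 2 / 2)))
  <= INR N * psi ^ 3.
Proof.
  intros Hpsi; rewrite Ebin_cos by exact hpq.
  set (e := exp (- (p * q * psi ^ 2 / 2))).
  assert (He : exp (- (p * q * INR N * psi ^ 2 / 2)) = e ^ N).
  { unfold e; rewrite exp_pow; f_equal; field. }
  rewrite He.
  replace (Re (cis (- t) * charfun p q psi ^ N) - cos t * e ^ N)
    with (Re (cis (- t) * (charfun p q psi ^ N - RtoC e ^ N))%C).
  2:{ rewrite <- RtoC_pow; unfold cis, Re; simpl; rewrite cos_neg; ring. }
  eapply Rle_trans; [apply re_le_Cmod|].
  rewrite Cmod_mult, Cmod_cis, Rmult_1_l.
  assert (Hpq : 0 < p * q) by nra.
  eapply Rle_trans; [apply Cmod_pow_diff|].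
  - eapply Rle_trans; [apply Cmod_charfun; try assumption|apply exp_neg_le_1; nra].
    pose proof PI2_1; lra.
  - rewrite Cmod_R, Rabs_pos_eq; [|left; apply exp_pos]. apply exp_neg_le_1; nra.
  - apply Rmult_le_compat_l; [apply pos_INR|now apply charfun_gauss].
Qed.

(** * Gaussian integrals *)

Notation RInt_scal_R := (RInt_scal (V := R_CompleteNormedModule)).
Notation RInt_plus_R := (RInt_plus (V := R_CompleteNormedModule)).
Notation RInt_minus_R := (RInt_minus (V := R_CompleteNormedModule)).
Notation is_RInt_unique_R := (is_RInt_unique (V := R_CompleteNormedModule)).
Notation RInt_correct_R := (RInt_correct (V := R_CompleteNormedModule)).
Notation ex_RInt_scal_R := (ex_RInt_scal (V := R_NormedModule)).
Notation is_derive_const_R := (is_derive_const (V := R_NormedModule)).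

Ltac eqR := match goal with |- @eq _ ?a ?b => change (@eq R a b) end.

Lemma ex_RInt_of_derivable (f : R -> R) (a b : R) :
  (forall x, ex_derive f x) -> ex_RInt f a b.
Proof.
  intros H; apply (ex_RInt_continuous (V := R_CompleteNormedModule)); intros x _.
  apply (ex_derive_continuous f x), H.
Qed.

Ltac smooth_RInt := apply ex_RInt_of_derivable; intros; auto_derive; exact I.

Lemma continuous_of_derivable (f : R -> R) (x : R) : ex_derive f x -> continuous f x.
Proof. exact (ex_derive_continuous f x). Qed.

Ltac smooth_at := apply continuous_of_derivable; auto_derive; exact I.

Lemma is_derive_RInt_smooth (f : R -> R) (a x : R) :
  (forall x, ex_derive f x) -> is_derive (fun t => RInt f a t) x (f x).
Proof.
  intros H; apply (is_derive_RInt f (fun t => RInt f a t) a).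
  - exists (mkposreal 1 Rlt_0_1); intros y _; apply RInt_correct_R.
    now apply ex_RInt_of_derivable.
  - apply continuous_of_derivable, H.
Qed.

Lemma is_derive_RInt_param_smooth (f df : R -> R -> R) (a b x : R) :
  (forall x t, is_derive (fun x => f x t) x (df x t)) ->
  (forall x t, ex_derive (fun t => f x t) t) ->
  (forall x t, continuity_2d_pt df x t) ->
  is_derive (fun x => RInt (fun t => f x t) a b) x (RInt (fun t => df x t) a b).
Proof.
  intros H1 H2 H3.
  rewrite <- (RInt_ext (fun t => Derive (fun u => f u t) x)).
  2:{ intros t _; apply is_derive_unique, H1. }
  apply is_derive_RInt_param.
  - exists (mkposreal 1 Rlt_0_1); intros y _ t _; now exists (df y t).
  - intros t _; apply continuity_2d_pt_ext with df.
    + intros u v; symmetry; apply is_derive_unique, H1.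
    + apply H3.
  - exists (mkposreal 1 Rlt_0_1); intros y _; now apply ex_RInt_of_derivable.
Qed.

Definition gauss (T : R) : R := RInt (fun u => exp (- (u ^ 2 / 2))) 0 T.

Lemma is_derive_gauss (T : R) : is_derive gauss T (exp (- (T ^ 2 / 2))).
Proof.
  apply (is_derive_RInt_smooth (fun u => exp (- (u ^ 2 / 2)))).
  intros x; auto_derive; exact I.
Qed.

Ltac cont2d :=
  repeat first
  [ apply continuity_2d_pt_mult | apply continuity_2d_pt_plus
  | apply continuity_2d_pt_minus | apply continuity_2d_pt_opp
  | apply continuity_2d_pt_const | apply continuity_2d_pt_id1
  | apply continuity_2d_pt_id2
  | apply (continuity_1d_2d_pt_comp exp); [apply derivable_continuous_pt, derivable_pt_exp|]
  | apply (continuity_1d_2d_pt_comp cos); [apply derivable_continuous_pt, derivable_pt_cos|]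
  | apply (continuity_1d_2d_pt_comp sin); [apply derivable_continuous_pt, derivable_pt_sin|] ].

(** In the classical evaluation of the Gaussian integral, [gauss ^ 2] and twice this
    function have opposite derivatives, and this function tends to [0]. *)
Definition gauss_aux (T : R) : R :=
  RInt (fun s => exp (- (T ^ 2 * (1 + s ^ 2) / 2)) / (1 + s ^ 2)) 0 1.

Lemma is_derive_gauss_aux (T : R) :
  is_derive gauss_aux T (- exp (- (T ^ 2 / 2)) * gauss T).
Proof.
  unfold gauss_aux.
  replace (- exp (- (T ^ 2 / 2)) * gauss T) with
    (RInt (fun s => - T * exp (- (T * T * (1 + s * s) * / 2))) 0 1).
  - apply (is_derive_RInt_param_smooth
      (fun T s => exp (- (T ^ 2 * (1 + s ^ 2) / 2)) / (1 + s ^ 2))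
      (fun T s => - T * exp (- (T * T * (1 + s * s) * / 2)))).
    + intros x t; auto_derive; [exact I|].
      replace (- (x * (x * 1) * (1 + t * (t * 1)) * / 2)) with (- (x * x * (1 + t * t) * / 2)) by field.
      replace (t * (t * 1)) with (t * t) by ring.
      field; nra.
    + intros x t; auto_derive; nra.
    + intros x t; cont2d.
  - unfold gauss.
    replace (RInt (fun u => exp (- (u ^ 2 / 2))) 0 T) with
      (RInt (fun u => exp (- (u ^ 2 / 2))) (T * 0 + 0) (T * 1 + 0))
      by (now rewrite Rmult_0_r, Rmult_1_r, !Rplus_0_r).
    rewrite <- RInt_comp_lin.
    2:{ smooth_RInt. }
    rewrite <- RInt_scal_R.
    2:{ apply ex_RInt_of_derivable; intros; unfold scal; simpl; unfold mult; simpl; auto_derive; exact I. }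
    apply RInt_ext; intros s _; unfold scal; simpl; unfold mult; simpl.
    transitivity (- T * (exp (- (T ^ 2 / 2)) * exp (- ((T * s) ^ 2 / 2)))).
    + rewrite <- exp_plus; f_equal; f_equal; field.
    + replace ((T * s + 0) * ((T * s + 0) * 1)) with ((T * s) ^ 2) by ring.
      replace (T ^ 2) with (T * (T * 1)) by ring. ring.
Qed.

Lemma gauss_sq (T : R) : gauss T ^ 2 + 2 * gauss_aux T = PI / 2.
Proof.
  pose (F := fun T => gauss T ^ 2 + 2 * gauss_aux T).
  assert (HF : forall x, is_derive F x 0).
  { intros x; unfold F.
    replace 0 with (2 * gauss x * exp (- (x ^ 2 / 2)) + 2 * (- exp (- (x ^ 2 / 2)) * gauss x)) by ring.
    apply (is_derive_plus (fun T => gauss T ^ 2) (fun T => 2 * gauss_aux T)).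
    - replace (2 * gauss x * exp (- (x ^ 2 / 2))) with (INR 2 * exp (- (x ^ 2 / 2)) * gauss x ^ (pred 2)) by (simpl; ring).
      apply is_derive_pow, is_derive_gauss.
    - apply is_derive_scal, is_derive_gauss_aux. }
  change (F T = PI / 2); rewrite (const_of_derive_0 F HF T 0); unfold F, gauss, gauss_aux.
  rewrite RInt_point.
  rewrite (RInt_ext _ (fun s => / (1 + s ^ 2))).
  2:{ intros s _; replace (- (0 ^ 2 * (1 + s ^ 2) / 2)) with 0 by field. rewrite exp_0; eqR; field; nra. }
  assert (A : RInt (fun s => / (1 + s ^ 2)) 0 1 = atan 1 - atan 0).
  { apply is_RInt_unique, (is_RInt_derive atan).
    - intros x _; auto_derive; [exact I|simpl; field; nra].
    - intros x _; apply continuous_of_derivable; auto_derive; nra. }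
  rewrite A, atan_0, atan_1; change (@zero R_CompleteNormedModule) with 0. simpl; field.
Qed.

Lemma gauss_nonneg (T : R) : 0 <= T -> 0 <= gauss T.
Proof.
  intros H; apply RInt_ge_0; [exact H| |].
  - smooth_RInt.
  - intros; left; apply exp_pos.
Qed.

Lemma gauss_aux_bounds (T : R) : 0 <= gauss_aux T <= exp (- (T ^ 2 / 2)).
Proof.
  assert (EX : ex_RInt (fun s => exp (- (T ^ 2 * (1 + s ^ 2) / 2)) / (1 + s ^ 2)) 0 1).
  { apply ex_RInt_of_derivable; intros; auto_derive; nra. }
  split.
  - apply RInt_ge_0; [lra|exact EX|]; intros s _.
    apply Rdiv_le_0_compat; [left; apply exp_pos|nra].
  - rewrite <- (Rmult_1_l (exp _)); replace 1 with (1 - 0) at 1 by ring.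
    eapply Rle_trans; [apply Rle_abs|].
    apply abs_RInt_le_const; [lra|exact EX|]; intros s Hs.
    rewrite Rabs_pos_eq by (apply Rdiv_le_0_compat; [left; apply exp_pos|nra]).
    apply Rle_trans with (exp (- (T ^ 2 * (1 + s ^ 2) / 2)) / 1).
    + apply Rmult_le_compat_l; [left; apply exp_pos|]. apply Rinv_le_contravar; nra.
    + rewrite Rdiv_1_r; apply exp_mono; nra.
Qed.

Lemma exp_neg_sq_le_inv (T : R) : 0 < T -> exp (- (T ^ 2 / 2)) <= 2 / T ^ 2.
Proof.
  intros H; rewrite exp_Ropp.
  replace (2 / T ^ 2) with (/ (T ^ 2 / 2)) by (field; lra).
  apply Rinv_le_contravar; [nra|].
  pose proof (exp_ineq1_le (T ^ 2 / 2)); lra.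
Qed.

Lemma gauss_limit (T : R) : 0 < T -> Rabs (gauss T - sqrt (PI / 2)) <= 4 / T ^ 2.
Proof.
  intros HT.
  pose proof (gauss_sq T) as H1; pose proof (gauss_aux_bounds T) as H2.
  pose proof (exp_neg_sq_le_inv T HT) as H3; pose proof (gauss_nonneg T ltac:(lra)) as H4.
  pose proof PI2_1 as HP.
  set (g := gauss T) in *; set (k := gauss_aux T) in *; set (e := exp _) in *.
  assert (Hs : sqrt (PI / 2) * sqrt (PI / 2) = PI / 2) by (apply sqrt_sqrt; lra).
  assert (Hs1 : 1 <= sqrt (PI / 2)) by (rewrite <- sqrt_1; apply sqrt_le_1; lra).
  set (s := sqrt (PI / 2)) in *.
  assert (H : (s - g) * (s + g) = 2 * k) by nra.
  assert (Hg : 0 <= s - g).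
  { destruct (Rle_lt_dec 0 (s - g)); [lra|exfalso; nra]. }
  rewrite Rabs_minus_sym, Rabs_pos_eq by lra.
  replace (4 / T ^ 2) with (2 * (2 / T ^ 2)) by (field; lra). nra.
Qed.

Definition dawson (xi : R) : R := RInt (fun t => exp (t ^ 2)) 0 xi.

Lemma is_derive_dawson (xi : R) : is_derive dawson xi (exp (xi ^ 2)).
Proof.
  apply (is_derive_RInt_smooth (fun u => exp (u ^ 2))).
  intros x; auto_derive; exact I.
Qed.

(** The truncated Fourier transform of a half Gaussian; [tau = 0] is its cosine part and
    [tau = PI / 2] minus its sine part. *)
Definition gaussF (T tau xi : R) : R :=
  RInt (fun u => cos (sqrt 2 * xi * u + tau) * exp (- (u ^ 2 / 2))) 0 T.

Lemma sqrt2_sq : sqrt 2 * sqrt 2 = 2.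
Proof. apply sqrt_sqrt; lra. Qed.

(** Differentiating in [xi] produces a factor [u], which integration by parts against
    [u exp (- u^2 / 2)] turns into a first order linear equation in [xi]. *)
Lemma is_derive_gaussF (T tau xi : R) :
  is_derive (gaussF T tau) xi
    (sqrt 2 * sin (sqrt 2 * xi * T + tau) * exp (- (T ^ 2 / 2)) - sqrt 2 * sin tau
     - 2 * xi * gaussF T tau xi).
Proof.
  unfold gaussF at 1.
  replace (sqrt 2 * sin (sqrt 2 * xi * T + tau) * exp (- (T ^ 2 / 2)) - sqrt 2 * sin tau
     - 2 * xi * gaussF T tau xi) with
    (RInt (fun u => - (sqrt 2 * u * sin (sqrt 2 * xi * u + tau) * exp (- (u * u * / 2)))) 0 T).
  - apply (is_derive_RInt_param_smooth
      (fun xi u => cos (sqrt 2 * xi * u + tau) * exp (- (u ^ 2 / 2)))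
      (fun xi u => - (sqrt 2 * u * sin (sqrt 2 * xi * u + tau) * exp (- (u * u * / 2))))).
    + intros x t; auto_derive; [exact I|].
      unfold Rdiv; replace (t * (t * 1)) with (t * t) by ring. ring.
    + intros x t; auto_derive; exact I.
    + intros x t; cont2d.
  - pose (G := fun u => sqrt 2 * sin (sqrt 2 * xi * u + tau) * exp (- (u ^ 2 / 2))).
    assert (EX : ex_RInt (fun u => cos (sqrt 2 * xi * u + tau) * exp (- (u ^ 2 / 2))) 0 T).
    { smooth_RInt. }
    assert (I1 : is_RInt (fun u => - (sqrt 2 * u * sin (sqrt 2 * xi * u + tau) * exp (- (u * u * / 2)))
         + 2 * xi * (cos (sqrt 2 * xi * u + tau) * exp (- (u ^ 2 / 2)))) 0 T (G T - G 0)).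
    { apply (is_RInt_derive G).
      - intros u _; unfold G; auto_derive; [exact I|].
        unfold Rdiv; replace (u * (u * 1)) with (u * u) by ring.
        transitivity ((sqrt 2 * sqrt 2 - 2) * (xi * cos (sqrt 2 * xi * u + tau) * exp (- (u * u * / 2))) +
          (- (sqrt 2 * u * sin (sqrt 2 * xi * u + tau) * exp (- (u * u * / 2))) +
          2 * xi * (cos (sqrt 2 * xi * u + tau) * exp (- (u ^ 2 / 2))))).
        + unfold Rdiv; replace (u ^ 2) with (u * u) by ring; field.
        + unfold Rdiv; rewrite sqrt2_sq; ring.
      - intros u _; smooth_at. }
    apply is_RInt_unique_R in I1.
    rewrite RInt_plus_R in I1.
    + rewrite RInt_scal_R in I1 by exact EX.
      unfold G, plus, scal in I1; simpl in I1; unfold mult in I1; simpl in I1.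
      unfold gaussF.
      replace (sqrt 2 * xi * 0 + tau) with tau in I1 by ring.
      replace (- (0 * (0 * 1) / 2)) with 0 in I1 by field. rewrite exp_0 in I1.
      simpl pow. lra.
    + smooth_RInt.
    + smooth_RInt.
Qed.

Lemma gaussF_0 (T tau : R) : gaussF T tau 0 = cos tau * gauss T.
Proof.
  unfold gaussF, gauss; rewrite <- RInt_scal_R.
  - apply RInt_ext; intros u _; unfold scal; simpl; unfold mult; simpl.
    f_equal; f_equal; ring.
  - smooth_RInt.
Qed.

Lemma Rabs_le_of_derive (f df : R -> R) (B x : R) :
  f 0 = 0 -> (forall t, is_derive f t (df t)) ->
  (forall t, Rabs t <= Rabs x -> Rabs (df t) <= B) -> Rabs (f x) <= B * Rabs x.
Proof.
  intros H0 Hd HB.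
  destruct (MVT_gen f 0 x df) as [c [Hc E]].
  - intros; apply Hd.
  - intros t _; apply derivable_continuous_pt; exists (df t); apply is_derive_Reals, Hd.
  - rewrite H0, !Rminus_0_r in E; rewrite E, Rabs_mult.
    apply Rmult_le_compat_r; [apply Rabs_pos|]; apply HB.
    unfold Rmin, Rmax in Hc; destruct (Rle_dec 0 x);
      unfold Rabs; repeat destruct Rcase_abs; lra.
Qed.

(** The limit of [gaussF] as [T] grows. *)
Definition gauss_lim (tau xi : R) : R :=
  exp (- xi ^ 2) * (cos tau * sqrt (PI / 2) - sqrt 2 * sin tau * dawson xi).

(** Up to the boundary term at [T], [exp (xi^2) gaussF] solves a differential equation
    that can be integrated from [xi = 0], where only the Gaussian integral remains. *)
Lemma gaussF_limit (T tau M xi : R) :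
  0 < T -> Rabs xi <= M ->
  Rabs (gaussF T tau xi - gauss_lim tau xi) <= (4 + 4 * M * exp (M ^ 2)) / T ^ 2.
Proof.
  intros HT Hxi.
  pose (h := fun x => exp (x ^ 2) * gaussF T tau x - cos tau * gauss T + sqrt 2 * sin tau * dawson x).
  pose (dh := fun x => exp (x ^ 2) * (sqrt 2 * sin (sqrt 2 * x * T + tau) * exp (- (T ^ 2 / 2)))).
  assert (Hd : forall t, is_derive h t (dh t)).
  { intros t; unfold h, dh.
    pose proof (is_derive_gaussF T tau t) as D1; pose proof (is_derive_dawson t) as D2.
    auto_derive.
    - repeat split; [eexists; apply D1|eexists; apply D2].
    - change (Derive (fun x => gaussF T tau x) t) with (Derive (gaussF T tau) t).
      change (Derive (fun x => dawson x) t) with (Derive dawson t).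
      rewrite (is_derive_unique _ _ _ D1), (is_derive_unique _ _ _ D2).
      simpl pow; ring. }
  assert (H0 : h 0 = 0).
  { unfold h; rewrite gaussF_0; unfold dawson; rewrite RInt_point.
    change (@zero R_CompleteNormedModule) with 0.
    replace (0 ^ 2) with 0 by ring; rewrite exp_0; ring. }
  pose proof (exp_neg_sq_le_inv T HT) as He.
  assert (Hs2 : 0 <= sqrt 2 <= 2).
  { split; [apply sqrt_pos|]. pose proof sqrt2_sq; pose proof (sqrt_pos 2); nra. }
  assert (HM : 0 <= M) by (eapply Rle_trans; [apply Rabs_pos|exact Hxi]).
  assert (HT2 : 0 < T ^ 2) by (apply pow_lt; lra).
  assert (HB : Rabs (h xi) <= (exp (M ^ 2) * (2 * (2 / T ^ 2))) * Rabs xi).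
  { apply (Rabs_le_of_derive h dh); [exact H0|exact Hd|].
    intros t Ht; unfold dh; rewrite !Rabs_mult, !(Rabs_pos_eq (exp _)) by (left; apply exp_pos).
    rewrite (Rabs_pos_eq (sqrt 2)) by lra.
    apply Rmult_le_compat; [left; apply exp_pos| | |].
    - repeat apply Rmult_le_pos; [lra|apply Rabs_pos|left; apply exp_pos].
    - apply exp_mono. rewrite <- (pow2_abs t); apply pow_incr; split; [apply Rabs_pos|lra].
    - apply Rmult_le_compat; [apply Rmult_le_pos; [lra|apply Rabs_pos]|left; apply exp_pos| |exact He].
      assert (Rabs (sin (sqrt 2 * t * T + tau)) <= 1) by (apply Rabs_le, SIN_bound).
      pose proof (Rabs_pos (sin (sqrt 2 * t * T + tau))). nra. }
  pose proof (gauss_limit T HT) as HG.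
  replace (gaussF T tau xi - gauss_lim tau xi) with
    (exp (- xi ^ 2) * (h xi + cos tau * (gauss T - sqrt (PI / 2)))).
  2:{ unfold h, gauss_lim.
      transitivity ((exp (- xi ^ 2) * exp (xi ^ 2)) * gaussF T tau xi
        - exp (- xi ^ 2) * (cos tau * sqrt (PI / 2) - sqrt 2 * sin tau * dawson xi)); [ring|].
      rewrite <- exp_plus; replace (- xi ^ 2 + xi ^ 2) with 0 by ring.
      rewrite exp_0; ring. }
  rewrite Rabs_mult, Rabs_pos_eq by (left; apply exp_pos).
  assert (Hex : exp (- xi ^ 2) <= 1) by (apply exp_neg_le_1, pow2_ge_0).
  assert (Hsum : Rabs (h xi + cos tau * (gauss T - sqrt (PI / 2)))
     <= (4 + 4 * M * exp (M ^ 2)) / T ^ 2).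
  { eapply Rle_trans; [apply Rabs_triang|]; rewrite Rabs_mult.
    assert (Rabs (cos tau) <= 1) by (apply Rabs_le, COS_bound).
    pose proof (Rabs_pos (gauss T - sqrt (PI / 2))). pose proof (Rabs_pos (cos tau)).
    replace ((4 + 4 * M * exp (M ^ 2)) / T ^ 2) with
      (exp (M ^ 2) * (2 * (2 / T ^ 2)) * M + 4 / T ^ 2) by (field; lra).
    apply Rplus_le_compat.
    - eapply Rle_trans; [exact HB|]. apply Rmult_le_compat_l; [|exact Hxi].
      apply Rmult_le_pos; [left; apply exp_pos|]. 
      apply Rmult_le_pos; [lra|apply Rdiv_le_0_compat; lra].
    - nra. }
  pose proof (Rabs_pos (h xi + cos tau * (gauss T - sqrt (PI / 2)))).
  pose proof (exp_pos (- xi ^ 2)). nra.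
Qed.

(** * Fourier integrals of the binomial law *)

Lemma is_derive_sum_f_R0 (f df : nat -> R -> R) (N : nat) (x : R) :
  (forall m, is_derive (f m) x (df m x)) ->
  is_derive (fun x => sum_f_R0 (fun m => f m x) N) x (sum_f_R0 (fun m => df m x) N).
Proof.
  intros H; induction N as [|N IH]; cbn [sum_f_R0]; [apply H|].
  apply (is_derive_plus (fun x => sum_f_R0 (fun m => f m x) N) (f (S N))); [exact IH|apply H].
Qed.

Lemma is_derive_Ebin (p q : R) (N : nat) (f df : nat -> R -> R) (x : R) :
  (forall m, is_derive (f m) x (df m x)) ->
  is_derive (fun x => Ebin p q N (fun m => f m x)) x (Ebin p q N (fun m => df m x)).
Proof.
  intros H; unfold Ebin.
  apply (is_derive_sum_f_R0 (fun m x => Binomial.C N m * q ^ m * p ^ (N - m) * f m x)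
    (fun m x => Binomial.C N m * q ^ m * p ^ (N - m) * df m x)).
  intros m; apply is_derive_scal, H.
Qed.

Lemma ex_derive_Ebin (p q : R) (N : nat) (f : nat -> R -> R) (x : R) :
  (forall m x, ex_derive (f m) x) ->
  ex_derive (fun x => Ebin p q N (fun m => f m x)) x.
Proof.
  intros H; exists (Ebin p q N (fun m => Derive (f m) x)).
  apply (is_derive_Ebin p q N f (fun m => Derive (f m))).
  intros m; apply Derive_correct, H.
Qed.

(** Standard deviation of the binomial law. *)
Definition scale (p q : R) (N : nat) : R := sqrt (p * q * INR N).

(** The argument [x = N y] of the Krawtchouk polynomial; [sqrt 2 * xi] measures its
    distance from the mean [q N] in standard deviations. *)
Definition node (p q : R) (N : nat) (xi : R) : R := q * INR N + sqrt 2 * xi * scale p q N.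

Definition fourier (p q : R) (N : nat) (x tau : R) : R :=
  RInt (fun psi => Ebin p q N (fun m => cos (psi * (INR m - x) - tau))) 0 PI.

Lemma scale_large (p q : R) : 0 < p * q -> forall S : R,
  exists N0, forall N, (N0 <= N)%nat -> S <= scale p q N.
Proof.
  intros Hpq S; destruct (INR_unbounded (S ^ 2 / (p * q))) as [N0 H0].
  exists N0; intros N HN; unfold scale.
  apply le_INR in HN.
  assert (H : S ^ 2 <= p * q * INR N).
  { apply Rle_trans with (p * q * (S ^ 2 / (p * q))); [right; field; split; intros ->; lra|].
    apply Rmult_le_compat_l; lra. }
  eapply Rle_trans; [apply Rle_abs|].
  rewrite <- sqrt_Rsqr_abs; apply sqrt_le_1_alt; rewrite Rsqr_pow2; exact H.
Qed.

Section Laplace.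
Variables p q : R.
Hypotheses (hp : 0 < p) (hq : 0 < q) (hpq : p + q = 1).

Lemma scale_sq (N : nat) : scale p q N ^ 2 = p * q * INR N.
Proof.
  unfold scale; rewrite <- Rsqr_pow2, Rsqr_sqrt; [reflexivity|].
  apply Rmult_le_pos; [nra|apply pos_INR].
Qed.

Lemma Ebin_node (N : nat) (xi tau psi : R) :
  Ebin p q N (fun m => cos (psi * (INR m - node p q N xi) - tau))
  = Ebin p q N (fun m => cos (psi * (INR m - q * INR N) -
      (sqrt 2 * xi * (scale p q N * psi) + tau))).
Proof. apply Ebin_ext; intros; unfold node; f_equal; ring. Qed.

Lemma fourier_ex_RInt (N : nat) (x tau a b : R) :
  ex_RInt (fun psi => Ebin p q N (fun m => cos (psi * (INR m - x) - tau))) a b.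
Proof.
  apply ex_RInt_of_derivable; intros y.
  apply (ex_derive_Ebin p q N (fun m psi => cos (psi * (INR m - x) - tau))).
  intros; auto_derive; exact I.
Qed.

(** Substitute [u = scale * psi]. On [u <= T] the binomial characteristic function is
    close to [exp (- u^2 / 2)]; beyond, its Gaussian bound is dominated by a decaying
    exponential whose integral is at most [18 / T]. *)
Lemma fourier_gaussF (N : nat) (xi tau T : R) :
  1 <= T <= scale p q N ->
  Rabs (scale p q N * fourier p q N (node p q N xi) tau - gaussF T tau xi)
  <= T ^ 4 / (p * q * scale p q N) + 18 / T.
Proof.
  intros [HT1 HTs].
  pose proof (scale_sq N) as Hs2.
  unfold fourier.
  set (s := scale p q N) in *.
  assert (Hs : 0 < s) by lra.
  set (F := fun psi => Ebin p q N (fun m => cos (psi * (INR m - node p q N xi) - tau))).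
  assert (HF : forall a b, ex_RInt F a b) by (intros; apply fourier_ex_RInt).
  assert (HTs0 : 0 < T / s <= 1).
  { split; [apply Rdiv_lt_0_compat; lra|]. apply Rmult_le_reg_r with s; [lra|].
    unfold Rdiv; rewrite Rmult_assoc, Rinv_l; lra. }
  assert (EC := RInt_Chasles F 0 (T / s) PI (HF _ _) (HF _ _)).
  rewrite <- EC; unfold plus; simpl.
  set (G := fun psi => cos (sqrt 2 * xi * (s * psi) + tau) * exp (- (p * q * INR N * psi ^ 2 / 2))).
  assert (HG : forall a b, ex_RInt G a b).
  { intros; apply ex_RInt_of_derivable; intros; unfold G; auto_derive; exact I. }
  assert (EG : gaussF T tau xi = s * RInt G 0 (T / s)).
  { unfold gaussF.
    replace (RInt (fun u => cos (sqrt 2 * xi * u + tau) * exp (- (u ^ 2 / 2))) 0 T)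
      with (RInt (fun u => cos (sqrt 2 * xi * u + tau) * exp (- (u ^ 2 / 2))) (s * 0 + 0) (s * (T / s) + 0)).
    2:{ replace (s * 0 + 0) with 0 by ring; replace (s * (T / s) + 0) with T by (field; lra); reflexivity. }
    rewrite <- RInt_comp_lin.
    2:{ smooth_RInt. }
    rewrite RInt_scal_R.
    2:{ smooth_RInt. }
    unfold scal; simpl; unfold mult; simpl; f_equal.
    apply RInt_ext; intros u _; unfold G; rewrite Rplus_0_r.
    f_equal; f_equal; rewrite <- Hs2; eqR; field. }
  rewrite EG.
  replace (s * (RInt F 0 (T / s) + RInt F (T / s) PI) - s * RInt G 0 (T / s))
    with (s * (RInt F 0 (T / s) - RInt G 0 (T / s)) + s * RInt F (T / s) PI) by ring.
  eapply Rle_trans; [apply Rabs_triang|]; rewrite !Rabs_mult, (Rabs_pos_eq s) by lra.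
  apply Rplus_le_compat.
  - assert (EM : RInt F 0 (T / s) - RInt G 0 (T / s) = RInt (fun u => F u - G u) 0 (T / s)).
    { symmetry; apply RInt_minus_R; auto. }
    rewrite EM.
    apply Rle_trans with (s * ((T / s - 0) * (INR N * (T / s) ^ 3))).
    + apply Rmult_le_compat_l; [lra|].
      apply abs_RInt_le_const; [lra|apply (ex_RInt_minus (V := R_NormedModule)); auto|].
      intros psi Hpsi; unfold F, G; rewrite Ebin_node.
      eapply Rle_trans; [apply Ebin_cos_gauss; try assumption; lra|].
      apply Rmult_le_compat_l; [apply pos_INR|apply pow_incr; exact Hpsi].
    + right. replace (INR N) with (s ^ 2 / (p * q)) by (rewrite Hs2; field; lra).
      field; lra.
  - pose proof PI2_1.
    assert (IE : is_RInt (fun psi => exp (- (T * s * psi / 18))) (T / s) PI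
       (18 / (T * s) * exp (- (T * s * (T / s) / 18)) - 18 / (T * s) * exp (- (T * s * PI / 18)))).
    { replace (18 / (T * s) * exp (- (T * s * (T / s) / 18)) - 18 / (T * s) * exp (- (T * s * PI / 18)))
        with (- (18 / (T * s) * exp (- (T * s * PI / 18))) - - (18 / (T * s) * exp (- (T * s * (T / s) / 18)))) by ring.
      apply (is_RInt_derive (fun psi => - (18 / (T * s) * exp (- (T * s * psi / 18))))).
      - intros psi _; auto_derive; [exact I|]. unfold Rdiv; field; lra.
      - intros psi _; smooth_at. }
    assert (HB : Rabs (RInt F (T / s) PI) <= 18 / (T * s)).
    { eapply Rle_trans.
      - apply (norm_RInt_le (V := R_NormedModule) F (fun psi => exp (- (T * s * psi / 18))) (T / s) PI);
          [lra| |apply RInt_correct_R, HF|exact IE].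
        intros psi Hpsi; unfold F; rewrite Ebin_node.
        eapply Rle_trans; [apply Ebin_cos_bound; try assumption; lra|].
        apply exp_mono; rewrite <- Hs2.
        assert (T <= s * psi).
        { replace T with (s * (T / s)) by (field; lra). apply Rmult_le_compat_l; lra. }
        enough (T * s * psi <= s ^ 2 * psi ^ 2) by lra.
        replace (s ^ 2 * psi ^ 2) with ((s * psi) * (s * psi)) by ring.
        rewrite Rmult_assoc; apply Rmult_le_compat_r; lra.
      - assert (0 < 18 / (T * s)) by (apply Rdiv_lt_0_compat; nra).
        assert (exp (- (T * s * (T / s) / 18)) <= 1).
        { apply exp_neg_le_1; replace (T * s * (T / s) / 18) with (T ^ 2 / 18) by (field; lra); nra. }
        pose proof (exp_pos (- (T * s * PI / 18))). nra. }
    apply Rle_trans with (s * (18 / (T * s))); [apply Rmult_le_compat_l; lra|].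
    right; field; lra.
Qed.

Lemma fourier_limit (tau M eta : R) : 0 <= M -> 0 < eta ->
  exists N0, forall N, (N0 <= N)%nat -> forall xi, Rabs xi <= M ->
  Rabs (scale p q N * fourier p q N (node p q N xi) tau - gauss_lim tau xi) <= eta.
Proof.
  intros HM He.
  set (c := 4 + 4 * M * exp (M ^ 2)).
  assert (Hc : 0 < c) by (unfold c; pose proof (exp_pos (M ^ 2)); nra).
  (* Large enough for 18 / T and for the truncation error c / T^2 together. *)
  set (T := 1 + 3 * (18 + c) / eta).
  assert (H3 : 0 < 3 * (18 + c) / eta) by (apply Rdiv_lt_0_compat; lra).
  assert (HT : 1 <= T) by (unfold T; lra).
  assert (HTe : 18 + c <= eta / 3 * T).
  { apply Rle_trans with (eta / 3 * (3 * (18 + c) / eta)); [right; field; lra|].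
    apply Rmult_le_compat_l; [lra|unfold T; lra]. }
  assert (Hpq : 0 < p * q) by nra.
  destruct (scale_large p q Hpq (T + 3 * T ^ 4 / (p * q * eta))) as [N0 HN0].
  exists N0; intros N HN xi Hxi; specialize (HN0 N HN).
  assert (HT4 : 0 < T ^ 4) by (apply pow_lt; lra).
  assert (0 < 3 * T ^ 4 / (p * q * eta)) by (apply Rdiv_lt_0_compat; nra).
  pose proof (fourier_gaussF N xi tau T ltac:(lra)) as A.
  pose proof (gaussF_limit T tau M xi ltac:(lra) Hxi) as B. fold c in B.
  set (s := scale p q N) in *.
  assert (E1 : T ^ 4 / (p * q * s) <= eta / 3).
  { apply Rmult_le_reg_r with (p * q * s); [nra|].
    unfold Rdiv at 1; rewrite Rmult_assoc, Rinv_l by nra.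
    apply Rle_trans with (eta / 3 * (p * q * (3 * T ^ 4 / (p * q * eta)))); [right; field; split; lra|].
    apply Rmult_le_compat_l; [lra|]; apply Rmult_le_compat_l; lra. }
  assert (E2 : 18 / T + c / T ^ 2 <= eta / 3).
  { apply Rle_trans with ((18 + c) / T).
    - replace ((18 + c) / T) with (18 / T + c / T ^ 2 * T) by (field; lra).
      assert (0 < c / T ^ 2) by (apply Rdiv_lt_0_compat; nra). nra.
    - apply Rmult_le_reg_r with T; [lra|].
      unfold Rdiv at 1; rewrite Rmult_assoc, Rinv_l by lra; lra. }
  replace (s * fourier p q N (node p q N xi) tau - gauss_lim tau xi) with
   ((s * fourier p q N (node p q N xi) tau - gaussF T tau xi) + (gaussF T tau xi - gauss_lim tau xi)) by ring.
  eapply Rle_trans; [apply Rabs_triang|]; lra.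
Qed.

End Laplace.

(** Fourier inversion at a node: a local limit theorem for the binomial weights will
    follow from the same asymptotics as for the Krawtchouk polynomial. *)
Lemma fourier_nat (p q : R) (N m : nat) : (m <= N)%nat ->
  fourier p q N (INR m) 0 = PI * (Binomial.C N m * q ^ m * p ^ (N - m)).
Proof.
  intros Hm; unfold fourier.
  pose (A := fun (k : nat) (psi : R) =>
    if Nat.eq_dec k m then psi else sin (psi * (INR k - INR m)) / (INR k - INR m)).
  rewrite (is_RInt_unique _ _ _ (minus (Ebin p q N (fun k => A k PI)) (Ebin p q N (fun k => A k 0)))).
  - assert (E0 : Ebin p q N (fun k => A k 0) = 0).
    { unfold Ebin; rewrite (sum_eq _ (fun _ => 0)).
      - rewrite sum_cte; ring.
      - intros k Hk; unfold A; destruct (Nat.eq_dec k m); [ring|].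
        rewrite Rmult_0_l, sin_0; unfold Rdiv; ring. }
    rewrite E0; unfold minus, plus, opp; simpl; rewrite Ropp_0, Rplus_0_r.
    unfold Ebin; rewrite (sum_f_R0_single _ m N Hm).
    + unfold A; destruct (Nat.eq_dec m m); [ring|lia].
    + intros k _ Hk; unfold A; destruct (Nat.eq_dec k m); [lia|].
      rewrite sin_eq_0_1; [unfold Rdiv; ring|].
      exists (Z.of_nat k - Z.of_nat m)%Z; rewrite minus_IZR, <- !INR_IZR_INZ; ring.
  - apply (is_RInt_derive (fun psi => Ebin p q N (fun k => A k psi))).
    + intros psi _; apply (is_derive_Ebin p q N A (fun k psi => cos (psi * (INR k - INR m) - 0))).
      intros k; unfold A; destruct (Nat.eq_dec k m) as [->|Hk].
      * rewrite Rminus_diag, Rmult_0_r, Rminus_0_r, cos_0; apply is_derive_Reals, derivable_pt_lim_id.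
      * assert (INR k - INR m <> 0) by (apply Rminus_eq_contra, not_INR, Hk).
        auto_derive; [exact I|]; rewrite Rminus_0_r; field; assumption.
    + intros psi _; apply continuous_of_derivable.
      apply (ex_derive_Ebin p q N (fun k psi => cos (psi * (INR k - INR m) - 0))).
      intros; auto_derive; exact I.
Qed.

Lemma fourier_split (p q : R) (N : nat) (x tau : R) :
  fourier p q N x tau = cos tau * fourier p q N x 0 + sin tau * fourier p q N x (PI / 2).
Proof.
  unfold fourier.
  assert (EX : forall t, ex_RInt (fun psi => Ebin p q N (fun m => cos (psi * (INR m - x) - t))) 0 PI)
    by (intros; apply fourier_ex_RInt).
  rewrite <- !RInt_scal_R by apply EX.
  rewrite <- RInt_plus_R by apply ex_RInt_scal_R, EX.
  apply RInt_ext; intros psi _; unfold plus, scal; simpl; unfold mult; simpl.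
  rewrite <- !Ebin_scal, <- Ebin_plus; apply Ebin_ext; intros m _.
  rewrite !cos_minus, cos_PI2, sin_PI2, cos_0, sin_0; ring.
Qed.

(** Since [sin (PI m) = 0], integrating [cos (PI x - psi (x - m))] over [0, PI] gives
    exactly [sin (PI x) / (x - m)]. This replaces the singular Cauchy kernel by a smooth
    Fourier integral. *)
Lemma Ebin_frac_fourier (p q : R) (N : nat) (x : R) :
  (forall m, (m <= N)%nat -> x <> INR m) ->
  sin (PI * x) * Ebin p q N (fun m => / (x - INR m)) = fourier p q N x (- (PI * x)).
Proof.
  intros Hx; unfold fourier; symmetry.
  pose (A := fun (k : nat) (psi : R) => - sin (PI * x + psi * (INR k - x)) / (x - INR k)).
  assert (EI : is_RInt (fun psi => Ebin p q N (fun m => cos (psi * (INR m - x) - - (PI * x)))) 0 PI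
     (minus (Ebin p q N (fun k => A k PI)) (Ebin p q N (fun k => A k 0)))).
  { assert (NZ : exists A', (forall m, (m <= N)%nat -> forall psi, A' m psi = A m psi) /\
      (forall m psi, is_derive (A' m) psi (if le_dec m N then cos (psi * (INR m - x) - - (PI * x)) else 0))).
    { exists (fun m => if le_dec m N then A m else fun _ => 0); split.
      - intros m Hm psi; destruct (le_dec m N); [reflexivity|lia].
      - intros m psi; destruct (le_dec m N) as [Hm|Hm].
        + unfold A; specialize (Hx m Hm).
          replace (psi * (INR m - x) - - (PI * x)) with (PI * x + psi * (INR m - x)) by ring.
          auto_derive; [exact I|]. field. apply Rminus_eq_contra, Hx.
        + apply is_derive_const_R. }
    destruct NZ as [A' [HA1 HA2]].
    rewrite <- (Ebin_ext _ _ _ (fun k => A' k PI) (fun k => A k PI)) by (intros; now apply HA1).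
    rewrite <- (Ebin_ext _ _ _ (fun k => A' k 0) (fun k => A k 0)) by (intros; now apply HA1).
    apply (is_RInt_derive (fun psi => Ebin p q N (fun k => A' k psi))).
    - intros psi _.
      rewrite (Ebin_ext _ _ _ _ (fun m => (fun m psi => if le_dec m N then cos (psi * (INR m - x) - - (PI * x)) else 0) m psi)).
      2:{ intros m Hm; simpl; destruct (le_dec m N); [reflexivity|lia]. }
      apply (is_derive_Ebin p q N A' (fun m psi => if le_dec m N then cos (psi * (INR m - x) - - (PI * x)) else 0)).
      intros m; apply HA2.
    - intros psi _; apply continuous_of_derivable.
      apply (ex_derive_Ebin p q N (fun k psi => cos (psi * (INR k - x) - - (PI * x)))).
      intros; auto_derive; exact I. }
  rewrite (is_RInt_unique _ _ _ _ EI); unfold minus, plus, opp; simpl.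
  replace (- Ebin p q N (fun k => A k 0)) with (Ebin p q N (fun k => (-1) * A k 0))
    by (rewrite Ebin_scal; ring).
  rewrite <- Ebin_plus, <- Ebin_scal; apply Ebin_ext; intros m Hm; unfold A.
  replace (PI * x + PI * (INR m - x)) with (IZR (Z.of_nat m) * PI)
    by (rewrite <- INR_IZR_INZ; ring).
  rewrite (sin_eq_0_1 (IZR (Z.of_nat m) * PI)) by (now exists (Z.of_nat m)).
  rewrite Rmult_0_l, Rplus_0_r; field; apply Rminus_eq_contra, Hx, Hm.
Qed.

(** * Euler product of the sine with remainder *)

(** The Pochhammer ratio [(1 + c)_M / M!]. *)
Fixpoint rising_ratio (c : R) (M : nat) : R :=
  match M with
  | O => 1
  | S M' => rising_ratio c M' * (1 + c / INR (S M'))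
  end.

Definition cos_moment (M : nat) (f : R) : R :=
  RInt (fun psi => cos (psi / 2) ^ (2 * M) * cos (f * psi)) 0 PI.

Lemma cos_moment_ex (M : nat) (f a b : R) :
  ex_RInt (fun psi => cos (psi / 2) ^ (2 * M) * cos (f * psi)) a b.
Proof.
  apply ex_RInt_of_derivable; intros x; auto_derive; exact I.
Qed.

Lemma cos_moment_S (M : nat) (f : R) :
  (INR (S M) ^ 2 - f ^ 2) * cos_moment (S M) f = INR (S M) * (INR (S M) - / 2) * cos_moment M f.
Proof.
  unfold cos_moment.
  assert (EX := cos_moment_ex M f 0 PI); assert (EX' := cos_moment_ex (S M) f 0 PI).
  replace (2 * S M)%nat with (S (S (2 * M))) in * by lia.
  assert (Hn : INR (2 * M) = 2 * INR M) by (rewrite mult_INR; simpl; ring).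
  set (n := (2 * M)%nat) in *; clearbody n.
  (* G vanishes at both ends and its derivative is the difference of the two integrands. *)
  pose (G := fun psi => INR (S M) * (cos (psi / 2) ^ (S n) * sin (psi / 2) * cos (f * psi))
     - f * (cos (psi / 2) ^ (S (S n)) * sin (f * psi))).
  assert (E : is_RInt (fun psi => (INR (S M) ^ 2 - f ^ 2) * (cos (psi / 2) ^ (S (S n)) * cos (f * psi))
     - INR (S M) * (INR (S M) - / 2) * (cos (psi / 2) ^ n * cos (f * psi))) 0 PI (minus (G PI) (G 0))).
  { apply (is_RInt_derive G).
    - intros psi _; unfold G; auto_derive; [exact I|].
      change (psi * / 2) with (psi / 2).
      set (c := cos (psi / 2)); set (s := sin (psi / 2)).
      assert (Hs : s * s = 1 - c * c).
      { unfold s, c; pose proof (sin2_cos2 (psi / 2)); unfold Rsqr in *; lra. }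
      change (match n with O => 1 | S _ => INR n + 1 end) with (INR (S n)).
      change (match M with O => 1 | S _ => INR M + 1 end) with (INR (S M)).
      cbn [pow]; rewrite !S_INR, Hn.
      transitivity (- ((INR M + 1) * ((2 * INR M + 1) / 2) * (s * s) * c ^ n * cos (f * psi))
         + ((INR M + 1) / 2 - f * f) * (c * c) * c ^ n * cos (f * psi)).
      + field.
      + rewrite Hs; field.
    - intros psi _; smooth_at. }
  assert (EG : minus (G PI) (G 0) = 0).
  { assert (E1 : G PI = 0) by (unfold G; cbn [pow]; rewrite cos_PI2; ring).
    assert (E2 : G 0 = 0).
    { unfold G; replace (0 / 2) with 0 by field; rewrite Rmult_0_r, sin_0; ring. }
    rewrite E1, E2; apply (minus_eq_zero (G := R_AbelianGroup)). }
  rewrite EG in E; apply is_RInt_unique_R in E.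
  rewrite (RInt_minus_R
    (fun psi => (INR (S M) ^ 2 - f ^ 2) * (cos (psi / 2) ^ (S (S n)) * cos (f * psi)))
    (fun psi => INR (S M) * (INR (S M) - / 2) * (cos (psi / 2) ^ n * cos (f * psi)))) in E.
  - rewrite RInt_scal_R in E by exact EX'.
    rewrite RInt_scal_R in E by exact EX.
    unfold minus, plus, opp, scal in E; simpl in E; unfold mult in E; simpl in E.
    simpl; lra.
  - apply ex_RInt_scal_R, EX'.
  - apply ex_RInt_scal_R, EX.
Qed.

Lemma cos_moment_0 (f : R) : f * cos_moment 0 f = sin (PI * f).
Proof.
  unfold cos_moment.
  rewrite <- RInt_scal_R by apply cos_moment_ex.
  rewrite (is_RInt_unique _ _ _ (minus (sin (f * PI)) (sin (f * 0)))).
  - unfold minus, plus, opp; simpl; rewrite Rmult_0_r, sin_0, Rmult_comm; ring.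
  - apply (is_RInt_derive (fun psi => sin (f * psi))).
    + intros psi _; unfold scal; simpl; unfold mult; simpl; auto_derive; [exact I|ring].
    + intros psi _; apply continuous_of_derivable; unfold scal; simpl; unfold mult; simpl; auto_derive; exact I.
Qed.

Lemma cos_moment_0_0 : cos_moment 0 0 = PI.
Proof.
  unfold cos_moment; rewrite (RInt_ext _ (fun _ => 1)).
  - rewrite RInt_const; unfold scal; simpl; unfold mult; simpl; ring.
  - intros x _; rewrite Rmult_0_l, cos_0; simpl; eqR; ring.
Qed.

(** The recursion [cos_moment_S] multiplies up to a partial Euler product, with an
    explicit remainder instead of a limit: the quotient of [cos_moment M f] by
    [cos_moment M 0]. *)
Lemma cos_moment_product (M : nat) (f : R) :
  exists c, 0 < c /\ cos_moment M 0 = PI * c /\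
  f * rising_ratio f M * rising_ratio (- f) M * cos_moment M f = sin (PI * f) * c.
Proof.
  induction M as [|M [c [Hc [H0 Hf]]]].
  - exists 1; repeat split; [lra|rewrite cos_moment_0_0; ring|].
    simpl; rewrite <- cos_moment_0; ring.
  - assert (Hk : 1 <= INR (S M)) by (rewrite S_INR; pose proof (pos_INR M); lra).
    set (k := INR (S M)) in *.
    exists (c * (1 - / (2 * k))); repeat split.
    + apply Rmult_lt_0_compat; [exact Hc|].
      assert (/ (2 * k) <= / 2) by (apply Rinv_le_contravar; lra); lra.
    + pose proof (cos_moment_S M 0) as E; fold k in E; rewrite H0 in E.
      replace (cos_moment (S M) 0) with ((k ^ 2 - 0 ^ 2) * cos_moment (S M) 0 / k ^ 2) by (field; lra).
      rewrite E; field; lra.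
    + cbn [rising_ratio]; fold k.
      pose proof (cos_moment_S M f) as E; fold k in E.
      transitivity (f * rising_ratio f M * rising_ratio (- f) M * ((k ^ 2 - f ^ 2) * cos_moment (S M) f) / k ^ 2);
        [field; lra|].
      rewrite E.
      transitivity (f * rising_ratio f M * rising_ratio (- f) M * cos_moment M f * ((k - / 2) / k)); [field; lra|].
      rewrite Hf; field; lra.
Qed.

(** [cos (f psi)] lies between [cos psi] and [1], and for [f = 1] the moment reduces to
    [f = 0] by [cos psi = 2 cos^2 (psi / 2) - 1]. So the remainder of the Euler product
    is [1 + O(1 / M)] uniformly in [f]. *)
Lemma cos_moment_bounds (M : nat) (f : R) : 0 <= f <= 1 ->
  INR M / INR (S M) * cos_moment M 0 <= cos_moment M f <= cos_moment M 0.
Proof.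
  intros Hf.
  assert (Hk : 1 <= INR (S M)) by (rewrite S_INR; pose proof (pos_INR M); lra).
  assert (Hw : forall psi, 0 <= cos (psi / 2) ^ (2 * M)).
  { intros psi; rewrite pow_mult; apply pow_le, pow2_ge_0. }
  assert (H1 : cos_moment M 1 = INR M / INR (S M) * cos_moment M 0).
  { pose proof (cos_moment_S M 0) as E.
    assert (E1 : cos_moment M 1 = 2 * cos_moment (S M) 0 - cos_moment M 0).
    { unfold cos_moment.
      rewrite <- RInt_scal_R by apply cos_moment_ex.
      rewrite <- RInt_minus_R; [|apply ex_RInt_scal_R|]; try apply cos_moment_ex.
      apply RInt_ext; intros psi _; unfold minus, plus, opp, scal; simpl; unfold mult; simpl.
      rewrite !Rmult_0_l, cos_0, Rmult_1_l.
      replace (cos psi) with (2 * cos (psi / 2) * cos (psi / 2) - 1).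
      2:{ rewrite <- cos_2a_cos; f_equal; field. }
      replace (M + S (M + 0))%nat with (S (2 * M)) by lia.
      replace (M + (M + 0))%nat with (2 * M)%nat by lia.
      cbn [pow]; eqR; ring. }
    rewrite E1, S_INR in *.
    set (k := INR M) in *.
    replace (cos_moment (S M) 0) with (((k + 1) ^ 2 - 0 ^ 2) * cos_moment (S M) 0 / (k + 1) ^ 2) by (field; lra).
    rewrite E; field; lra. }
  rewrite <- H1; pose proof PI_RGT_0; split; apply RInt_le; try lra; try apply cos_moment_ex;
    intros psi Hpsi; apply Rmult_le_compat_l; try apply Hw.
  - rewrite Rmult_1_l; apply cos_decr_1; nra.
  - rewrite Rmult_0_l, cos_0; apply COS_bound.
Qed.

(** Bernoulli's inequality for exponents in [[0, 1]], by convexity of [exp]. *)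
Lemma Rpower_bernoulli (a f : R) : 0 < a -> 0 <= f <= 1 -> Rpower a f <= 1 + f * (a - 1).
Proof.
  intros Ha Hf; unfold Rpower.
  set (c := f * ln a).
  pose proof (exp_ineq1_le (- c)) as H1; pose proof (exp_ineq1_le (ln a - c)) as H2.
  pose proof (exp_pos c).
  assert (E0 : exp c * exp (- c) = 1) by (rewrite <- exp_plus, Rplus_opp_r; apply exp_0).
  assert (E1 : exp c * exp (ln a - c) = a).
  { rewrite <- exp_plus; replace (c + (ln a - c)) with (ln a) by ring; now apply exp_ln. }
  assert (A0 : exp c * (1 - c) <= 1) by (rewrite <- E0; apply Rmult_le_compat_l; lra).
  assert (A1 : exp c * (1 + (ln a - c)) <= a) by (rewrite <- E1 at 2; apply Rmult_le_compat_l; lra).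
  replace (exp c) with ((1 - f) * (exp c * (1 - c)) + f * (exp c * (1 + (ln a - c)))).
  2:{ unfold c; ring. }
  nra.
Qed.

Lemma Rpower_near_1 (r f d : R) : 0 < r -> 0 <= f <= 1 -> Rabs (r - 1) <= d ->
  1 - d <= Rpower r f <= 1 + d.
Proof.
  intros Hr Hf Hd; apply Rabs_le_between in Hd; split.
  - assert (Hi : Rpower (/ r) f <= 1 + f * (/ r - 1)) by (apply Rpower_bernoulli; [now apply Rinv_0_lt_compat|exact Hf]).
    destruct (Rle_lt_dec 1 r) as [H|H].
    + apply Rle_trans with 1; [lra|]. rewrite <- (Rpower_O r Hr).
      apply Rle_Rpower; lra.
    + apply Rle_trans with r; [lra|].
      rewrite <- (Rpower_1 r Hr) at 1. unfold Rpower; apply exp_mono.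
      assert (ln r <= 0) by (rewrite <- ln_1; left; apply ln_increasing; lra). nra.
  - pose proof (Rpower_bernoulli r f Hr Hf). nra.
Qed.

Lemma rising_ratio_pos (f : R) (M : nat) : 0 <= f < 1 -> 0 < rising_ratio (- f) M.
Proof.
  intros Hf; induction M as [|M IH]; cbn [rising_ratio]; [lra|].
  apply Rmult_lt_0_compat; [exact IH|].
  assert (Hk : 1 <= INR (S M)) by (rewrite S_INR; pose proof (pos_INR M); lra).
  assert (/ INR (S M) <= 1) by (rewrite <- Rinv_1; apply Rinv_le_contravar; lra).
  assert (0 < / INR (S M)) by (apply Rinv_0_lt_compat; lra).
  unfold Rdiv; nra.
Qed.

Lemma Rpower_div (a b f : R) : 0 < a -> 0 < b -> Rpower a f = Rpower (a / b) f * Rpower b f.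
Proof.
  intros Ha Hb; rewrite Rpower_mult_distr; [|now apply Rdiv_lt_0_compat|exact Hb].
  f_equal; field; lra.
Qed.

Lemma rising_ratio_incr (f : R) (M : nat) : 0 <= f < 1 ->
  rising_ratio (- f) (S M) * Rpower (INR (S M)) f
  <= rising_ratio (- f) (S (S M)) * Rpower (INR (S (S M))) f.
Proof.
  intros Hf; pose proof (rising_ratio_pos f (S M) Hf) as Hp.
  remember (S M) as k eqn:Ek; cbn [rising_ratio].
  assert (Hk : 1 <= INR k) by (subst k; rewrite S_INR; pose proof (pos_INR M); lra).
  rewrite (S_INR k); rewrite (Rpower_div (INR k) (INR k + 1)) by lra.
  replace (rising_ratio (- f) k * (Rpower (INR k / (INR k + 1)) f * Rpower (INR k + 1) f))
    with (rising_ratio (- f) k * Rpower (INR k / (INR k + 1)) f * Rpower (INR k + 1) f) by ring.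
  apply Rmult_le_compat_r; [left; apply exp_pos|]; apply Rmult_le_compat_l; [lra|].
  eapply Rle_trans; [apply Rpower_bernoulli; [apply Rdiv_lt_0_compat; lra|lra]|].
  right; field; lra.
Qed.

Lemma rising_ratio_decr (f : R) (M : nat) : 0 <= f < 1 ->
  rising_ratio (- f) (S M) * Rpower (INR (S M) + 1) f
  <= rising_ratio (- f) M * Rpower (INR M + 1) f.
Proof.
  intros Hf; pose proof (rising_ratio_pos f M Hf) as Hp; cbn [rising_ratio].
  assert (Hk : 0 <= INR M) by apply pos_INR.
  rewrite S_INR; set (k := INR M + 1); assert (1 <= k) by (unfold k; lra).
  rewrite (Rpower_div (k + 1) k) by lra.
  replace (rising_ratio (- f) M * (1 + - f / k) * (Rpower ((k + 1) / k) f * Rpower k f))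
    with (rising_ratio (- f) M * ((1 + - f / k) * Rpower ((k + 1) / k) f) * Rpower k f) by ring.
  apply Rmult_le_compat_r; [left; apply exp_pos|].
  rewrite <- (Rmult_1_r (rising_ratio (- f) M)) at 2; apply Rmult_le_compat_l; [lra|].
  assert (Hinv : 0 < / k <= 1).
  { split; [apply Rinv_0_lt_compat; lra|rewrite <- Rinv_1; apply Rinv_le_contravar; lra]. }
  apply Rle_trans with ((1 + - f / k) * (1 + f * / k)).
  - apply Rmult_le_compat_l; [unfold Rdiv; nra|].
    eapply Rle_trans; [apply Rpower_bernoulli; [apply Rdiv_lt_0_compat; lra|lra]|].
    right; field; lra.
  - unfold Rdiv; nra.
Qed.

(** The sequence [(1 - f)_M / M! * M^f] increases and [(1 - f)_M / M! * (M + 1)^f]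
    decreases, and they are asymptotically equal; hence every term of the former is
    below every term of the latter, whatever the order of the indices. *)
Lemma rising_ratio_cross (f : R) (a b : nat) : 0 <= f < 1 -> (1 <= a)%nat ->
  rising_ratio (- f) a * Rpower (INR a) f <= rising_ratio (- f) b * Rpower (INR b + 1) f.
Proof.
  intros Hf Ha.
  assert (Hst : forall c, (1 <= c)%nat ->
    rising_ratio (- f) c * Rpower (INR c) f <= rising_ratio (- f) c * Rpower (INR c + 1) f).
  { intros c Hc; apply le_INR in Hc; simpl in Hc.
    apply Rmult_le_compat_l; [left; now apply rising_ratio_pos|].
    apply Rle_Rpower_l; lra. }
  destruct (le_lt_dec a b) as [H|H].
  - apply Rle_trans with (rising_ratio (- f) b * Rpower (INR b) f); [|apply Hst; lia].
    induction H as [|b H IH]; [apply Rle_refl|].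
    eapply Rle_trans; [exact IH|]. destruct b as [|b]; [lia|]. now apply rising_ratio_incr.
  - apply Rle_trans with (rising_ratio (- f) a * Rpower (INR a + 1) f); [apply Hst; lia|].
    assert (H' : (b <= a)%nat) by lia; clear H Ha.
    induction H' as [|a H IH]; [apply Rle_refl|].
    eapply Rle_trans; [now apply rising_ratio_decr|exact IH].
Qed.

(** * Falling factorials off the integers *)

Lemma falling_near (f : R) (m : nat) :
  falling (INR m + f) m = INR (fact m) * rising_ratio f m.
Proof.
  induction m as [|m IH]; [simpl; ring|].
  replace (S m) with (1 + m)%nat at 2 by lia.
  rewrite falling_add; replace (INR (S m) + f - INR 1) with (INR m + f) by (rewrite S_INR; simpl; ring).
  rewrite IH, fact_simpl, mult_INR; cbn [rising_ratio falling].
  simpl (INR 0); field; apply not_0_INR; lia.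
Qed.

Lemma falling_below (f : R) (l : nat) :
  falling (f - 1) l = (-1) ^ l * INR (fact l) * rising_ratio (- f) l.
Proof.
  induction l as [|l IH]; [simpl; ring|].
  cbn [falling rising_ratio pow]; rewrite IH, fact_simpl, mult_INR.
  replace (f - 1 - INR l) with (f - INR (S l)) by (rewrite S_INR; ring).
  field; apply not_0_INR; lia.
Qed.

(** With [x = m + f] and [l = N - m], the factor by which the falling factorial at [x]
    differs, up to sign, from [m! l! sin (PI f) / PI]; in terms of the Gamma function it is
    [Gamma (x + 1) Gamma (N - x + 1) / (m! l!)]. *)
Definition gamma_corr (f : R) (m l : nat) : R :=
  cos_moment m 0 / cos_moment m f * (rising_ratio (- f) l / rising_ratio (- f) m).

Lemma cos_moment_pos (f : R) (m : nat) : 0 <= f <= 1 -> (1 <= m)%nat ->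
  0 < cos_moment m 0 /\ 0 < cos_moment m f /\
  1 <= cos_moment m 0 / cos_moment m f <= 1 + / INR m.
Proof.
  intros Hf Hm; destruct (cos_moment_product m f) as [c [Hc [H0 _]]].
  pose proof PI_RGT_0; pose proof (cos_moment_bounds m f Hf) as [B1 B2].
  apply le_INR in Hm; simpl in Hm; rewrite S_INR in B1.
  assert (P0 : 0 < cos_moment m 0) by (rewrite H0; nra).
  assert (P1 : 0 < cos_moment m f).
  { eapply Rlt_le_trans; [|exact B1]. apply Rmult_lt_0_compat; [apply Rdiv_lt_0_compat; lra|exact P0]. }
  repeat split; try assumption.
  - apply Rmult_le_reg_r with (cos_moment m f); [exact P1|].
    unfold Rdiv; rewrite Rmult_assoc, Rinv_l; lra.
  - apply Rmult_le_reg_r with (cos_moment m f); [exact P1|].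
    unfold Rdiv; rewrite Rmult_assoc, Rinv_l by lra.
    apply Rle_trans with ((1 + / INR m) * (INR m / (INR m + 1) * cos_moment m 0)).
    + right; field; lra.
    + apply Rmult_le_compat_l; [|exact B1].
      assert (0 < / INR m) by (apply Rinv_0_lt_compat; lra); lra.
Qed.

Lemma falling_sin (f : R) (m l : nat) : 0 < f < 1 -> (1 <= m)%nat ->
  falling (INR m + f) (S (m + l)) =
  (-1) ^ l * INR (fact m) * INR (fact l) * (sin (PI * f) / PI) * gamma_corr f m l.
Proof.
  intros Hf Hm.
  destruct (cos_moment_product m f) as [c [Hc [H0 HE]]].
  destruct (cos_moment_pos f m ltac:(lra) Hm) as [P0 [P1 _]].
  pose proof (rising_ratio_pos f m ltac:(lra)) as Pr.
  pose proof PI_RGT_0.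
  replace (S (m + l)) with (S m + l)%nat by lia.
  rewrite falling_add; cbn [falling]; rewrite falling_near.
  replace (INR m + f - INR (S m)) with (f - 1) by (rewrite S_INR; ring).
  rewrite falling_below; unfold gamma_corr; rewrite H0.
  replace (sin (PI * f)) with (f * rising_ratio f m * rising_ratio (- f) m * cos_moment m f / c).
  - field; lra.
  - rewrite HE; field; lra.
Qed.

Lemma gamma_corr_near_1 (f d s : R) (m l : nat) :
  0 <= f < 1 -> (1 <= m)%nat -> (1 <= l)%nat -> 0 < s ->
  Rabs (INR m * s / (INR l + 1) - 1) <= d ->
  Rabs ((INR m + 1) * s / INR l - 1) <= d -> / INR m <= d ->
  Rabs (gamma_corr f m l * Rpower s f - 1) <= 2 * d + d ^ 2.
Proof.
  intros Hf Hm Hl Hs Hd1 Hd2 Hd3.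
  destruct (cos_moment_pos f m ltac:(lra) Hm) as [_ [_ HB]].
  pose proof (rising_ratio_cross f l m Hf Hl) as C1.
  pose proof (rising_ratio_cross f m l Hf Hm) as C2.
  pose proof (rising_ratio_pos f m Hf) as Pm; pose proof (rising_ratio_pos f l Hf) as Pl.
  apply le_INR in Hm; apply le_INR in Hl; simpl in Hm, Hl.
  apply Rpower_near_1 with (f := f) in Hd1; [|apply Rdiv_lt_0_compat; nra|lra].
  apply Rpower_near_1 with (f := f) in Hd2; [|apply Rdiv_lt_0_compat; nra|lra].
  unfold gamma_corr.
  set (h := cos_moment m 0 / cos_moment m f) in *.
  set (um := rising_ratio (- f) m) in *; set (ul := rising_ratio (- f) l) in *.
  assert (L : Rpower (INR m * s / (INR l + 1)) f <= ul / um * Rpower s f).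
  { apply Rmult_le_reg_r with (um * Rpower (INR l + 1) f); [apply Rmult_lt_0_compat; [lra|apply exp_pos]|].
    replace (ul / um * Rpower s f * (um * Rpower (INR l + 1) f)) with (ul * Rpower (INR l + 1) f * Rpower s f) by (field; lra).
    replace (Rpower (INR m * s / (INR l + 1)) f * (um * Rpower (INR l + 1) f))
      with (um * (Rpower (INR m * s / (INR l + 1)) f * Rpower (INR l + 1) f)) by ring.
    rewrite <- Rpower_div by nra.
    rewrite <- (Rpower_mult_distr (INR m) s) by lra.
    rewrite <- Rmult_assoc; apply Rmult_le_compat_r; [left; apply exp_pos|exact C2]. }
  assert (U : ul / um * Rpower s f <= Rpower ((INR m + 1) * s / INR l) f).
  { apply Rmult_le_reg_r with (um * Rpower (INR l) f); [apply Rmult_lt_0_compat; [lra|apply exp_pos]|].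
    replace (ul / um * Rpower s f * (um * Rpower (INR l) f)) with (ul * Rpower (INR l) f * Rpower s f) by (field; lra).
    replace (Rpower ((INR m + 1) * s / INR l) f * (um * Rpower (INR l) f))
      with (um * (Rpower ((INR m + 1) * s / INR l) f * Rpower (INR l) f)) by ring.
    rewrite <- Rpower_div by nra.
    rewrite <- (Rpower_mult_distr (INR m + 1) s) by lra.
    rewrite <- Rmult_assoc; apply Rmult_le_compat_r; [left; apply exp_pos|exact C1]. }
  rewrite Rmult_assoc; set (w := ul / um * Rpower s f) in *.
  assert (0 < w) by (apply Rmult_lt_0_compat; [apply Rdiv_lt_0_compat; lra|apply exp_pos]).
  assert (0 < / INR m) by (apply Rinv_0_lt_compat; lra).
  apply Rabs_le; split; nra.
Qed.

(** * Complex functions along a line *)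

(** All complex derivatives are taken along lines [a + s b] with [s] real, where the
    real derivatives of the two components suffice. *)
Definition path_derive (F : R -> C) (s : R) (l : C) : Prop :=
  is_derive (fun s => Re (F s)) s (Re l) /\ is_derive (fun s => Im (F s)) s (Im l).

Lemma path_derive_ext (F G : R -> C) (s : R) (l : C) :
  (forall t, F t = G t) -> path_derive F s l -> path_derive G s l.
Proof.
  intros H [H1 H2]; split; [eapply is_derive_ext, H1|eapply is_derive_ext, H2];
    intros t; simpl; now rewrite H.
Qed.

Lemma path_derive_unique (F : R -> C) (s : R) (l l' : C) :
  path_derive F s l -> path_derive F s l' -> l = l'.
Proof.
  intros [A B] [A' B']; apply is_derive_unique in A, B, A', B'.
  destruct l, l'; simpl in *; congruence.
Qed.

Lemma path_derive_plus (F G : R -> C) (s : R) (l k : C) :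
  path_derive F s l -> path_derive G s k -> path_derive (fun s => F s + G s)%C s (l + k)%C.
Proof.
  intros [A B] [A' B']; split.
  - exact (is_derive_plus (fun s => Re (F s)) (fun s => Re (G s)) s _ _ A A').
  - exact (is_derive_plus (fun s => Im (F s)) (fun s => Im (G s)) s _ _ B B').
Qed.

Lemma path_derive_mult (F G : R -> C) (s : R) (l k : C) :
  path_derive F s l -> path_derive G s k ->
  path_derive (fun s => F s * G s)%C s (l * G s + F s * k)%C.
Proof.
  intros [A B] [A' B']; split.
  - apply (is_derive_ext (fun s => Re (F s) * Re (G s) - Im (F s) * Im (G s))); [reflexivity|].
    pose proof (is_derive_minus (fun s => Re (F s) * Re (G s)) (fun s => Im (F s) * Im (G s)) s _ _
      (is_derive_mult _ _ s _ _ A A' Rmult_comm) (is_derive_mult _ _ s _ _ B B' Rmult_comm)) as D.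
    replace (Re (l * G s + F s * k)) with
      (Re l * Re (G s) + Re (F s) * Re k - (Im l * Im (G s) + Im (F s) * Im k)); [exact D|].
    unfold Re, Im; simpl; ring.
  - apply (is_derive_ext (fun s => Re (F s) * Im (G s) + Im (F s) * Re (G s))); [reflexivity|].
    pose proof (is_derive_plus (fun s => Re (F s) * Im (G s)) (fun s => Im (F s) * Re (G s)) s _ _
      (is_derive_mult _ _ s _ _ A B' Rmult_comm) (is_derive_mult _ _ s _ _ B A' Rmult_comm)) as D.
    replace (Im (l * G s + F s * k)) with
      ((Re l * Im (G s) + Re (F s) * Im k) + (Im l * Re (G s) + Im (F s) * Re k)); [exact D|].
    unfold Re, Im; simpl; ring.
Qed.

Lemma path_derive_const (c : C) (s : R) : path_derive (fun _ => c) s (RtoC 0).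
Proof. split; apply is_derive_const_R. Qed.

Lemma path_derive_line (a b : C) (s : R) : path_derive (fun s => a + RtoC s * b)%C s b.
Proof.
  split; unfold Re, Im; simpl; auto_derive; try exact I; ring.
Qed.

Lemma path_derive_eq (F : R -> C) (s : R) (l l' : C) :
  l = l' -> path_derive F s l -> path_derive F s l'.
Proof. now intros ->. Qed.

(** [pr] stands for the real or the imaginary part. *)
Lemma is_derive_of_linear_part (pr : C -> R) (w : C -> C) (a b l : C) (s : R) :
  (forall x y, pr (x - y)%C = pr x - pr y) -> (forall r x, pr (RtoC r * x)%C = r * pr x) ->
  (forall x, Rabs (pr x) <= Cmod x) ->
  is_derive (K := C_AbsRing) (V := C_NormedModule) w (a + RtoC s * b)%C l ->
  is_derive (fun s => pr (w (a + RtoC s * b)%C)) s (pr (l * b)%C).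
Proof.
  intros Hm Hs Hb [_ H].
  specialize (H (a + RtoC s * b)%C (fun P HP => HP)).
  apply is_derive_Reals; intros eps Heps.
  assert (Hb0 := Cmod_ge_0 b).
  assert (He' : 0 < eps / 2 / (1 + Cmod b)) by (apply Rdiv_lt_0_compat; lra).
  destruct (H (mkposreal _ He')) as [[d Hd0] Hd]; simpl in Hd.
  assert (Hd' : 0 < d / (1 + Cmod b)) by (apply Rdiv_lt_0_compat; lra).
  exists (mkposreal _ Hd'); intros h Hh0 Hh; simpl in Hh.
  set (z := (a + RtoC s * b)%C) in *; set (y := (a + RtoC (s + h) * b)%C).
  assert (Ey : (y - z)%C = (RtoC h * b)%C) by (unfold y, z; rewrite RtoC_plus; ring).
  assert (HC : Cmod (y - z) = Rabs h * Cmod b) by (rewrite Ey, Cmod_mult, Cmod_R; reflexivity).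
  assert (Hhb : Rabs h * (1 + Cmod b) < d).
  { apply Rmult_lt_compat_r with (r := 1 + Cmod b) in Hh; [|lra].
    unfold Rdiv in Hh; rewrite Rmult_assoc, Rinv_l in Hh by lra; lra. }
  pose proof (Rabs_pos_lt h Hh0) as Hhp.
  specialize (Hd y).
  assert (Hball : AbsRing_ball C_AbsRing z d y).
  { unfold AbsRing_ball; change (Cmod (y - z) < d); rewrite HC; nra. }
  specialize (Hd Hball).
  change (Cmod ((w y - w z) - (y - z) * l) <= eps / 2 / (1 + Cmod b) * Cmod (y - z)) in Hd.
  replace ((pr (w y) - pr (w z)) / h - pr (l * b)%C)
    with (pr ((w y - w z) - (y - z) * l)%C / h).
  2:{ rewrite !Hm, Ey.
      replace (RtoC h * b * l)%C with (RtoC h * (l * b))%C by ring.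
      rewrite Hs; field; exact Hh0. }
  unfold Rdiv; rewrite Rabs_mult, Rabs_inv.
  apply Rmult_lt_reg_r with (Rabs h); [exact Hhp|].
  rewrite Rmult_assoc, Rinv_l, Rmult_1_r by lra.
  eapply Rle_lt_trans; [apply Hb|]; eapply Rle_lt_trans; [exact Hd|]; rewrite HC.
  apply Rle_lt_trans with (eps / 2 * Rabs h).
  - replace (eps / 2 / (1 + Cmod b) * (Rabs h * Cmod b)) with (eps / 2 * Rabs h * (Cmod b / (1 + Cmod b))) by (field; lra).
    rewrite <- Rmult_1_r; apply Rmult_le_compat_l; [nra|].
    apply Rmult_le_reg_r with (1 + Cmod b); [lra|].
    unfold Rdiv; rewrite Rmult_assoc, Rinv_l; lra.
  - nra.
Qed.

Lemma im_le_Cmod (c : C) : Rabs (Im c) <= Cmod c.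
Proof. eapply Rle_trans; [apply Rmax_r|apply Rmax_Cmod]. Qed.

Lemma path_derive_comp (w : C -> C) (a b l : C) (s : R) :
  is_derive (K := C_AbsRing) (V := C_NormedModule) w (a + RtoC s * b)%C l ->
  path_derive (fun s => w (a + RtoC s * b)%C) s (l * b)%C.
Proof.
  intros H; split; apply is_derive_of_linear_part; try exact H;
    try (intros; unfold Re, Im; simpl; ring).
  - apply re_le_Cmod.
  - apply im_le_Cmod.
Qed.

Lemma Re_Im_dot (x y : C) : Re x * Re y + Im x * Im y <= Cmod x * Cmod y.
Proof.
  replace (Re x * Re y + Im x * Im y) with (Re (x * Cconj y)%C) by (unfold Re, Im; simpl; ring).
  eapply Rle_trans; [apply Rle_abs|]; eapply Rle_trans; [apply re_le_Cmod|].
  rewrite Cmod_mult, Cmod_conj; lra.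
Qed.

Lemma is_derive_sum_sq (f1 f2 f3 f4 : R -> R) (s l1 l2 l3 l4 : R) :
  is_derive f1 s l1 -> is_derive f2 s l2 -> is_derive f3 s l3 -> is_derive f4 s l4 ->
  is_derive (fun s => f1 s ^ 2 + f2 s ^ 2 + (f3 s ^ 2 + f4 s ^ 2)) s
    (2 * (f1 s * l1 + f2 s * l2 + (f3 s * l3 + f4 s * l4))).
Proof.
  intros A1 A2 A3 A4; auto_derive; [repeat split; eexists; eassumption|].
  rewrite (is_derive_unique (fun x : R => f1 x) _ _ A1), (is_derive_unique (fun x : R => f2 x) _ _ A2),
    (is_derive_unique (fun x : R => f3 x) _ _ A3), (is_derive_unique (fun x : R => f4 x) _ _ A4); ring.
Qed.

(** Gronwall's inequality for [|F|^2 + |G|^2]. *)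
Lemma linear_ode_zero (F G Q : R -> C) (b : C) (K : R) :
  (forall s, path_derive F s (b * G s)%C) ->
  (forall s, path_derive G s (b * (Q s * F s))%C) ->
  (forall s, 0 <= s <= 1 -> Cmod (Q s) <= K) ->
  F 0 = RtoC 0 -> G 0 = RtoC 0 -> F 1 = RtoC 0.
Proof.
  intros HF HG HQ HF0 HG0.
  assert (HK : 0 <= K) by (eapply Rle_trans; [apply Cmod_ge_0|apply (HQ 0); lra]).
  pose (E := fun s => Re (F s) ^ 2 + Im (F s) ^ 2 + (Re (G s) ^ 2 + Im (G s) ^ 2)).
  pose (L := Cmod b * (1 + K)).
  pose (dE := fun s => 2 * (Re (F s) * Re (b * G s)%C + Im (F s) * Im (b * G s)%C
     + (Re (G s) * Re (b * (Q s * F s))%C + Im (G s) * Im (b * (Q s * F s))%C))).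
  assert (HE : forall s, is_derive E s (dE s)).
  { intros s; destruct (HF s) as [A1 A2]; destruct (HG s) as [A3 A4].
    unfold E, dE.
    pose proof (is_derive_sum_sq _ _ _ _ s _ _ _ _ A1 A2 A3 A4) as D; exact D. }
  assert (Hle : forall s, 0 <= s <= 1 -> dE s <= L * E s).
  { intros s Hs; unfold dE, E, L.
    rewrite <- !Cmod2_alt.
    pose proof (Re_Im_dot (F s) (b * G s)) as B1.
    pose proof (Re_Im_dot (G s) (b * (Q s * F s))) as B2.
    rewrite Cmod_mult in B1, B2; rewrite (Cmod_mult (Q s)) in B2.
    specialize (HQ s Hs).
    pose proof (Cmod_ge_0 (F s)); pose proof (Cmod_ge_0 (G s)); pose proof (Cmod_ge_0 b).
    set (f := Cmod (F s)) in *; set (g := Cmod (G s)) in *; set (c := Cmod b) in *.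
    assert (P : g * (c * (Cmod (Q s) * f)) <= g * (c * (K * f))).
    { apply Rmult_le_compat_l; [lra|]; apply Rmult_le_compat_l; [lra|]; apply Rmult_le_compat_r; lra. }
    pose proof (pow2_ge_0 (f - g)) as Sq.
    assert (P2 : 2 * (f * g) <= f ^ 2 + g ^ 2) by (clear - Sq; nra).
    assert (P3 : 0 <= c * (1 + K)) by (apply Rmult_le_pos; lra).
    assert (P4 : c * (1 + K) * (2 * (f * g)) <= c * (1 + K) * (f ^ 2 + g ^ 2)) by (apply Rmult_le_compat_l; lra).
    lra. }
  assert (H1 : - (E 0 * exp (- (L * 0))) <= - (E 1 * exp (- (L * 1)))).
  { apply (le_of_derive_nonneg (fun s => - (E s * exp (- (L * s))))
      (fun s => (L * E s - dE s) * exp (- (L * s)))); [lra| |].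
    - intros s _; pose proof (HE s) as D; auto_derive; [eexists; apply D|].
      change (Derive (fun x => E x) s) with (Derive E s).
      rewrite (is_derive_unique _ _ _ D); ring.
    - intros s Hs; apply Rmult_le_pos; [specialize (Hle s Hs); lra|left; apply exp_pos]. }
  assert (E0 : E 0 = 0) by (unfold E; rewrite HF0, HG0; simpl; ring).
  rewrite E0 in H1; pose proof (exp_pos (- (L * 1))).
  assert (E1 : E 1 <= 0) by nra.
  apply Cmod_eq_0; pose proof (Cmod2_alt (F 1)) as HC; pose proof (Cmod_ge_0 (F 1)).
  unfold E in E1; pose proof (pow2_ge_0 (Re (G 1))); pose proof (pow2_ge_0 (Im (G 1))); nra.
Qed.

(** * Weber equation on the real axis *)

(** [f] solves Weber's equation of order [nu] on the real line, with derivative [df]. *)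
Definition weber (nu : R) (f df : R -> R) : Prop :=
  (forall t, is_derive f t (df t)) /\
  (forall t, is_derive df t (- (nu + 1 / 2 - t ^ 2 / 4) * f t)).

Definition pcf_size (nu t : R) : R := Rpower t nu * exp (- t ^ 2 / 4).

Definition asymp (f : R -> R) (nu l : R) : Prop :=
  forall eps, 0 < eps -> exists A, forall t, A < t ->
    Rabs (f t - l * pcf_size nu t) <= eps * pcf_size nu t.

Lemma pcf_size_pos (nu t : R) : 0 < pcf_size nu t.
Proof. apply Rmult_lt_0_compat; apply exp_pos. Qed.

Lemma ln_le_self (t : R) : 0 < t -> ln t <= t.
Proof. intros H; pose proof (exp_ineq1_le (ln t)); rewrite exp_ln in H0; lra. Qed.

Lemma pcf_size_le_1 (nu : R) : forall t, Rmax 1 (4 * Rabs nu) < t -> pcf_size nu t <= 1.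
Proof.
  intros t Ht; pose proof (Rmax_l 1 (4 * Rabs nu)); pose proof (Rmax_r 1 (4 * Rabs nu)).
  unfold pcf_size, Rpower; rewrite <- exp_plus, <- exp_0; apply exp_mono.
  assert (0 <= ln t <= t) by (split; [rewrite <- ln_1; left; apply ln_increasing; lra|apply ln_le_self; lra]).
  pose proof (Rle_abs nu); pose proof (Rabs_pos nu).
  assert (nu * ln t <= Rabs nu * t) by nra. nra.
Qed.

Lemma weber_opp (nu : R) (f df : R -> R) :
  weber nu f df -> weber nu (fun t => - f t) (fun t => - df t).
Proof.
  intros [H1 H2]; split; intros t.
  - apply (is_derive_opp f t (df t)), H1.
  - replace (- (nu + 1 / 2 - t ^ 2 / 4) * - f t) with (- (- (nu + 1 / 2 - t ^ 2 / 4) * f t)) by ring.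
    apply (is_derive_opp df t), H2.
Qed.

Lemma asymp_bounds (u : R -> R) (nu : R) : asymp u nu 1 ->
  exists A, 0 < A /\ forall t, A < t -> pcf_size nu t / 2 <= u t <= 2 * pcf_size nu t /\ 0 < u t <= 2.
Proof.
  intros H; destruct (H (1 / 2) ltac:(lra)) as [A HA].
  exists (Rmax 1 (Rmax A (Rmax 1 (4 * Rabs nu)))).
  pose proof (Rmax_l 1 (Rmax A (Rmax 1 (4 * Rabs nu)))).
  pose proof (Rmax_r 1 (Rmax A (Rmax 1 (4 * Rabs nu)))).
  pose proof (Rmax_l A (Rmax 1 (4 * Rabs nu))); pose proof (Rmax_r A (Rmax 1 (4 * Rabs nu))).
  split; [lra|]; intros t Ht.
  specialize (HA t ltac:(lra)); apply Rabs_le_between in HA.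
  pose proof (pcf_size_pos nu t); pose proof (pcf_size_le_1 nu t ltac:(lra)); lra.
Qed.

Section Wronskian.
Variables (nu : R) (u du f df : R -> R).
Hypotheses (Hu : weber nu u du) (Hf : weber nu f df) (Au : asymp u nu 1).

Lemma wronskian_const : forall a b, df a * u a - f a * du a = df b * u b - f b * du b.
Proof.
  apply (const_of_derive_0 (fun t => df t * u t - f t * du t)); intros t.
  destruct Hu as [U1 U2]; destruct Hf as [F1 F2].
  pose proof (U1 t) as A1; pose proof (U2 t) as A2; pose proof (F1 t) as A3; pose proof (F2 t) as A4.
  auto_derive; [repeat split; eexists; eassumption|].
  rewrite (is_derive_unique (fun x : R => u x) _ _ A1), (is_derive_unique (fun x : R => du x) _ _ A2),
    (is_derive_unique (fun x : R => f x) _ _ A3), (is_derive_unique (fun x : R => df x) _ _ A4); ring.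
Qed.

Lemma is_derive_quotient (t : R) : u t <> 0 ->
  is_derive (fun t => f t / u t) t ((df 0 * u 0 - f 0 * du 0) / u t ^ 2).
Proof.
  intros H; rewrite (wronskian_const 0 t).
  destruct Hu as [U1 _]; destruct Hf as [F1 _].
  pose proof (U1 t) as A1; pose proof (F1 t) as A3.
  auto_derive; [repeat split; try (eexists; eassumption); assumption|].
  rewrite (is_derive_unique (fun x : R => u x) _ _ A1), (is_derive_unique (fun x : R => f x) _ _ A3).
  field; exact H.
Qed.

(** The derivative of [f / u] is the Wronskian divided by [u^2], which is bounded below
    because [u] tends to [0]; so [f / u] grows without bound. *)
Lemma wronskian_pos : 0 < df 0 * u 0 - f 0 * du 0 ->
  forall B, exists A, forall t, A < t -> B * u t <= f t.
Proof.
  intros Hk B; set (k := df 0 * u 0 - f 0 * du 0) in *.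
  destruct (asymp_bounds u nu Au) as [A [HA0 HA]].
  set (a := A + 1).
  exists (a + Rabs (B - f a / u a) * (4 / k)); intros t Ht.
  assert (Hk4 : 0 < 4 / k) by (apply Rdiv_lt_0_compat; lra).
  assert (Hta : a <= t) by (pose proof (Rabs_pos (B - f a / u a)); nra).
  destruct (HA t ltac:(unfold a in *; lra)) as [_ Hut].
  assert (H : f a / u a - k / 4 * a <= f t / u t - k / 4 * t).
  { apply (le_of_derive_nonneg (fun t => f t / u t - k / 4 * t) (fun t => k / u t ^ 2 - k / 4)); [exact Hta| |].
    - intros x Hx; destruct (HA x ltac:(unfold a in *; lra)) as [_ Hux].
      apply (is_derive_minus (fun t => f t / u t) (fun t => k / 4 * t)).
      + apply is_derive_quotient; lra.
      + auto_derive; [exact I|ring].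
    - intros x Hx; destruct (HA x ltac:(unfold a in *; lra)) as [_ Hux].
      enough (k / 4 <= k / u x ^ 2) by lra.
      apply Rmult_le_compat_l; [lra|]; apply Rinv_le_contravar; nra. }
  assert (HB : B <= f t / u t).
  { pose proof (Rle_abs (B - f a / u a)).
    assert (Rabs (B - f a / u a) <= k / 4 * (t - a)).
    { replace (Rabs (B - f a / u a)) with (k / 4 * (Rabs (B - f a / u a) * (4 / k))) by (field; lra).
      apply Rmult_le_compat_l; lra. }
    lra. }
  replace (f t) with (f t / u t * u t) by (field; lra).
  apply Rmult_le_compat_r; lra.
Qed.

Lemma wronskian_zero : df 0 * u 0 - f 0 * du 0 = 0 ->
  exists c A, forall t, A < t -> f t = c * u t.
Proof.
  intros Hk; destruct (asymp_bounds u nu Au) as [A [HA0 HA]].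
  set (a := A + 1); exists (f a / u a), a; intros t Ht.
  destruct (HA t ltac:(unfold a in *; lra)) as [_ Hut].
  enough (E : f t / u t = f a / u a) by (rewrite <- E; field; lra).
  assert (D : forall x, a <= x <= t -> is_derive (fun t => f t / u t) x 0).
  { intros x Hx; destruct (HA x ltac:(unfold a in *; lra)) as [_ Hux].
    pose proof (is_derive_quotient x ltac:(lra)) as D; rewrite Hk in D.
    replace (0 / u x ^ 2) with 0 in D by (unfold Rdiv; ring); exact D. }
  apply Rle_antisym.
  - apply Ropp_le_cancel.
    apply (le_of_derive_nonneg (fun t => - (f t / u t)) (fun _ => - 0)); [lra| |intros; lra].
    intros x Hx; apply (is_derive_opp (fun t => f t / u t) x 0), D, Hx.
  - apply (le_of_derive_nonneg (fun t => f t / u t) (fun _ => 0)); [lra| |intros; lra].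
    exact D.
Qed.
End Wronskian.

(** The sign of the Wronskian decides. *)
Lemma weber_trichotomy (nu : R) (u du f df : R -> R) :
  weber nu u du -> weber nu f df -> asymp u nu 1 ->
  (exists c A, forall t, A < t -> f t = c * u t) \/
  (forall B, exists A, forall t, A < t -> B * u t <= f t) \/
  (forall B, exists A, forall t, A < t -> f t <= B * u t).
Proof.
  intros Hu Hf Au.
  destruct (Rtotal_order (df 0 * u 0 - f 0 * du 0) 0) as [H|[H|H]].
  - right; right; intros B.
    destruct (wronskian_pos nu u du (fun t => - f t) (fun t => - df t) Hu (weber_opp _ _ _ Hf) Au ltac:(lra) (- B)) as [A HA].
    exists A; intros t Ht; specialize (HA t Ht); lra.
  - left; exact (wronskian_zero nu u du f df Hu Hf Au H).
  - right; left; exact (wronskian_pos nu u du f df Hu Hf Au H).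
Qed.

Lemma weber_decaying_zero (nu : R) (u du f df : R -> R) :
  weber nu u du -> weber nu f df -> asymp u nu 1 -> asymp f nu 0 ->
  exists A, forall t, A < t -> f t = 0.
Proof.
  intros Hu Hf Au Af.
  destruct (asymp_bounds u nu Au) as [A0 [_ HA0]].
  assert (No : forall c A1, 0 < c -> ~ (forall t, A1 < t -> c * u t <= Rabs (f t))).
  { intros c A1 Hc H; destruct (Af (c / 4) ltac:(lra)) as [A2 H2].
    set (t := Rmax A0 (Rmax A1 A2) + 1).
    pose proof (Rmax_l A0 (Rmax A1 A2)); pose proof (Rmax_r A0 (Rmax A1 A2)).
    pose proof (Rmax_l A1 A2); pose proof (Rmax_r A1 A2).
    specialize (H t ltac:(unfold t; lra)); specialize (H2 t ltac:(unfold t; lra)).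
    destruct (HA0 t ltac:(unfold t; lra)) as [B1 _].
    rewrite Rmult_0_l, Rminus_0_r in H2; pose proof (pcf_size_pos nu t). nra. }
  destruct (weber_trichotomy nu u du f df Hu Hf Au) as [[c [A1 H]]|[H|H]].
  - destruct (Req_dec c 0) as [->|Hc]; [exists A1; intros t Ht; rewrite (H t Ht); ring|].
    exfalso; apply (No (Rabs c) (Rmax A0 A1)); [now apply Rabs_pos_lt|]; intros t Ht.
    pose proof (Rmax_l A0 A1); pose proof (Rmax_r A0 A1).
    destruct (HA0 t ltac:(lra)) as [_ Hut].
    rewrite H, Rabs_mult, (Rabs_pos_eq (u t)) by lra; apply Rle_refl.
  - exfalso; destruct (H 1) as [A1 H1]; apply (No 1 A1 Rlt_0_1); intros t Ht.
    eapply Rle_trans; [now apply H1|apply Rle_abs].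
  - exfalso; destruct (H (-1)) as [A1 H1]; apply (No 1 A1 Rlt_0_1); intros t Ht.
    rewrite <- Rabs_Ropp; eapply Rle_trans; [|apply Rle_abs]; specialize (H1 t Ht); lra.
Qed.

Lemma weber_raise (nu : R) (v dv : R -> R) : weber nu v dv ->
  weber (nu + 1) (fun t => dv t - t / 2 * v t)
    (fun t => - (nu + 1 / 2 - t ^ 2 / 4) * v t - v t / 2 - t / 2 * dv t).
Proof.
  intros [V1 V2]; split; intros t; pose proof (V1 t) as A1; pose proof (V2 t) as A2;
    (auto_derive; [repeat split; eexists; eassumption|]);
    rewrite ?(is_derive_unique (fun x : R => v x) _ _ A1), ?(is_derive_unique (fun x : R => dv x) _ _ A2);
    simpl; field.
Qed.

(** A one-sided form of l'Hospital's rule. Put [g = v exp (- t^2 / 4)], so that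
    [g' = (v' - t v / 2) exp (- t^2 / 4)] and [g ~ y = t^nu exp (- t^2 / 2)]. If
    [v' - t v / 2] stayed on one side of [- u], at a distance proportional to [u], then
    [g - lam y] with [lam] slightly off [1] would be monotone, bounded away from [0] and
    yet tend to [0]. *)
Lemma raise_one_sided (nu s d : R) (v dv u : R -> R) :
  s ^ 2 = 1 -> 0 < d <= 1 ->
  (forall t, is_derive v t (dv t)) -> asymp v nu 1 -> asymp u (nu + 1) 1 ->
  ~ (exists A, forall t, A < t -> d * u t <= s * (dv t - t / 2 * v t + u t)).
Proof.
  intros Hs Hd Hv Av Au [A0 H0].
  assert (Hs1 : Rabs s = 1).
  { assert (Hs' : (s - 1) * (s + 1) = 0) by lra.
    apply Rmult_integral in Hs' as [E|E]; [replace s with 1 by lra; apply Rabs_R1|].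
    replace s with (- (1)) by lra; rewrite Rabs_Ropp; apply Rabs_R1. }
  set (e := d / 6); assert (He : 0 < e) by (unfold e; lra).
  destruct (Av e He) as [A1 H1]; destruct (Au e He) as [A2 H2].
  pose (y := fun t => Rpower t nu * exp (- t ^ 2 / 2)).
  assert (Hy : forall t, 0 < y t) by (intros; apply Rmult_lt_0_compat; apply exp_pos).
  set (A := Rmax (Rmax A0 (Rmax A1 A2)) (Rmax (Rmax 1 (4 * Rabs nu)) (Rabs nu / e))).
  assert (HA : forall t, A < t -> A0 < t /\ A1 < t /\ A2 < t /\ 1 < t /\ Rmax 1 (4 * Rabs nu) < t /\ Rabs nu <= e * t).
  { intros t Ht; unfold A in Ht.
    pose proof (Rmax_l (Rmax A0 (Rmax A1 A2)) (Rmax (Rmax 1 (4 * Rabs nu)) (Rabs nu / e))).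
    pose proof (Rmax_r (Rmax A0 (Rmax A1 A2)) (Rmax (Rmax 1 (4 * Rabs nu)) (Rabs nu / e))).
    pose proof (Rmax_l A0 (Rmax A1 A2)); pose proof (Rmax_r A0 (Rmax A1 A2)).
    pose proof (Rmax_l A1 A2); pose proof (Rmax_r A1 A2).
    pose proof (Rmax_l (Rmax 1 (4 * Rabs nu)) (Rabs nu / e)).
    pose proof (Rmax_r (Rmax 1 (4 * Rabs nu)) (Rabs nu / e)).
    pose proof (Rmax_l 1 (4 * Rabs nu)).
    repeat split; try lra.
    replace (Rabs nu) with (e * (Rabs nu / e)) by (field; lra).
    apply Rmult_le_compat_l; lra. }
  assert (Eexp : forall t, exp (- t ^ 2 / 4) * exp (- t ^ 2 / 4) = exp (- t ^ 2 / 2)).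
  { intros t; rewrite <- exp_plus; f_equal; field. }
  (* On the side of 1 where g - lam y has the sign s. *)
  set (lam := 1 - s * (d / 3)).
  pose (g := fun t => v t * exp (- t ^ 2 / 4)).
  pose (h := fun t => s * (g t - lam * y t)).
  assert (Hg : forall t, A < t -> Rabs (g t - y t) <= e * y t).
  { intros t Ht; destruct (HA t Ht) as [_ [T1 _]]; specialize (H1 t T1).
    replace (y t) with (pcf_size nu t * exp (- t ^ 2 / 4)) by (unfold y, pcf_size; rewrite Rmult_assoc, Eexp; reflexivity).
    unfold g.
    replace (v t * exp (- t ^ 2 / 4) - pcf_size nu t * exp (- t ^ 2 / 4))
      with ((v t - 1 * pcf_size nu t) * exp (- t ^ 2 / 4)) by ring.
    rewrite Rabs_mult, (Rabs_pos_eq (exp _)) by (left; apply exp_pos).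
    rewrite <- Rmult_assoc; apply Rmult_le_compat_r; [left; apply exp_pos|exact H1]. }
  assert (Hh : forall t, A < t -> e * y t <= h t <= y t).
  { intros t Ht; specialize (Hg t Ht); specialize (Hy t).
    assert (E : h t = s * (g t - y t) + s ^ 2 * (d / 3) * y t) by (unfold h, lam; ring).
    rewrite E, Hs.
    assert (B : Rabs (s * (g t - y t)) <= e * y t) by (rewrite Rabs_mult, Hs1; lra).
    apply Rabs_le_between in B; unfold e in *; nra. }
  pose (dh := fun t => s * ((dv t - t / 2 * v t) * exp (- t ^ 2 / 4) - lam * ((nu / t - t) * y t))).
  assert (Hdh : forall t, 0 < t -> is_derive h t (dh t)).
  { intros t Ht; unfold h, g, dh.
    assert (Dy : is_derive y t ((nu / t - t) * y t)).
    { unfold y, Rpower; auto_derive; [exact Ht|].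
      replace (- (t * (t * 1)) * / 2) with (- t ^ 2 / 2) by (simpl; field; lra).
      field; lra. }
    pose proof (Hv t) as Dv.
    auto_derive; [repeat split; eexists; eassumption|].
    rewrite (is_derive_unique (fun x : R => y x) _ _ Dy), (is_derive_unique (fun x : R => v x) _ _ Dv).
    replace (- (t * (t * 1)) * / 4) with (- t ^ 2 / 4) by (simpl; field).
    field; lra. }
  assert (Hpos : forall t, A < t -> 0 <= dh t).
  { intros t Ht; destruct (HA t Ht) as [T0 [_ [T2 [T3 [_ T5]]]]].
    specialize (H0 t T0); specialize (H2 t T2); specialize (Hy t).
    assert (Ey : pcf_size (nu + 1) t * exp (- t ^ 2 / 4) = t * y t).
    { unfold pcf_size, y; rewrite Rpower_plus, Rpower_1 by lra.
      rewrite <- (Eexp t); ring. }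
    assert (Hue : Rabs (u t * exp (- t ^ 2 / 4) - t * y t) <= e * (t * y t)).
    { rewrite <- Ey.
      replace (u t * exp (- t ^ 2 / 4) - pcf_size (nu + 1) t * exp (- t ^ 2 / 4))
        with ((u t - 1 * pcf_size (nu + 1) t) * exp (- t ^ 2 / 4)) by ring.
      rewrite Rabs_mult, (Rabs_pos_eq (exp _)) by (left; apply exp_pos).
      rewrite <- Rmult_assoc; apply Rmult_le_compat_r; [left; apply exp_pos|exact H2]. }
    set (E := exp (- t ^ 2 / 4)) in *.
    assert (HE : 0 < E) by apply exp_pos.
    assert (E1 : d * (u t * E) <= s * ((dv t - t / 2 * v t) * E) + s * (u t * E)).
    { replace (s * ((dv t - t / 2 * v t) * E) + s * (u t * E))
        with (s * (dv t - t / 2 * v t + u t) * E) by ring.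
      rewrite <- Rmult_assoc; apply Rmult_le_compat_r; lra. }
    set (ty := t * y t) in *; assert (Hty : 0 < ty) by (unfold ty; nra).
    assert (E2 : Rabs (s * (u t * E - ty)) <= e * ty) by (rewrite Rabs_mult, Hs1; lra).
    assert (E3 : Rabs (s * lam * (nu / t * y t)) <= 2 * e * ty).
    { rewrite !Rabs_mult, Hs1, (Rabs_pos_eq (y t)) by lra.
      unfold Rdiv; rewrite Rabs_mult, Rabs_inv, (Rabs_pos_eq t) by lra.
      assert (Hl : Rabs lam <= 2).
      { unfold lam; assert (-1 <= s <= 1) by (apply Rabs_le_between; lra). apply Rabs_le; nra. }
      assert (Hn : Rabs nu * / t * y t <= e * ty).
      { unfold ty. apply Rle_trans with (e * t * / t * y t).
        - apply Rmult_le_compat_r; [lra|]. apply Rmult_le_compat_r; [left; apply Rinv_0_lt_compat; lra|lra].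
        - rewrite Rmult_assoc, Rmult_assoc, <- (Rmult_assoc t), Rinv_r, Rmult_1_l by lra. 
          apply Rmult_le_compat_l; [lra|]. nra. }
      assert (0 <= Rabs nu * / t * y t).
      { apply Rmult_le_pos; [apply Rmult_le_pos; [apply Rabs_pos|left; apply Rinv_0_lt_compat; lra]|lra]. }
      pose proof (Rabs_pos lam). nra. }
    unfold dh; fold E.
    replace (s * ((dv t - t / 2 * v t) * E - lam * ((nu / t - t) * y t)))
      with (s * ((dv t - t / 2 * v t) * E) + s * (u t * E) - s * (u t * E - ty)
        - s ^ 2 * (d / 3) * ty - s * lam * (nu / t * y t)) by (unfold lam, ty; ring).
    rewrite Hs.
    apply Rabs_le_between in E2, E3, Hue.
    assert (d * (ty - e * ty) <= d * (u t * E)) by (apply Rmult_le_compat_l; lra).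
    assert (d * (e * ty) <= e * ty) by nra.
    unfold e in *; lra. }
  (* h increases and is positive, but is bounded by y, which tends to 0. *)
  set (a := A + 1).
  assert (Ha : 0 < h a) by (specialize (Hh a ltac:(unfold a; lra)); specialize (Hy a); nra).
  set (t := a + 1 + 4 / h a).
  assert (Hi : 0 < 4 / h a) by (apply Rdiv_lt_0_compat; lra).
  assert (Hat : h a <= h t).
  { apply (le_of_derive_nonneg h dh); [unfold t; lra| |].
    - intros x Hx; apply Hdh. destruct (HA x ltac:(unfold a in Hx; lra)); lra.
    - intros x Hx; apply Hpos; unfold a in Hx; lra. }
  assert (HaA : a = A + 1) by reflexivity.
  assert (HtA : A < t) by (unfold t; lra).
  destruct (HA t HtA) as [_ [_ [_ [T3 [T4 _]]]]].
  pose proof (Hh t HtA) as [_ Hht].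
  assert (Hyt : y t <= exp (- t ^ 2 / 4)).
  { pose proof (pcf_size_le_1 nu t T4) as P1; pose proof (exp_pos (- t ^ 2 / 4)).
    unfold y; rewrite <- (Eexp t), <- Rmult_assoc; fold (pcf_size nu t). nra. }
  assert (Hexp : exp (- t ^ 2 / 4) <= 4 / t ^ 2).
  { replace (- t ^ 2 / 4) with (- (t ^ 2 / 4)) by field. rewrite exp_Ropp.
    replace (4 / t ^ 2) with (/ (t ^ 2 / 4)) by (field; lra).
    apply Rinv_le_contravar; [nra|]. pose proof (exp_ineq1_le (t ^ 2 / 4)); lra. }
  assert (Ht2 : 4 / t ^ 2 < h a).
  { apply Rmult_lt_reg_r with (t ^ 2); [nra|].
    unfold Rdiv; rewrite Rmult_assoc, Rinv_l by nra.
    assert (4 < h a * t).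
    { replace 4 with (h a * (4 / h a)) by (field; lra). apply Rmult_lt_compat_l; [lra|].
      destruct (HA a ltac:(unfold a; lra)) as [_ [_ [_ [? _]]]]. unfold t; lra. }
    nra. }
  lra.
Qed.

(** The left side solves Weber's equation of order [nu + 1], so it is eventually a
    multiple of [u] or dominates every multiple of [u] with one sign;
    [raise_one_sided] leaves only the multiple [-1]. *)
Lemma weber_raise_eq (nu : R) (v dv u du : R -> R) :
  weber nu v dv -> asymp v nu 1 -> weber (nu + 1) u du -> asymp u (nu + 1) 1 ->
  exists A, forall t, A < t -> dv t - t / 2 * v t = - u t.
Proof.
  intros Hv Av Hu Au.
  destruct (asymp_bounds u _ Au) as [A0 [_ HA0]].
  destruct (weber_trichotomy _ _ _ _ _ Hu (weber_raise _ _ _ Hv) Au) as [[c [A H]]|[H|H]].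
  - destruct (Rtotal_order c (-1)) as [Hc|[Hc|Hc]].
    + exfalso; apply (raise_one_sided nu (-1) (Rmin 1 (- (c + 1))) v dv u); [ring| |apply Hv|exact Av|exact Au|].
      * split; [apply Rmin_glb_lt; lra|apply Rmin_l].
      * exists (Rmax A A0); intros t Ht.
        pose proof (Rmax_l A A0); pose proof (Rmax_r A A0).
        specialize (H t ltac:(lra)); destruct (HA0 t ltac:(lra)) as [_ Hut].
        rewrite H; pose proof (Rmin_r 1 (- (c + 1))). nra.
    + exists A; intros t Ht; rewrite (H t Ht), Hc; ring.
    + exfalso; apply (raise_one_sided nu 1 (Rmin 1 (c + 1)) v dv u); [ring| |apply Hv|exact Av|exact Au|].
      * split; [apply Rmin_glb_lt; lra|apply Rmin_l].
      * exists (Rmax A A0); intros t Ht.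
        pose proof (Rmax_l A A0); pose proof (Rmax_r A A0).
        specialize (H t ltac:(lra)); destruct (HA0 t ltac:(lra)) as [_ Hut].
        rewrite H; pose proof (Rmin_r 1 (c + 1)). nra.
  - exfalso; apply (raise_one_sided nu 1 1 v dv u); [ring|lra|apply Hv|exact Av|exact Au|].
    destruct (H 0) as [A HA]; exists A; intros t Ht; specialize (HA t Ht); lra.
  - exfalso; apply (raise_one_sided nu (-1) 1 v dv u); [ring|lra|apply Hv|exact Av|exact Au|].
    destruct (H (-2)) as [A HA]; exists A; intros t Ht; specialize (HA t Ht); lra.
Qed.

(** * Parabolic cylinder functions *)

Lemma RtoC_nonzero (r : R) : r <> 0 -> RtoC r <> RtoC 0.
Proof. intros H E; apply H; now apply (f_equal Re) in E. Qed.

Definition complex_weber (nu : R) (w dw : C -> C) : Prop :=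
  (forall z, is_derive (K := C_AbsRing) (V := C_NormedModule) w z (dw z)) /\
  (forall z, is_derive (K := C_AbsRing) (V := C_NormedModule) dw z
     (- (RtoC (nu + 1 / 2) - z * z / RtoC 4) * w z)%C).

Lemma complex_weber_real (nu : R) (w dw : C -> C) : complex_weber nu w dw ->
  weber nu (fun t => Re (w (RtoC t))) (fun t => Re (dw (RtoC t))) /\
  weber nu (fun t => Im (w (RtoC t))) (fun t => Im (dw (RtoC t))).
Proof.
  intros [H1 H2].
  assert (E : forall t, RtoC t = (RtoC 0 + RtoC t * RtoC 1)%C) by (intros; ring).
  assert (A1 : forall t, path_derive (fun t => w (RtoC t)) t (dw (RtoC t))).
  { intros t; apply path_derive_eq with (dw (RtoC 0 + RtoC t * RtoC 1) * RtoC 1)%C; [rewrite <- E; ring|].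
    apply (path_derive_ext (fun t => w (RtoC 0 + RtoC t * RtoC 1)%C)); [intros s; now rewrite <- E|].
    apply path_derive_comp, H1. }
  assert (A2 : forall t, path_derive (fun t => dw (RtoC t)) t
     (RtoC (- (nu + 1 / 2 - t ^ 2 / 4)) * w (RtoC t))%C).
  { intros t; eapply path_derive_eq;
      [|apply (path_derive_ext (fun t => dw (RtoC 0 + RtoC t * RtoC 1)%C)); [intros s; now rewrite <- E|];
        apply path_derive_comp, H2].
    rewrite <- E. replace (RtoC (- (nu + 1 / 2 - t ^ 2 / 4))) with (- (RtoC (nu + 1 / 2) - RtoC t * RtoC t / RtoC 4))%C.
    - ring.
    - rewrite !RtoC_opp, RtoC_minus, RtoC_div, RtoC_pow by lra. simpl Cpow. f_equal; f_equal; f_equal; ring. }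
  split; split; intros t; try apply A1; destruct (A2 t) as [B1 B2].
  - replace (- (nu + 1 / 2 - t ^ 2 / 4) * Re (w (RtoC t))) with
      (Re (RtoC (- (nu + 1 / 2 - t ^ 2 / 4)) * w (RtoC t))%C); [exact B1|unfold Re; simpl; ring].
  - replace (- (nu + 1 / 2 - t ^ 2 / 4) * Im (w (RtoC t))) with
      (Im (RtoC (- (nu + 1 / 2 - t ^ 2 / 4)) * w (RtoC t))%C); [exact B2|unfold Im; simpl; ring].
Qed.

Lemma pcf_asymp (nu : R) (w : C -> C) :
  filterlim (fun t : R => (w (RtoC t) / RtoC (Rpower t nu * exp (- t ^ 2 / 4)))%C)
    (Rbar_locally p_infty) (locally (RtoC 1)) ->
  asymp (fun t => Re (w (RtoC t))) nu 1 /\ asymp (fun t => Im (w (RtoC t))) nu 0.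
Proof.
  intros H.
  assert (K : forall eps, 0 < eps -> exists A, forall t, A < t ->
     Rabs (Re (w (RtoC t)) - 1 * pcf_size nu t) <= eps * pcf_size nu t /\
     Rabs (Im (w (RtoC t)) - 0 * pcf_size nu t) <= eps * pcf_size nu t).
  { intros eps He.
    specialize (H (ball (RtoC 1) (mkposreal eps He))).
    destruct H as [A HA]; [exists (mkposreal eps He); intros y Hy; exact Hy|].
    exists A; intros t Ht; destruct (HA t Ht) as [B1 B2]; fold (pcf_size nu t) in B1, B2.
    change (Rabs (fst (w (RtoC t) / RtoC (pcf_size nu t))%C - 1) < eps) in B1.
    change (Rabs (snd (w (RtoC t) / RtoC (pcf_size nu t))%C - 0) < eps) in B2.
    pose proof (pcf_size_pos nu t) as Hp; set (G := pcf_size nu t) in *.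
    assert (EG : (w (RtoC t) / RtoC G)%C = (RtoC (/ G) * w (RtoC t))%C)
      by (unfold Cdiv; rewrite RtoC_inv by lra; ring).
    rewrite EG in B1, B2.
    split.
    - replace (Re (w (RtoC t)) - 1 * G) with ((fst (RtoC (/ G) * w (RtoC t))%C - 1) * G)
        by (unfold Re; simpl; field; lra).
      rewrite Rabs_mult, (Rabs_pos_eq G) by lra; apply Rmult_le_compat_r; lra.
    - replace (Im (w (RtoC t)) - 0 * G) with ((snd (RtoC (/ G) * w (RtoC t))%C - 0) * G)
        by (unfold Im; simpl; field; lra).
      rewrite Rabs_mult, (Rabs_pos_eq G) by lra; apply Rmult_le_compat_r; lra. }
  split; intros eps He; destruct (K eps He) as [A HA]; exists A; intros t Ht; now apply HA.
Qed.

Lemma path_derive_locally_0 (F : R -> C) (A s : R) (l : C) :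
  A < s -> (forall t, A < t -> F t = RtoC 0) -> path_derive F s l -> l = RtoC 0.
Proof.
  intros Hs H0 [D1 D2].
  assert (HL : locally s (fun t => A < t)).
  { assert (Hd : 0 < s - A) by lra.
    exists (mkposreal _ Hd); intros y Hy; unfold ball in Hy; simpl in Hy.
    unfold AbsRing_ball, abs, minus, plus, opp in Hy; simpl in Hy.
    apply Rabs_lt_between in Hy; lra. }
  assert (E1 : is_derive (fun _ : R => 0) s (Re l)).
  { apply is_derive_ext_loc with (2 := D1).
    apply filter_imp with (2 := HL); intros t Ht; now rewrite H0. }
  assert (E2 : is_derive (fun _ : R => 0) s (Im l)).
  { apply is_derive_ext_loc with (2 := D2).
    apply filter_imp with (2 := HL); intros t Ht; now rewrite H0. }
  apply is_derive_unique in E1, E2; rewrite Derive_const in E1, E2.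
  destruct l; unfold RtoC; simpl in *; congruence.
Qed.

(** On the real axis the imaginary parts vanish far out, being solutions that are small
    compared with the recessive one, and the real parts are covered by [weber_raise_eq].
    The left side is a solution of order [nu + 1], so vanishing on a half-line it
    vanishes along every segment that starts there. *)
Lemma pcf_raise (nu : R) (w dw u du : C -> C) :
  complex_weber nu w dw -> complex_weber (nu + 1) u du ->
  asymp (fun t => Re (w (RtoC t))) nu 1 -> asymp (fun t => Im (w (RtoC t))) nu 0 ->
  asymp (fun t => Re (u (RtoC t))) (nu + 1) 1 -> asymp (fun t => Im (u (RtoC t))) (nu + 1) 0 ->
  forall z, (dw z - z / RtoC 2 * w z + u z)%C = RtoC 0.
Proof.
  intros Hw Hu Aw Bw Au Bu z.
  destruct (complex_weber_real _ _ _ Hw) as [W1 W2].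
  destruct (complex_weber_real _ _ _ Hu) as [U1 U2].
  destruct (weber_raise_eq nu _ _ _ _ W1 Aw U1 Au) as [A1 H1].
  destruct (weber_decaying_zero nu _ _ _ _ W1 W2 Aw Bw) as [A2 H2].
  destruct (weber_decaying_zero (nu + 1) _ _ _ _ U1 U2 Au Bu) as [A3 H3].
  assert (H2' : forall t, A2 < t -> Im (dw (RtoC t)) = 0).
  { intros t Ht; destruct W2 as [W2 _]; specialize (W2 t).
    assert (E : is_derive (fun t => Im (RtoC (Im (w (RtoC t))))) t (Im (RtoC (Im (dw (RtoC t)))))).
    { simpl; apply is_derive_const_R. }
    assert (P : path_derive (fun t => RtoC (Im (w (RtoC t)))) t (RtoC (Im (dw (RtoC t))))) by (split; assumption).
    apply path_derive_locally_0 with (A := A2) in P; [|exact Ht|intros; now rewrite H2].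
    now apply (f_equal Re) in P. }
  set (h := fun z => (dw z - z / RtoC 2 * w z + u z)%C).
  pose (dh := fun z => (- (RtoC (nu + 1 / 2) - z * z / RtoC 4) * w z - w z / RtoC 2 - z / RtoC 2 * dw z + du z)%C).
  pose (Qf := fun z => (- (RtoC (nu + 1 + 1 / 2) - z * z / RtoC 4))%C).
  assert (Hr2 := RtoC_nonzero 2 ltac:(lra)).
  assert (Hr4 := RtoC_nonzero 4 ltac:(lra)).
  destruct Hw as [Hw1 Hw2]; destruct Hu as [Hu1 Hu2].
  assert (Dh : forall a b s, path_derive (fun s => h (a + RtoC s * b)%C) s (b * dh (a + RtoC s * b)%C)%C).
  { intros a b s; unfold h, dh.
    pose proof (path_derive_line a b s) as L.
    pose proof (path_derive_comp w a b _ s (Hw1 (a + RtoC s * b)%C)) as P1.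
    pose proof (path_derive_comp dw a b _ s (Hw2 (a + RtoC s * b)%C)) as P2.
    pose proof (path_derive_comp u a b _ s (Hu1 (a + RtoC s * b)%C)) as P3.
    pose proof (path_derive_plus _ _ s _ _ (path_derive_plus _ _ s _ _ P2
      (path_derive_mult _ _ s _ _ (path_derive_mult _ _ s _ _ (path_derive_const (- / RtoC 2)%C s) L) P1)) P3) as P.
    cbv beta in P.
    eapply path_derive_ext; [|eapply path_derive_eq; [|exact P]].
    - intros t; cbv beta; field; exact Hr2.
    - field; split; assumption. }
  assert (Ddh : forall a b s, path_derive (fun s => dh (a + RtoC s * b)%C) s
      (b * (Qf (a + RtoC s * b)%C * h (a + RtoC s * b)%C))%C).
  { intros a b s; unfold h, dh.
    pose proof (path_derive_line a b s) as L.
    pose proof (path_derive_comp w a b _ s (Hw1 (a + RtoC s * b)%C)) as P1.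
    pose proof (path_derive_comp dw a b _ s (Hw2 (a + RtoC s * b)%C)) as P2.
    pose proof (path_derive_comp du a b _ s (Hu2 (a + RtoC s * b)%C)) as P3.
    pose proof (path_derive_mult _ _ s _ _ (path_derive_plus _ _ s _ _
       (path_derive_const (- RtoC (nu + 1 / 2) - / RtoC 2)%C s)
       (path_derive_mult _ _ s _ _ (path_derive_const (/ RtoC 4)%C s) (path_derive_mult _ _ s _ _ L L))) P1) as P4.
    pose proof (path_derive_plus _ _ s _ _ (path_derive_plus _ _ s _ _ P4
      (path_derive_mult _ _ s _ _ (path_derive_mult _ _ s _ _ (path_derive_const (- / RtoC 2)%C s) L) P2)) P3) as P.
    cbv beta in P.
    eapply path_derive_ext; [|eapply path_derive_eq; [|exact P]].
    - intros t; cbv beta; field; split; assumption.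
    - unfold Qf. replace (RtoC (nu + 1 + 1 / 2)) with (RtoC (nu + 1 / 2) + RtoC 1)%C
        by (rewrite <- RtoC_plus; f_equal; ring).
      replace (RtoC 4) with (RtoC 2 * RtoC 2)%C by (rewrite <- RtoC_mult; f_equal; ring).
      field; exact Hr2. }
  set (T := Rmax A1 (Rmax A2 A3)).
  pose proof (Rmax_l A1 (Rmax A2 A3)); pose proof (Rmax_r A1 (Rmax A2 A3)).
  pose proof (Rmax_l A2 A3); pose proof (Rmax_r A2 A3).
  assert (Hh : forall t, T < t -> h (RtoC t) = RtoC 0).
  { intros t Ht; unfold T in Ht.
    specialize (H1 t ltac:(lra)); specialize (H2 t ltac:(lra)); specialize (H3 t ltac:(lra)); specialize (H2' t ltac:(lra)).
    simpl in H1, H2, H3.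
    assert (Ed : dw (RtoC t) = RtoC (Re (dw (RtoC t)))) by (destruct (dw (RtoC t)); simpl in *; unfold RtoC; congruence).
    assert (Ew : w (RtoC t) = RtoC (Re (w (RtoC t)))) by (destruct (w (RtoC t)); simpl in *; unfold RtoC; congruence).
    assert (Eu : u (RtoC t) = RtoC (Re (u (RtoC t)))) by (destruct (u (RtoC t)); simpl in *; unfold RtoC; congruence).
    unfold h; rewrite Ed, Ew, Eu, <- RtoC_div, <- RtoC_mult, <- RtoC_minus, <- RtoC_plus by lra.
    f_equal; lra. }
  set (t0 := RtoC (T + 1)).
  assert (Hdh : dh t0 = RtoC 0).
  { assert (E : forall t, RtoC t = (RtoC 0 + RtoC t * RtoC 1)%C) by (intros; ring).
    pose proof (Dh (RtoC 0) (RtoC 1) (T + 1)) as P; rewrite <- E in P.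
    apply path_derive_locally_0 with (A := T) in P; [|lra|intros t Ht; rewrite <- E; now apply Hh].
    rewrite <- P; unfold t0; ring. }
  set (b := (z - t0)%C).
  assert (Ez : z = (t0 + RtoC 1 * b)%C) by (unfold b; ring).
  change (h z = RtoC 0); rewrite Ez.
  apply (linear_ode_zero (fun s => h (t0 + RtoC s * b)%C) (fun s => dh (t0 + RtoC s * b)%C)
    (fun s => Qf (t0 + RtoC s * b)%C) b
    (Rabs (nu + 1 + 1 / 2) + (Cmod t0 + Cmod b) * (Cmod t0 + Cmod b) / 4)).
  - intros s; apply Dh.
  - intros s; apply Ddh.
  - intros s Hs; unfold Qf.
    rewrite Cmod_opp; unfold Cminus; eapply Rle_trans; [apply Cmod_triangle|].
    rewrite Cmod_opp, Cmod_div, Cmod_mult, !Cmod_R by exact Hr4.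
    rewrite (Rabs_pos_eq 4) by lra.
    apply Rplus_le_compat_l; apply Rmult_le_compat_r; [lra|].
    assert (B : Cmod (t0 + RtoC s * b) <= Cmod t0 + Cmod b).
    { eapply Rle_trans; [apply Cmod_triangle|]; rewrite Cmod_mult, Cmod_R, Rabs_pos_eq by lra.
      pose proof (Cmod_ge_0 b); nra. }
    apply Rmult_le_compat; try exact B; apply Cmod_ge_0.
  - replace (t0 + RtoC 0 * b)%C with t0 by ring. apply Hh; lra.
  - replace (t0 + RtoC 0 * b)%C with t0 by ring. exact Hdh.
Qed.

Section Family.
Variable D : R -> C -> C.
Hypothesis hD : forall nu : R, is_parabolic_cylinder nu (D nu).

Lemma pcf_raise_path (nu : R) (a b : C) (s : R) :
  path_derive (fun s => D nu (a + RtoC s * b)%C) s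
   (b * ((a + RtoC s * b) / RtoC 2 * D nu (a + RtoC s * b) - D (nu + 1) (a + RtoC s * b)))%C.
Proof.
  destruct (hD nu) as [[dw [W1 W2]] W3]; destruct (hD (nu + 1)) as [[du [U1 U2]] U3].
  destruct (pcf_asymp _ _ W3) as [Aw Bw]; destruct (pcf_asymp _ _ U3) as [Au Bu].
  pose proof (pcf_raise nu (D nu) dw (D (nu + 1)) du (conj W1 W2) (conj U1 U2) Aw Bw Au Bu
    (a + RtoC s * b)%C) as E.
  eapply path_derive_eq; [|apply path_derive_comp, W1].
  set (z := (a + RtoC s * b)%C) in *.
  replace (dw z) with (dw z - z / RtoC 2 * D nu z + D (nu + 1) z + (z / RtoC 2 * D nu z - D (nu + 1) z))%C by ring.
  rewrite E; ring.
Qed.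

(** The raising relation at order [nu - 1] writes [D nu] by [D (nu - 1)] and its
    derivative; differentiate it and use Weber's equation. *)
Lemma pcf_lower_path (nu : R) (a b : C) (s : R) :
  path_derive (fun s => D nu (a + RtoC s * b)%C) s
   (b * (RtoC nu * D (nu - 1) (a + RtoC s * b) - (a + RtoC s * b) / RtoC 2 * D nu (a + RtoC s * b)))%C.
Proof.
  destruct (hD (nu - 1)) as [[dw [W1 W2]] W3]; destruct (hD nu) as [[du [U1 U2]] U3].
  destruct (pcf_asymp _ _ W3) as [Aw Bw]; destruct (pcf_asymp _ _ U3) as [Au Bu].
  assert (E1 : nu - 1 + 1 = nu) by ring.
  pose proof (fun H1 H2 H3 => pcf_raise (nu - 1) (D (nu - 1)) dw (D nu) du (conj W1 W2) H1 Aw Bw H2 H3) as E.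
  rewrite E1 in E; specialize (E (conj U1 U2) Au Bu).
  assert (Hr2 := RtoC_nonzero 2 ltac:(lra)).
  pose proof (path_derive_line a b s) as L.
  pose proof (path_derive_comp _ a b _ s (W1 (a + RtoC s * b)%C)) as P1.
  pose proof (path_derive_comp _ a b _ s (W2 (a + RtoC s * b)%C)) as P2.
  pose proof (path_derive_plus _ _ s _ _
    (path_derive_mult _ _ s _ _ (path_derive_mult _ _ s _ _ (path_derive_const (/ RtoC 2)%C s) L) P1)
    (path_derive_mult _ _ s _ _ (path_derive_const (- RtoC 1)%C s) P2)) as P.
  cbv beta in P.
  eapply path_derive_ext; [|eapply path_derive_eq; [|exact P]]; cycle 1.
  - specialize (E (a + RtoC s * b)%C).
    set (z := (a + RtoC s * b)%C) in *.
    assert (Ez : D nu z = (z / RtoC 2 * D (nu - 1) z - dw z)%C).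
    { replace (D nu z) with (dw z - z / RtoC 2 * D (nu - 1) z + D nu z + (z / RtoC 2 * D (nu - 1) z - dw z))%C by ring.
      rewrite E; ring. }
    rewrite Ez.
    replace (RtoC (nu - 1 + 1 / 2)) with (RtoC nu - / RtoC 2)%C
      by (rewrite <- RtoC_inv, <- RtoC_minus by lra; f_equal; field).
    replace (RtoC 4) with (RtoC 2 * RtoC 2)%C by (rewrite <- RtoC_mult; f_equal; ring).
    field; exact Hr2.
  - intros t; specialize (E (a + RtoC t * b)%C); cbv beta.
    set (z := (a + RtoC t * b)%C) in *.
    replace (D nu z) with (dw z - z / RtoC 2 * D (nu - 1) z + D nu z + (z / RtoC 2 * D (nu - 1) z - dw z))%C by ring.
    rewrite E; field; exact Hr2.
Qed.

Lemma pcf_recurrence (nu : R) (z : C) :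
  D (nu + 1) z = (z * D nu z - RtoC nu * D (nu - 1) z)%C.
Proof.
  pose proof (path_derive_unique _ _ _ _ (pcf_raise_path nu z (RtoC 1) 0) (pcf_lower_path nu z (RtoC 1) 0)) as E.
  assert (Hr2 := RtoC_nonzero 2 ltac:(lra)).
  replace (z + RtoC 0 * RtoC 1)%C with z in E by ring.
  replace (D (nu + 1) z) with (z / RtoC 2 * D nu z - RtoC 1 * (z / RtoC 2 * D nu z - D (nu + 1) z))%C by ring.
  rewrite E; field; exact Hr2.
Qed.

Lemma path_derive_gauss (c : R) (s : R) :
  path_derive (fun s => RtoC (exp (c * s ^ 2))) s (RtoC (2 * c * s * exp (c * s ^ 2))).
Proof.
  split; simpl; [|apply is_derive_const_R].
  auto_derive; [exact I|]. simpl; ring.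
Qed.

Lemma path_const (F : R -> C) : (forall s, path_derive F s (RtoC 0)) -> forall a b, F a = F b.
Proof.
  intros H a b.
  assert (E1 : Re (F a) = Re (F b)) by (apply (const_of_derive_0 (fun s => Re (F s))); intros t; apply H).
  assert (E2 : Im (F a) = Im (F b)) by (apply (const_of_derive_0 (fun s => Im (F s))); intros t; apply H).
  destruct (F a), (F b); simpl in *; congruence.
Qed.

(** At order [0] the lowering relation is the first order equation [w' = - (z / 2) w]. *)
Lemma pcf_0_line (b : C) (c : R) : (b * b)%C = RtoC (4 * c) -> forall s,
  (D 0 (RtoC s * b) * RtoC (exp (c * s ^ 2)))%C = D 0 (RtoC 0).
Proof.
  intros Hb.
  assert (Hr2 := RtoC_nonzero 2 ltac:(lra)).
  pose (F := fun s => (D 0 (RtoC 0 + RtoC s * b) * RtoC (exp (c * s ^ 2)))%C).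
  assert (E : forall s, D 0 (RtoC s * b)%C = D 0 (RtoC 0 + RtoC s * b)%C) by (intros; f_equal; ring).
  intros s; rewrite E; change (F s = D 0 (RtoC 0)).
  rewrite (path_const F) with (b := 0).
  - unfold F; replace (c * 0 ^ 2) with 0 by ring; rewrite exp_0, <- E.
    replace (RtoC 0 * b)%C with (RtoC 0) by ring; ring.
  - intros t.
    eapply path_derive_eq; [|apply path_derive_mult; [apply pcf_lower_path|apply path_derive_gauss]].
    rewrite !RtoC_mult.
    replace (RtoC c) with ((b * b) / (RtoC 2 * RtoC 2))%C; [field; exact Hr2|].
    rewrite Hb, RtoC_mult.
    replace (RtoC 4) with (RtoC 2 * RtoC 2)%C by (rewrite <- RtoC_mult; f_equal; ring).
    field; exact Hr2.
Qed.

Lemma pcf_0_real (t : R) : D 0 (RtoC t) = RtoC (exp (- (t ^ 2 / 4))).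
Proof.
  assert (H : forall s, (D 0 (RtoC s) * RtoC (exp (s ^ 2 / 4)))%C = D 0 (RtoC 0)).
  { intros s; rewrite <- (pcf_0_line (RtoC 1) (/ 4)) with (s := s).
    - f_equal; [f_equal; ring|f_equal; f_equal; field].
    - rewrite Rinv_r by lra; ring. }
  assert (Hinv : forall s, (RtoC (exp (s ^ 2 / 4)) * RtoC (exp (- (s ^ 2 / 4))))%C = RtoC 1).
  { intros s; rewrite <- RtoC_mult, <- exp_plus, Rplus_opp_r, exp_0; reflexivity. }
  assert (H1 : D 0 (RtoC 0) = RtoC 1).
  { destruct (hD 0) as [_ A]; destruct (pcf_asymp _ _ A) as [A1 A2].
    assert (Hs : forall s, 0 < s -> D 0 (RtoC s) = (RtoC (pcf_size 0 s) * D 0 (RtoC 0))%C).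
    { intros s Hs; rewrite <- (H s).
      replace (pcf_size 0 s) with (exp (- (s ^ 2 / 4))).
      - transitivity ((RtoC (exp (s ^ 2 / 4)) * RtoC (exp (- (s ^ 2 / 4)))) * D 0 (RtoC s))%C; [|ring].
        rewrite Hinv; ring.
      - unfold pcf_size; rewrite Rpower_O, Rmult_1_l by exact Hs; f_equal; field. }
    assert (Z : forall pr l, (pr = Re \/ pr = Im) -> asymp (fun t => pr (D 0 (RtoC t))) 0 l -> pr (D 0 (RtoC 0)) = l).
    { intros pr l Hpr Al; apply Rminus_diag_uniq.
      destruct (Req_dec (pr (D 0 (RtoC 0)) - l) 0) as [E|E]; [exact E|exfalso].
      apply Rabs_pos_lt in E; destruct (Al (Rabs (pr (D 0 (RtoC 0)) - l) / 2) ltac:(lra)) as [B HB].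
      set (s := Rmax B 0 + 1); pose proof (Rmax_l B 0); pose proof (Rmax_r B 0).
      specialize (HB s ltac:(unfold s; lra)); rewrite (Hs s ltac:(unfold s; lra)) in HB.
      pose proof (pcf_size_pos 0 s).
      replace (pr (RtoC (pcf_size 0 s) * D 0 (RtoC 0))%C - l * pcf_size 0 s)
        with ((pr (D 0 (RtoC 0)) - l) * pcf_size 0 s) in HB
        by (destruct Hpr; subst pr; unfold Re, Im; simpl; ring).
      rewrite Rabs_mult, (Rabs_pos_eq (pcf_size 0 s)) in HB by lra. nra. }
    pose proof (Z Re 1 (or_introl eq_refl) A1) as E1; pose proof (Z Im 0 (or_intror eq_refl) A2) as E2.
    destruct (D 0 (RtoC 0)); simpl in *; unfold RtoC; congruence. }
  transitivity ((RtoC (exp (t ^ 2 / 4)) * RtoC (exp (- (t ^ 2 / 4)))) * D 0 (RtoC t))%C; [rewrite Hinv; ring|].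
  transitivity ((D 0 (RtoC t) * RtoC (exp (t ^ 2 / 4))) * RtoC (exp (- (t ^ 2 / 4))))%C; [ring|].
  rewrite H, H1; ring.
Qed.

Lemma Ci_sq : (Ci * Ci)%C = (- RtoC 1)%C.
Proof. unfold Ci, RtoC, Cmult, Copp; simpl; f_equal; ring. Qed.

Lemma sqrt2_sq_C : (RtoC (sqrt 2) * RtoC (sqrt 2))%C = RtoC 2.
Proof. rewrite <- RtoC_mult, sqrt2_sq; reflexivity. Qed.

Lemma pcf_0_imag (s e : R) : e ^ 2 = 1 ->
  D 0 (RtoC s * (RtoC e * (RtoC (sqrt 2) * Ci)))%C = RtoC (exp (s ^ 2 / 2)).
Proof.
  intros He.
  assert (E := pcf_0_line (RtoC e * (RtoC (sqrt 2) * Ci))%C (- / 2)).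
  rewrite (pcf_0_real 0) in E; replace (- (0 ^ 2 / 4)) with 0 in E by field; rewrite exp_0 in E.
  assert (Hb : (RtoC e * (RtoC (sqrt 2) * Ci) * (RtoC e * (RtoC (sqrt 2) * Ci)))%C = RtoC (4 * - / 2)).
  { transitivity ((RtoC e * RtoC e) * (RtoC (sqrt 2) * RtoC (sqrt 2)) * (Ci * Ci))%C; [ring|].
    rewrite sqrt2_sq_C, Ci_sq, <- RtoC_mult; replace (e * e) with (e ^ 2) by ring; rewrite He.
    rewrite <- RtoC_opp, <- !RtoC_mult; f_equal; field. }
  specialize (E Hb s).
  set (d := D 0 _) in *.
  assert (Hinv : (RtoC (exp (- / 2 * s ^ 2)) * RtoC (exp (s ^ 2 / 2)))%C = RtoC 1).
  { rewrite <- RtoC_mult, <- exp_plus; replace (- / 2 * s ^ 2 + s ^ 2 / 2) with 0 by field.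
    rewrite exp_0; reflexivity. }
  transitivity (d * (RtoC (exp (- / 2 * s ^ 2)) * RtoC (exp (s ^ 2 / 2))))%C; [rewrite Hinv; ring|].
  rewrite Cmult_assoc, E; ring.
Qed.

Lemma RtoC_m1 : RtoC (-1) = (- RtoC 1)%C.
Proof. rewrite <- RtoC_opp; f_equal; ring. Qed.

(** * The function Lambda *)

Lemma Lambda_m1 (xi : R) : Lambda D (-1) xi = RtoC (2 * exp (xi ^ 2 / 2)).
Proof.
  unfold Lambda; change (Z.to_nat (-1 + 1)) with 0%nat; change (- -1 - 1)%Z with 0%Z.
  cbn [Cpow].
  replace (RtoC (sqrt 2) * Ci * RtoC xi)%C with (RtoC xi * (RtoC 1 * (RtoC (sqrt 2) * Ci)))%C by ring.
  replace (- (RtoC xi * (RtoC 1 * (RtoC (sqrt 2) * Ci))))%C with (RtoC xi * (RtoC (-1) * (RtoC (sqrt 2) * Ci)))%C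
    by (rewrite RtoC_m1; ring).
  rewrite !pcf_0_imag by ring.
  rewrite RtoC_mult; ring.
Qed.

(** By the raising relation [D (-1)] solves a first order equation with right side
    [- exp (- z^2 / 4)]. In the difference of its values at [z] and [- z] the constant of
    integration drops out, and on the imaginary axis the Gaussian becomes
    [exp (xi^2 / 2)], hence the Dawson integral. *)
Lemma Lambda_0 (xi : R) : Lambda D 0 xi = RtoC (2 * sqrt 2 * exp (- (xi ^ 2 / 2)) * dawson xi).
Proof.
  assert (Hr2 := RtoC_nonzero 2 ltac:(lra)).
  pose (c := (RtoC (sqrt 2) * Ci)%C).
  assert (Hc : (c * c)%C = (- RtoC 2)%C).
  { unfold c; transitivity ((RtoC (sqrt 2) * RtoC (sqrt 2)) * (Ci * Ci))%C; [ring|].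
    rewrite sqrt2_sq_C, Ci_sq; ring. }
  pose (L := fun xi => (Ci * (D (-1) (RtoC 0 + RtoC xi * c) - D (-1) (RtoC 0 + RtoC xi * - c)))%C).
  assert (EL : Lambda D 0 xi = L xi).
  { unfold Lambda, L, c; change (Z.to_nat (0 + 1)) with 1%nat; change (- 0 - 1)%Z with (-1)%Z; cbn [Cpow].
    replace (RtoC 0 + RtoC xi * (RtoC (sqrt 2) * Ci))%C with (RtoC (sqrt 2) * Ci * RtoC xi)%C by ring.
    replace (RtoC 0 + RtoC xi * - (RtoC (sqrt 2) * Ci))%C with (- (RtoC (sqrt 2) * Ci * RtoC xi))%C by ring.
    ring. }
  assert (DL : forall s, path_derive L s (- RtoC s * L s + RtoC (2 * sqrt 2 * exp (s ^ 2 / 2)))%C).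
  { intros s; unfold L.
    pose proof (pcf_raise_path (-1) (RtoC 0) c s) as P1.
    pose proof (pcf_raise_path (-1) (RtoC 0) (- c)%C s) as P2.
    replace (-1 + 1) with 0 in P1, P2 by ring.
    assert (V1 : D 0 (RtoC 0 + RtoC s * c)%C = RtoC (exp (s ^ 2 / 2))).
    { rewrite <- (pcf_0_imag s 1) by ring; f_equal; unfold c; ring. }
    assert (V2 : D 0 (RtoC 0 + RtoC s * - c)%C = RtoC (exp (s ^ 2 / 2))).
    { rewrite <- (pcf_0_imag s (-1)) by ring; f_equal; unfold c; rewrite RtoC_m1; ring. }
    rewrite V1 in P1; rewrite V2 in P2.
    pose proof (path_derive_mult _ _ s _ _ (path_derive_const Ci s) (path_derive_plus _ _ s _ _ P1
      (path_derive_mult _ _ s _ _ (path_derive_const (- RtoC 1)%C s) P2))) as P.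
    cbv beta in P.
    eapply path_derive_ext; [|eapply path_derive_eq; [|exact P]]; [intros t; cbv beta; ring|].
    set (E := RtoC (exp (s ^ 2 / 2))).
    set (d1 := D (-1) (RtoC 0 + RtoC s * c)%C); set (d2 := D (-1) (RtoC 0 + RtoC s * - c)%C).
    rewrite !RtoC_mult; fold E.
    transitivity (Ci * (RtoC s * (c * c) / RtoC 2 * (d1 - d2) - RtoC 2 * c * E))%C; [field; exact Hr2|].
    rewrite Hc; unfold c.
    transitivity (- RtoC s * (Ci * (d1 - d2)) - RtoC 2 * RtoC (sqrt 2) * (Ci * Ci) * E)%C; [field; exact Hr2|].
    rewrite Ci_sq; ring. }
  pose (F := fun s => (L s * RtoC (exp (/ 2 * s ^ 2)) + RtoC (- (2 * sqrt 2)) * RtoC (dawson s))%C).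
  assert (DF : forall s, path_derive F s (RtoC 0)).
  { intros s; unfold F.
    assert (DD : path_derive (fun s => RtoC (dawson s)) s (RtoC (exp (s ^ 2)))).
    { split; simpl; [apply is_derive_dawson|apply is_derive_const_R]. }
    eapply path_derive_eq; [|apply path_derive_plus; [apply path_derive_mult; [apply DL|apply path_derive_gauss]|
      apply path_derive_mult; [apply path_derive_const|exact DD]]].
    replace (2 * / 2 * s * exp (/ 2 * s ^ 2)) with (s * exp (/ 2 * s ^ 2)) by field.
    replace (exp (s ^ 2)) with (exp (s ^ 2 / 2) * exp (/ 2 * s ^ 2)) by (rewrite <- exp_plus; f_equal; field).
    rewrite RtoC_opp, !RtoC_mult; ring. }
  assert (EF : F xi = RtoC 0).
  { rewrite (path_const F DF xi 0); unfold F, L.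
    replace (RtoC 0 + RtoC 0 * c)%C with (RtoC 0 + RtoC 0 * - c)%C by ring.
    unfold dawson; rewrite RInt_point; change (@zero R_CompleteNormedModule) with 0. ring. }
  unfold F in EF; rewrite EL.
  assert (Hinv : (RtoC (exp (/ 2 * xi ^ 2)) * RtoC (exp (- (xi ^ 2 / 2))))%C = RtoC 1).
  { rewrite <- RtoC_mult, <- exp_plus; replace (/ 2 * xi ^ 2 + - (xi ^ 2 / 2)) with 0 by field.
    rewrite exp_0; reflexivity. }
  transitivity (L xi * (RtoC (exp (/ 2 * xi ^ 2)) * RtoC (exp (- (xi ^ 2 / 2)))))%C; [rewrite Hinv; ring|].
  transitivity ((L xi * RtoC (exp (/ 2 * xi ^ 2)) + RtoC (- (2 * sqrt 2)) * RtoC (dawson xi)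
     + RtoC (2 * sqrt 2) * RtoC (dawson xi)) * RtoC (exp (- (xi ^ 2 / 2))))%C.
  - rewrite RtoC_opp; ring.
  - rewrite EF, !RtoC_mult; ring.
Qed.

Lemma Lambda_recurrence (k : nat) (xi : R) :
  (RtoC (INR k + 1) * Lambda D (Z.of_nat k + 1) xi)%C =
  (RtoC (sqrt 2 * xi) * Lambda D (Z.of_nat k) xi - Lambda D (Z.of_nat k - 1) xi)%C.
Proof.
  unfold Lambda.
  replace (Z.to_nat (Z.of_nat k + 1 + 1)) with (S (S k)) by lia.
  replace (Z.to_nat (Z.of_nat k + 1)) with (S k) by lia.
  replace (Z.to_nat (Z.of_nat k - 1 + 1)) with k by lia.
  set (nu := IZR (- Z.of_nat k - 1)).
  replace (IZR (- (Z.of_nat k + 1) - 1)) with (nu - 1).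
  2:{ unfold nu; rewrite !minus_IZR, !opp_IZR, plus_IZR; ring. }
  replace (IZR (- (Z.of_nat k - 1) - 1)) with (nu + 1).
  2:{ unfold nu; rewrite !minus_IZR, !opp_IZR, minus_IZR; ring. }
  set (z := (RtoC (sqrt 2) * Ci * RtoC xi)%C).
  rewrite !(pcf_recurrence nu).
  replace (INR k + 1) with (- nu) by (unfold nu; rewrite minus_IZR, opp_IZR, <- INR_IZR_INZ; ring).
  rewrite RtoC_opp, !Cpow_S.
  set (ik := (Ci ^ k)%C); set (mk := ((- RtoC 1) ^ k)%C).
  set (d1 := D nu z); set (d2 := D nu (- z)%C); set (e1 := D (nu - 1) z); set (e2 := D (nu - 1) (- z)%C).
  transitivity (- RtoC nu * (Ci * Ci) * ik * (e1 + mk * e2))%C; [ring|]; rewrite Ci_sq.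
  unfold z; rewrite RtoC_mult.
  transitivity (RtoC nu * ik * (e1 + mk * e2))%C; ring.
Qed.

End Family.

(** * Asymptotics in degrees N and N + 1 *)

Lemma exp_neg_sq_lipschitz (a b : R) : Rabs (exp (- a ^ 2) - exp (- b ^ 2)) <= Rabs (a - b).
Proof.
  destruct (MVT_gen (fun t => exp (- t ^ 2)) b a (fun t => - (2 * t) * exp (- t ^ 2))) as [c [_ E]].
  - intros x _; auto_derive; [exact I|]. simpl; ring.
  - intros x _; apply derivable_continuous_pt; eexists; apply is_derive_Reals.
    auto_derive; [exact I|reflexivity].
  - rewrite E, Rabs_mult; rewrite <- (Rmult_1_l (Rabs (a - b))) at 2.
    apply Rmult_le_compat_r; [apply Rabs_pos|].
    rewrite Rabs_mult, (Rabs_pos_eq (exp _)) by (left; apply exp_pos).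
    assert (H : exp (- c ^ 2) <= / (1 + c ^ 2)).
    { replace (- c ^ 2) with (- (c ^ 2)) by ring; rewrite exp_Ropp; apply Rinv_le_contravar; [nra|].
      apply exp_ineq1_le. }
    assert (H2 : Rabs (- (2 * c)) <= 1 + c ^ 2) by (pose proof (pow2_ge_0 (c - 1)); pose proof (pow2_ge_0 (c + 1)); apply Rabs_le; split; lra).
    apply Rmult_le_reg_r with (1 + c ^ 2); [nra|].
    apply Rle_trans with (Rabs (- (2 * c)) * / (1 + c ^ 2) * (1 + c ^ 2)).
    + apply Rmult_le_compat_r; [nra|]; apply Rmult_le_compat_l; [apply Rabs_pos|exact H].
    + rewrite Rmult_assoc, Rinv_l by nra; lra.
Qed.

Lemma sqrt_PI2_bounds : 1 <= sqrt (PI / 2) <= 2.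
Proof.
  pose proof PI2_1; pose proof PI_4.
  split; [rewrite <- sqrt_1 at 1; apply sqrt_le_1; lra|].
  replace 2 with (sqrt (2 ^ 2)) at 2 by (rewrite sqrt_pow2; lra); apply sqrt_le_1; lra.
Qed.

Lemma sqrt2_bounds : 1 <= sqrt 2 <= 2.
Proof. pose proof sqrt2_sq; pose proof (sqrt_pos 2); nra. Qed.

Lemma sqrt_2PI : sqrt (2 * PI) = 2 * sqrt (PI / 2).
Proof.
  pose proof PI_RGT_0.
  replace (2 * PI) with (2 ^ 2 * (PI / 2)) by field.
  rewrite sqrt_mult, sqrt_pow2 by lra; reflexivity.
Qed.

Section Base.
Variables p q : R.
Hypotheses (hp : 0 < p) (hq : 0 < q) (hpq : p + q = 1).

Lemma pq_pos : 0 < p * q.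
Proof. nra. Qed.

(** The local limit theorem for the binomial weight next to the node, obtained by
    evaluating [fourier_limit] at the nearby point [xm] for which [m] is the node. *)
Lemma binomial_weight_limit (M eta : R) : 0 <= M -> 0 < eta ->
  exists N0, forall N, (N0 <= N)%nat -> forall xi, Rabs xi <= M ->
  forall m, (m <= N)%nat -> Rabs (INR m - node p q N xi) <= 1 ->
  Rabs (scale p q N * (PI * (Binomial.C N m * q ^ m * p ^ (N - m)))
        - exp (- xi ^ 2) * sqrt (PI / 2)) <= eta.
Proof.
  intros HM He.
  destruct (fourier_limit p q hp hq hpq 0 (M + 1) (eta / 2) ltac:(lra) ltac:(lra)) as [N1 H1].
  destruct (scale_large p q pq_pos (Rmax 1 (4 / eta))) as [N2 H2].
  exists (Nat.max N1 N2); intros N HN xi Hxi m Hm Hmx.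
  specialize (H2 N ltac:(lia)); specialize (H1 N ltac:(lia)).
  pose proof (Rmax_l 1 (4 / eta)); pose proof (Rmax_r 1 (4 / eta)).
  set (s := scale p q N) in *.
  pose (xm := (INR m - q * INR N) / (sqrt 2 * s)).
  pose proof sqrt2_bounds as S2; pose proof sqrt_PI2_bounds as SP.
  assert (Hs1 : 1 <= s) by lra.
  assert (Hs2 : 1 <= sqrt 2 * s) by nra.
  assert (Em : node p q N xm = INR m) by (unfold node, xm; fold s; field; split; lra).
  assert (Hd : Rabs (xm - xi) <= / s).
  { replace (xm - xi) with ((INR m - node p q N xi) / (sqrt 2 * s)) by (unfold node, xm; fold s; field; split; lra).
    unfold Rdiv; rewrite Rabs_mult, Rabs_inv, (Rabs_pos_eq (sqrt 2 * s)) by lra.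
    apply Rle_trans with (1 * / (sqrt 2 * s)).
    - apply Rmult_le_compat_r; [left; apply Rinv_0_lt_compat; lra|exact Hmx].
    - rewrite Rmult_1_l; apply Rinv_le_contravar; [lra|nra]. }
  assert (Hs3 : / s <= eta / 4).
  { replace (eta / 4) with (/ (4 / eta)) by (field; lra).
    apply Rinv_le_contravar; [apply Rdiv_lt_0_compat; lra|lra]. }
  assert (Hs4 : / s <= 1) by (rewrite <- Rinv_1; apply Rinv_le_contravar; lra).
  assert (Hxm : Rabs xm <= M + 1).
  { replace xm with (xi + (xm - xi)) by ring; eapply Rle_trans; [apply Rabs_triang|lra]. }
  specialize (H1 xm Hxm); rewrite Em, fourier_nat in H1 by exact Hm.
  unfold gauss_lim in H1; rewrite cos_0, sin_0, Rmult_0_r, Rmult_0_l, Rminus_0_r, Rmult_1_l in H1.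
  pose proof (exp_neg_sq_lipschitz xm xi) as HL.
  set (V := s * (PI * (Binomial.C N m * q ^ m * p ^ (N - m)))) in *.
  replace (V - exp (- xi ^ 2) * sqrt (PI / 2)) with
    ((V - exp (- xm ^ 2) * sqrt (PI / 2)) + (exp (- xm ^ 2) - exp (- xi ^ 2)) * sqrt (PI / 2)) by ring.
  eapply Rle_trans; [apply Rabs_triang|]; rewrite Rabs_mult, (Rabs_pos_eq (sqrt (PI / 2))) by lra.
  pose proof (Rabs_pos (exp (- xm ^ 2) - exp (- xi ^ 2))). nra.
Qed.

(** The distance of [m] from [q N] is [O(sqrt N)], so [m / (N - m)] tends to [q / p] and
    the two ratios in [gamma_corr_near_1] are [1 + O(1 / sqrt N)]. *)
Lemma gamma_corr_limit (M eta : R) : 0 <= M -> 0 < eta ->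
  exists N0, forall N, (N0 <= N)%nat -> forall xi, Rabs xi <= M ->
  forall m f, 0 <= f < 1 -> node p q N xi = INR m + f ->
  (1 <= m < N)%nat /\ Rabs (gamma_corr f m (N - m) * Rpower (p / q) f - 1) <= eta.
Proof.
  intros HM He.
  (* The error 2 d0 + d0^2 must not exceed eta. *)
  set (d0 := Rmin 1 (eta / 3)).
  assert (Hd0 : 0 < d0 <= 1 /\ 3 * d0 <= eta).
  { unfold d0; pose proof (Rmin_l 1 (eta / 3)); pose proof (Rmin_r 1 (eta / 3)).
    assert (0 < Rmin 1 (eta / 3)) by (apply Rmin_glb_lt; lra). lra. }
  destruct (scale_large p q pq_pos (4 * M + 4 + 4 * (M + 1) / (q * d0))) as [N0 H0].
  exists N0; intros N HN xi Hxi m f Hf Hx; specialize (H0 N HN).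
  pose proof (scale_sq p q hp hq N) as Hs.
  set (s := scale p q N) in *.
  assert (Hc : 0 < 4 * (M + 1) / (q * d0)) by (apply Rdiv_lt_0_compat; nra).
  assert (Hs4 : 4 * M + 4 <= s) by lra.
  assert (Hd : 4 * (M + 1) <= d0 * (q * s)).
  { replace (4 * (M + 1)) with (q * d0 * (4 * (M + 1) / (q * d0))) by (field; lra).
    replace (d0 * (q * s)) with (q * d0 * s) by ring.
    apply Rmult_le_compat_l; [nra|lra]. }
  set (B := 2 * M * s + 1).
  assert (HB : Rabs (INR m - q * INR N) <= B).
  { replace (INR m - q * INR N) with (sqrt 2 * xi * s - f) by (unfold node in Hx; fold s in Hx; lra).
    unfold Rminus; eapply Rle_trans; [apply Rabs_triang|]; rewrite Rabs_Ropp, (Rabs_pos_eq f) by lra.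
    rewrite !Rabs_mult, (Rabs_pos_eq s), (Rabs_pos_eq (sqrt 2)) by (try apply sqrt_pos; lra).
    pose proof sqrt2_bounds; pose proof (Rabs_pos xi).
    assert (sqrt 2 * Rabs xi <= 2 * M) by nra. unfold B; nra. }
  apply Rabs_le_between in HB.
  assert (HBs : B + 1 <= (2 * M + 2) * s) by (unfold B; nra).
  assert (HB2 : B <= s ^ 2 / 2) by (unfold B; nra).
  pose proof (pos_INR N) as PN.
  assert (Hp1 : s ^ 2 <= p * INR N) by (rewrite Hs; nra).
  assert (Hq1 : s ^ 2 <= q * INR N) by (rewrite Hs; nra).
  assert (Hm1 : s ^ 2 / 2 <= INR m) by lra.
  assert (HlR : INR N - INR m >= s ^ 2 / 2).
  { replace (INR N) with (p * INR N + q * INR N) by (rewrite <- Rmult_plus_distr_r, hpq; ring). lra. }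
  assert (Hs2 : 2 <= s ^ 2) by nra.
  assert (Hm : (1 <= m)%nat) by (apply INR_le; simpl; lra).
  assert (HmN : (m < N)%nat) by (apply INR_lt; lra).
  split; [lia|].
  assert (El : INR (N - m) = INR N - INR m) by (apply minus_INR; lia).
  set (l := (N - m)%nat) in *.
  assert (Hbound : forall X Y, Rabs X <= B + 1 -> s ^ 2 / 2 <= Y -> Rabs (X / (q * Y)) <= d0).
  { intros X Y HX HY.
    unfold Rdiv; rewrite Rabs_mult, Rabs_inv, (Rabs_pos_eq (q * Y)) by nra.
    apply Rmult_le_reg_r with (q * Y); [nra|].
    rewrite Rmult_assoc, Rinv_l, Rmult_1_r by nra.
    eapply Rle_trans; [exact HX|]; eapply Rle_trans; [exact HBs|].
    apply Rle_trans with (d0 * (q * (s ^ 2 / 2))).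
    - replace (d0 * (q * (s ^ 2 / 2))) with (d0 * (q * s) * (s / 2)) by field.
      replace ((2 * M + 2) * s) with (4 * (M + 1) * (s / 2)) by field.
      apply Rmult_le_compat_r; lra.
    - apply Rmult_le_compat_l; [lra|]; apply Rmult_le_compat_l; lra. }
  eapply Rle_trans; [apply (gamma_corr_near_1 f d0 (p / q) m l Hf Hm)|].
  - unfold l; lia.
  - apply Rdiv_lt_0_compat; assumption.
  - replace (INR m * (p / q) / (INR l + 1) - 1) with ((INR m - q * INR N - q) / (q * (INR l + 1))).
    + apply Hbound; [apply Rabs_le; lra|lra].
    + rewrite El; replace p with (1 - q) by lra; field; lra.
  - replace ((INR m + 1) * (p / q) / INR l - 1) with ((INR m - q * INR N + p) / (q * INR l)).
    + apply Hbound; [apply Rabs_le; lra|lra].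
    + rewrite El; replace p with (1 - q) by lra; field; lra.
  - replace (/ INR m) with (q / (q * INR m)) by (field; lra).
    eapply Rle_trans; [apply Rle_abs|]; apply Hbound; [rewrite Rabs_pos_eq; unfold B; nra|exact Hm1].
  - nra.
Qed.

Definition binary_power (N : nat) (x : R) : R := exp (x * ln q + (INR N - x) * ln p).

Lemma binary_power_split (N m : nat) (f : R) : (m <= N)%nat ->
  q ^ m * p ^ (N - m) = binary_power N (INR m + f) * Rpower (p / q) f.
Proof.
  intros H; unfold binary_power, Rpower, Rdiv.
  rewrite <- !Rpower_pow, ln_mult, ln_Rinv by (try apply Rinv_0_lt_compat; assumption).
  unfold Rpower; rewrite <- !exp_plus, minus_INR by exact H; f_equal; ring.
Qed.

Lemma sin_cos_shift (m : nat) (f : R) :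
  sin (PI * (INR m + f)) = (-1) ^ m * sin (PI * f) /\ cos (PI * (INR m + f)) = (-1) ^ m * cos (PI * f).
Proof.
  induction m as [|m [IH1 IH2]]; [simpl; split; rewrite Rplus_0_l; ring|].
  replace (PI * (INR (S m) + f)) with (PI * (INR m + f) + PI) by (rewrite S_INR; ring).
  rewrite neg_sin, neg_cos, IH1, IH2; simpl; split; ring.
Qed.

Lemma sin_cos_reflect (N : nat) (x : R) :
  sin (PI * (INR N - x)) = - ((-1) ^ N * sin (PI * x)) /\
  cos (PI * (INR N - x)) = (-1) ^ N * cos (PI * x).
Proof.
  unfold Rminus; destruct (sin_cos_shift N (- x)) as [-> ->].
  replace (PI * - x) with (- (PI * x)) by ring; rewrite sin_neg, cos_neg; split; ring.
Qed.

Lemma frac_not_nat (m k : nat) (f : R) : 0 < f < 1 -> INR m + f <> INR k.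
Proof.
  intros Hf E; destruct (le_lt_dec k m) as [H|H].
  - apply le_INR in H; lra.
  - assert (H' : (m + 1 <= k)%nat) by lia; apply le_INR in H'; rewrite plus_INR in H'; simpl in H'; lra.
Qed.

Lemma weight_pos (N m : nat) : (m <= N)%nat -> 0 < Binomial.C N m * q ^ m * p ^ (N - m).
Proof.
  intros H; apply Rmult_lt_0_compat; [apply Rmult_lt_0_compat|]; try (apply pow_lt; assumption).
  unfold Binomial.C; apply Rdiv_lt_0_compat; [|apply Rmult_lt_0_compat]; apply INR_fact_lt_0.
Qed.

Section OffNodes.
Variables (N m : nat) (f : R).
Hypotheses (Hm : (1 <= m < N)%nat) (Hf : 0 < f < 1).
Let x := INR m + f.
Let w := Binomial.C N m * q ^ m * p ^ (N - m).
Let rho := gamma_corr f m (N - m) * Rpower (p / q) f.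

Lemma falling_exact :
  falling x (S N) = - (INR (fact N) * sin (PI * (INR N - x)) * binary_power N x * rho / (PI * w)).
Proof.
  pose proof PI_RGT_0 as HP; pose proof (weight_pos N m ltac:(lia)) as Hw; fold w in Hw.
  destruct (sin_cos_reflect N x) as [-> _].
  destruct (sin_cos_shift m f) as [Es _]; fold x in Es; rewrite Es.
  replace (S N) with (S (m + (N - m))) by lia.
  unfold x at 1; rewrite falling_sin by (try lia; assumption).
  unfold rho, x.
  replace (INR (fact N) * - ((-1) ^ N * ((-1) ^ m * sin (PI * f))) * binary_power N (INR m + f) *
     (gamma_corr f m (N - m) * Rpower (p / q) f) / (PI * w)) with
    (INR (fact N) * - ((-1) ^ N * ((-1) ^ m * sin (PI * f))) * gamma_corr f m (N - m) *
     (binary_power N (INR m + f) * Rpower (p / q) f) / (PI * w)) by (unfold Rdiv; ring).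
  rewrite <- binary_power_split by lia.
  replace ((-1) ^ N) with ((-1) ^ m * (-1) ^ (N - m)) by (rewrite <- pow_add; f_equal; lia).
  replace ((-1) ^ m * (-1) ^ (N - m) * ((-1) ^ m * sin (PI * f))) with
    (((-1) ^ m * (-1) ^ m) * (-1) ^ (N - m) * sin (PI * f)) by ring.
  rewrite pow_m1_sq; unfold w, Binomial.C.
  pose proof (INR_fact_lt_0 N); pose proof (INR_fact_lt_0 m); pose proof (INR_fact_lt_0 (N - m)).
  pose proof (pow_lt q m hq); pose proof (pow_lt p (N - m) hp).
  field; repeat split; lra.
Qed.

Lemma Krawtchouk_top_exact :
  Krawtchouk (S N) x N p q =
  - (sin (PI * (INR N - x)) * binary_power N x * rho / (PI * w * INR (S N))).
Proof.
  rewrite Krawtchouk_top, falling_exact, fact_simpl, mult_INR by exact hpq.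
  pose proof PI_RGT_0 as HP; pose proof (weight_pos N m ltac:(lia)) as Hw; fold w in Hw.
  pose proof (INR_fact_lt_0 N); pose proof (pos_INR N).
  assert (INR (S N) <> 0) by (apply not_0_INR; lia).
  field; repeat split; lra.
Qed.

Lemma Krawtchouk_diag_exact :
  Krawtchouk N x N p q =
  binary_power N x * rho / (PI * w) *
  (cos (PI * (INR N - x)) * fourier p q N x 0 + sin (PI * (INR N - x)) * fourier p q N x (PI / 2)).
Proof.
  assert (Hx : forall k, (k <= N)%nat -> x <> INR k) by (intros k _; apply frac_not_nat, Hf).
  pose proof (Ebin_frac_fourier p q N x Hx) as E.
  rewrite fourier_split, cos_neg, sin_neg in E.
  rewrite Krawtchouk_diag_frac, falling_exact by exact Hx.
  destruct (sin_cos_reflect N x) as [-> ->].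
  pose proof PI_RGT_0 as HP; pose proof (weight_pos N m ltac:(lia)) as Hw; fold w in Hw.
  pose proof (INR_fact_lt_0 N).
  transitivity (binary_power N x * rho / (PI * w) * ((-1) ^ N * (sin (PI * x) * Ebin p q N (fun k => / (x - INR k))))).
  - field; repeat split; lra.
  - rewrite E; ring.
Qed.
End OffNodes.

Lemma punctured_zero (N m k : nat) : (m <= N)%nat -> (k <= N)%nat -> k <> m -> punctured (INR m) N k = 0.
Proof.
  intros Hm Hk Hkm; unfold punctured.
  assert (Z : forall a n, (a < n)%nat -> falling (INR a) n = 0).
  { intros a n H; replace n with (a + (1 + (n - a - 1)))%nat by lia.
    rewrite falling_add, (falling_add _ 1); simpl; ring. }
  destruct (le_lt_dec m k) as [H|H].
  - rewrite Z by lia; ring.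
  - rewrite <- minus_INR by lia; rewrite (Z _ (N - k)%nat) by lia; ring.
Qed.

(** At a node a single Lagrange term survives. *)
Lemma Krawtchouk_diag_node (N m : nat) : (m <= N)%nat ->
  Krawtchouk N (INR m) N p q = binary_power N (INR m) * cos (PI * (INR N - INR m)).
Proof.
  intros Hm; rewrite Krawtchouk_diag.
  assert (Hterm : punctured (INR m) N m / INR (fact N) * (Binomial.C N m * q ^ m * p ^ (N - m))
     = binary_power N (INR m) * cos (PI * (INR N - INR m))).
  { pose proof (binary_power_split N m 0 Hm) as E; rewrite Rplus_0_r in E.
    unfold Rpower in E; rewrite Rmult_0_l, exp_0, Rmult_1_r in E; rewrite <- E.
    rewrite <- minus_INR by lia.
    destruct (sin_cos_shift (N - m) 0) as [_ Ec]; rewrite Rplus_0_r, Rmult_0_r, cos_0 in Ec; rewrite Ec.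
    unfold punctured, Binomial.C.
    pose proof (falling_near 0 m) as F1; rewrite Rplus_0_r in F1; rewrite F1.
    replace (INR m - INR (S m)) with (0 - 1) by (rewrite S_INR; ring).
    rewrite falling_below.
    assert (R1 : forall n, rising_ratio 0 n = 1).
    { induction n as [|n IH]; cbn [rising_ratio]; [reflexivity|rewrite IH; unfold Rdiv; ring]. }
    rewrite Ropp_0, !R1.
    pose proof (INR_fact_lt_0 N); pose proof (INR_fact_lt_0 m); pose proof (INR_fact_lt_0 (N - m)).
    field; repeat split; lra. }
  rewrite <- Hterm, (sum_f_R0_single _ m N Hm); [reflexivity|].
  intros k Hk Hkm; rewrite punctured_zero by assumption; unfold Rdiv; ring.
Qed.

Lemma Krawtchouk_top_node (N m : nat) : (m <= N)%nat -> Krawtchouk (S N) (INR m) N p q = 0.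
Proof.
  intros Hm; rewrite Krawtchouk_top by exact hpq.
  rewrite <- (punctured_spec (INR m) N m Hm), Rminus_diag; unfold Rdiv; ring.
Qed.

Lemma node_decompose (N : nat) (x : R) : 0 <= x -> exists m f, 0 <= f < 1 /\ x = INR m + f.
Proof.
  intros H; exists (Z.to_nat (Int_part x)), (frac_part x); split.
  - destruct (base_fp x); lra.
  - assert (0 <= Int_part x)%Z.
    { destruct (base_Int_part x) as [B1 B2].
      apply le_IZR; apply Rnot_lt_le; intros Hlt.
      assert ((Int_part x <= -1)%Z) by (apply lt_IZR in Hlt; lia).
      apply IZR_le in H0; lra. }
    rewrite INR_IZR_INZ, Z2Nat.id by assumption; unfold frac_part; ring.
Qed.

Lemma dawson_bound (xi : R) : exp (- xi ^ 2) * Rabs (dawson xi) <= Rabs xi.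
Proof.
  assert (H : Rabs (dawson xi) <= exp (xi ^ 2) * Rabs xi).
  { apply (Rabs_le_of_derive dawson (fun t => exp (t ^ 2))).
    - unfold dawson; rewrite RInt_point; reflexivity.
    - apply is_derive_dawson.
    - intros t Ht; rewrite Rabs_pos_eq by (left; apply exp_pos); apply exp_mono.
      rewrite <- (pow2_abs t), <- (pow2_abs xi); apply pow_incr; split; [apply Rabs_pos|exact Ht]. }
  apply Rle_trans with (exp (- xi ^ 2) * (exp (xi ^ 2) * Rabs xi)).
  - apply Rmult_le_compat_l; [left; apply exp_pos|exact H].
  - rewrite <- Rmult_assoc, <- exp_plus; replace (- xi ^ 2 + xi ^ 2) with 0 by ring; rewrite exp_0; lra.
Qed.

(** [V] is the scaled binomial weight with limit [v], and [rho] is close to [1]. *)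
Lemma quotient_close (rho V v v0 d : R) :
  0 < v0 <= 1 -> v0 <= v <= 2 -> 0 < d <= v0 / 2 -> Rabs (rho - 1) <= d -> Rabs (V - v) <= d ->
  0 < V /\ Rabs (rho / V) <= 4 / v0 /\ Rabs (rho / V - / v) <= 6 * d / v0 ^ 2.
Proof.
  intros H0 Hv Hd Hr HV; apply Rabs_le_between in HV.
  assert (HV0 : v0 / 2 <= V) by lra.
  assert (HiV : / V <= 2 / v0).
  { replace (2 / v0) with (/ (v0 / 2)) by (field; lra); apply Rinv_le_contravar; lra. }
  assert (Hiv : / v <= / v0) by (apply Rinv_le_contravar; lra).
  assert (HiVp : 0 < / V) by (apply Rinv_0_lt_compat; lra).
  assert (Hivp : 0 < / v) by (apply Rinv_0_lt_compat; lra).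
  assert (Hr2 : Rabs rho <= 2).
  { replace rho with (1 + (rho - 1)) by ring; eapply Rle_trans; [apply Rabs_triang|]; rewrite Rabs_R1; lra. }
  repeat split; [lra| |].
  - unfold Rdiv at 1; rewrite Rabs_mult, Rabs_inv, (Rabs_pos_eq V) by lra.
    replace (4 / v0) with (2 * (2 / v0)) by (field; lra).
    apply Rmult_le_compat; [apply Rabs_pos|lra|exact Hr2|exact HiV].
  - replace (rho / V - / v) with (((rho - 1) * v + (v - V)) * (/ V * / v)) by (field; lra).
    rewrite Rabs_mult, (Rabs_pos_eq (/ V * / v)) by nra.
    replace (6 * d / v0 ^ 2) with (3 * d * (2 / v0 * / v0)) by (field; lra).
    apply Rmult_le_compat; [apply Rabs_pos|nra| |].
    + eapply Rle_trans; [apply Rabs_triang|]; rewrite Rabs_mult, (Rabs_pos_eq v) by lra.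
      assert (Rabs (v - V) <= d) by (apply Rabs_le; lra).
      pose proof (Rabs_pos (rho - 1)). nra.
    + apply Rmult_le_compat; lra.
Qed.

Definition osc (al be th : R) : R := al * cos th - / sqrt (2 * PI) * be * sin th.

(** Away from the nodes, both polynomials carry the factor [rho / V], which tends
    to [exp (xi^2) / sqrt (PI / 2)]; the amplitudes at degree [N] are this factor times
    the cosine and the sine part of the Fourier integral. *)
Lemma base_amplitudes (M eta : R) : 0 <= M -> 0 < eta ->
  exists N0, forall N, (N0 <= N)%nat -> forall xi, Rabs xi <= M ->
  exists al be be1,
    Rabs (al - exp (- (xi ^ 2 / 2))) <= eta /\
    Rabs (be - 2 * sqrt 2 * exp (- (xi ^ 2 / 2)) * dawson xi) <= eta /\
    Rabs (be1 - 2 * exp (xi ^ 2 / 2)) <= eta /\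
    Krawtchouk N (node p q N xi) N p q =
      binary_power N (node p q N xi) * exp (xi ^ 2 / 2) * osc al be (PI * (INR N - node p q N xi)) /\
    Krawtchouk (S N) (node p q N xi) N p q =
      scale p q N / INR N * (binary_power N (node p q N xi) * exp (xi ^ 2 / 2)
        * osc 0 be1 (PI * (INR N - node p q N xi))).
Proof.
  intros HM He.
  set (v0 := exp (- M ^ 2)).
  assert (Hv0 : 0 < v0 <= 1) by (unfold v0; split; [apply exp_pos|apply exp_neg_le_1, pow2_ge_0]).
  (* Four times the error constant (16 + 12 M) / v0^2 found below: the amplitudes carry
     the further factor s2p * eh, which is at most 4. *)
  set (c := (64 + 48 * M) / v0 ^ 2).
  assert (Hv02 : 0 < v0 ^ 2 <= v0) by nra.
  assert (Hc : 0 < c) by (apply Rdiv_lt_0_compat; lra).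
  set (d := Rmin (v0 / 2) (eta / c)).
  assert (Hd : 0 < d <= v0 / 2).
  { split; [apply Rmin_glb_lt; [lra|apply Rdiv_lt_0_compat; lra]|apply Rmin_l]. }
  assert (Hdc : c * d <= eta).
  { replace eta with (c * (eta / c)) by (field; lra). apply Rmult_le_compat_l; [lra|apply Rmin_r]. }
  destruct (fourier_limit p q hp hq hpq 0 M d HM ltac:(lra)) as [N1 H1].
  destruct (fourier_limit p q hp hq hpq (PI / 2) M d HM ltac:(lra)) as [N2 H2].
  destruct (binomial_weight_limit M d HM ltac:(lra)) as [N3 H3].
  destruct (gamma_corr_limit M d HM ltac:(lra)) as [N4 H4].
  destruct (INR_unbounded (/ d)) as [N5 H5].
  destruct (scale_large p q pq_pos (4 * M + 4)) as [N6 H6].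
  exists (N1 + N2 + N3 + N4 + N5 + N6 + 1)%nat; intros N HN xi Hxi.
  specialize (H1 N ltac:(lia) xi Hxi); specialize (H2 N ltac:(lia) xi Hxi).
  specialize (H3 N ltac:(lia) xi Hxi); specialize (H4 N ltac:(lia) xi Hxi).
  specialize (H6 N ltac:(lia)).
  assert (HNR : / d <= INR N) by (assert (HN5 : (N5 <= N)%nat) by lia; apply le_INR in HN5; lra).
  pose proof (scale_sq p q hp hq N) as Hs.
  set (s := scale p q N) in *; set (x := node p q N xi) in *.
  assert (Hx0 : 0 <= x).
  { unfold x, node; fold s.
    pose proof sqrt2_bounds; pose proof (pos_INR N); apply Rabs_le_between in Hxi.
    assert (s ^ 2 <= q * INR N) by (rewrite Hs; nra).
    assert (- (2 * M) <= sqrt 2 * xi) by nra. nra. }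
  destruct (node_decompose N x Hx0) as [m [f [Hf Ex]]].
  destruct (H4 m f Hf Ex) as [Hm Hrho].
  assert (Hsp : 0 < s) by lra.
  assert (HNp : 0 < INR N) by (apply lt_0_INR; lia).
  pose proof PI_RGT_0 as HP; pose proof sqrt_PI2_bounds as SP; pose proof sqrt_2PI as E2P.
  destruct (Req_dec f 0) as [Hf0|Hf0].
  - (* At a node the sine vanishes, so the limits themselves serve as amplitudes. *)
    assert (Exm : x = INR m) by lra.
    exists (exp (- (xi ^ 2 / 2))), (2 * sqrt 2 * exp (- (xi ^ 2 / 2)) * dawson xi), (2 * exp (xi ^ 2 / 2)).
    assert (Hsin : sin (PI * (INR N - x)) = 0).
    { rewrite Exm, <- minus_INR by lia; destruct (sin_cos_shift (N - m) 0) as [E _].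
      rewrite Rplus_0_r, Rmult_0_r, sin_0, Rmult_0_r in E; exact E. }
    rewrite !Rminus_diag, Rabs_R0; repeat split; try lra; unfold osc; rewrite Hsin.
    + rewrite Exm, Krawtchouk_diag_node by lia.
      rewrite Rmult_0_r, Rminus_0_r.
      transitivity (binary_power N (INR m) * (exp (xi ^ 2 / 2) * exp (- (xi ^ 2 / 2))) * cos (PI * (INR N - INR m))).
      * rewrite <- exp_plus, Rplus_opp_r, exp_0; ring.
      * ring.
    + rewrite Exm, Krawtchouk_top_node by lia; ring.
  - assert (Hf' : 0 < f < 1) by lra.
    pose proof (Krawtchouk_top_exact N m f Hm Hf') as KT; pose proof (Krawtchouk_diag_exact N m f Hm Hf') as KD.
    rewrite <- Ex in KT, KD.
    specialize (H3 m ltac:(lia)).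
    assert (Hmx : Rabs (INR m - x) <= 1) by (rewrite Ex; apply Rabs_le; lra).
    specialize (H3 Hmx).
    pose proof (weight_pos N m ltac:(lia)) as Hw.
    set (w := Binomial.C N m * q ^ m * p ^ (N - m)) in *.
    set (rho := gamma_corr f m (N - m) * Rpower (p / q) f) in *.
    set (V := s * (PI * w)) in *.
    set (v := exp (- xi ^ 2) * sqrt (PI / 2)) in *.
    assert (Hvb : v0 <= v <= 2).
    { assert (Ev : v0 <= exp (- xi ^ 2)).
      { unfold v0; apply exp_mono; rewrite <- (pow2_abs xi).
        assert (Rabs xi ^ 2 <= M ^ 2) by (apply pow_incr; split; [apply Rabs_pos|exact Hxi]). lra. }
      assert (exp (- xi ^ 2) <= 1) by (apply exp_neg_le_1, pow2_ge_0).
      unfold v; pose proof (exp_pos (- xi ^ 2)); nra. }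
    destruct (quotient_close rho V v v0 d Hv0 Hvb Hd Hrho H3) as [HVp [Hy Hyv]].
    set (y := rho / V) in *.
    unfold gauss_lim in H1, H2.
    rewrite cos_0, sin_0, Rmult_0_r, Rmult_0_l, Rminus_0_r, Rmult_1_l in H1; fold v in H1.
    rewrite cos_PI2, sin_PI2, Rmult_0_l, Rmult_1_r in H2.
    set (C0 := s * fourier p q N x 0) in *; set (C1 := s * fourier p q N x (PI / 2)) in *.
    set (c1 := exp (- xi ^ 2) * (0 - sqrt 2 * dawson xi)) in *.
    assert (Hc1 : Rabs c1 <= 2 * M).
    { unfold c1; replace (exp (- xi ^ 2) * (0 - sqrt 2 * dawson xi)) with (- (sqrt 2 * (exp (- xi ^ 2) * dawson xi))) by ring.
      rewrite Rabs_Ropp, !Rabs_mult, (Rabs_pos_eq (sqrt 2)), (Rabs_pos_eq (exp _)) by (try apply sqrt_pos; left; apply exp_pos).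
      pose proof (dawson_bound xi); pose proof sqrt2_bounds; pose proof (Rabs_pos xi).
      assert (0 <= exp (- xi ^ 2) * Rabs (dawson xi)) by (apply Rmult_le_pos; [left; apply exp_pos|apply Rabs_pos]).
      nra. }
    set (eh := exp (- (xi ^ 2 / 2))).
    assert (Heh : 0 < eh <= 1) by (split; [apply exp_pos|apply exp_neg_le_1; pose proof (pow2_ge_0 xi); lra]).
    assert (Eeh : exp (xi ^ 2 / 2) * eh = 1) by (unfold eh; rewrite <- exp_plus, Rplus_opp_r; apply exp_0).
    assert (Ev2 : eh * eh = exp (- xi ^ 2)) by (unfold eh; rewrite <- exp_plus; f_equal; field).
    set (s2p := sqrt (2 * PI)) in *.
    assert (Hs2p : 2 <= s2p <= 4) by lra.
    assert (Hcd1 : 16 * d / v0 ^ 2 <= eta / 4).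
    { apply Rle_trans with (c * d / 4); [|lra].
      unfold c; replace ((64 + 48 * M) / v0 ^ 2 * d / 4) with ((16 + 12 * M) * d / v0 ^ 2) by (field; lra).
      apply Rmult_le_compat_r; [left; apply Rinv_0_lt_compat; lra|nra]. }
    assert (Hcd2 : (16 + 12 * M) * d / v0 ^ 2 <= eta / 4).
    { apply Rle_trans with (c * d / 4); [|lra].
      right; unfold c; field; lra. }
    assert (Hdv : 4 / v0 * d <= 4 * d / v0 ^ 2).
    { replace (4 / v0 * d) with (4 * d * / v0) by (field; lra).
      apply Rmult_le_compat_l; [lra|]; apply Rinv_le_contravar; lra. }
    assert (Hya : Rabs (y * C0 - 1) <= 16 * d / v0 ^ 2).
    { replace (y * C0 - 1) with (y * (C0 - v) + v * (y - / v)) by (field; lra).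
      eapply Rle_trans; [apply Rabs_triang|]; rewrite !Rabs_mult, (Rabs_pos_eq v) by lra.
      assert (Rabs y * Rabs (C0 - v) <= 4 / v0 * d) by (apply Rmult_le_compat; auto using Rabs_pos).
      assert (v * Rabs (y - / v) <= 2 * (6 * d / v0 ^ 2)) by (apply Rmult_le_compat; try lra; apply Rabs_pos).
      replace (16 * d / v0 ^ 2) with (4 * d / v0 ^ 2 + 2 * (6 * d / v0 ^ 2)) by (field; lra). lra. }
    assert (Hyb : Rabs (y * C1 - c1 / v) <= (16 + 12 * M) * d / v0 ^ 2).
    { replace (y * C1 - c1 / v) with (y * (C1 - c1) + c1 * (y - / v)) by (field; lra).
      eapply Rle_trans; [apply Rabs_triang|]; rewrite !Rabs_mult.
      assert (Rabs y * Rabs (C1 - c1) <= 4 / v0 * d) by (apply Rmult_le_compat; auto using Rabs_pos).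
      assert (Rabs c1 * Rabs (y - / v) <= 2 * M * (6 * d / v0 ^ 2)) by (apply Rmult_le_compat; auto using Rabs_pos).
      assert (0 < d / v0 ^ 2) by (apply Rdiv_lt_0_compat; lra).
      replace ((16 + 12 * M) * d / v0 ^ 2) with (4 * d / v0 ^ 2 + 2 * M * (6 * d / v0 ^ 2) + 12 * (d / v0 ^ 2)) by (field; lra). lra. }
    assert (Hyc : Rabs (y * (INR N / INR (S N)) - / v) <= 16 * d / v0 ^ 2).
    { rewrite S_INR.
      replace (y * (INR N / (INR N + 1)) - / v) with ((y - / v) + - (y * / (INR N + 1))) by (field; lra).
      eapply Rle_trans; [apply Rabs_triang|]; rewrite Rabs_Ropp, Rabs_mult, Rabs_inv, (Rabs_pos_eq (INR N + 1)) by lra.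
      assert (/ (INR N + 1) <= d).
      { rewrite <- (Rinv_inv d); apply Rinv_le_contravar; [apply Rinv_0_lt_compat; lra|lra]. }
      assert (Rabs y * / (INR N + 1) <= 4 / v0 * d).
      { apply Rmult_le_compat; auto using Rabs_pos. left; apply Rinv_0_lt_compat; lra. }
      assert (0 < d / v0 ^ 2) by (apply Rdiv_lt_0_compat; lra).
      replace (16 * d / v0 ^ 2) with (6 * d / v0 ^ 2 + 4 * d / v0 ^ 2 + 6 * (d / v0 ^ 2)) by (field; lra). lra. }
    assert (Hmul : forall X Y, Rabs X <= Y -> Y <= eta / 4 -> Rabs (s2p * eh * X) <= eta).
    { intros X Y HX HY; rewrite Rabs_mult, (Rabs_pos_eq (s2p * eh)) by nra.
      apply Rle_trans with (4 * Y); [|lra].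
      apply Rmult_le_compat; [nra|apply Rabs_pos|nra|exact HX]. }
    exists (eh * (y * C0)), (- (s2p * eh * (y * C1))), (s2p * eh * (y * (INR N / INR (S N)))).
    assert (HSN : 0 < INR (S N)) by (apply lt_0_INR; lia).
    assert (Ey : binary_power N x * rho / (PI * w) = binary_power N x * (y * s)).
    { unfold y, V; field; repeat split; lra. }
    repeat split.
    + replace (eh * (y * C0) - eh) with (eh * (y * C0 - 1)) by ring.
      rewrite Rabs_mult, (Rabs_pos_eq eh) by lra.
      pose proof (Rabs_pos (y * C0 - 1)). nra.
    + replace (- (s2p * eh * (y * C1)) - 2 * sqrt 2 * eh * dawson xi) with (- (s2p * eh * (y * C1 - c1 / v))).
      * rewrite Rabs_Ropp; eapply Hmul; [exact Hyb|exact Hcd2].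
      * unfold c1, v; rewrite E2P; pose proof (exp_pos (- xi ^ 2)); field; lra.
    + replace (s2p * eh * (y * (INR N / INR (S N))) - 2 * exp (xi ^ 2 / 2))
        with (s2p * eh * (y * (INR N / INR (S N)) - / v)).
      * eapply Hmul; [exact Hyc|exact Hcd1].
      * unfold v; rewrite <- Ev2.
        replace (exp (xi ^ 2 / 2)) with (/ eh) by (apply Rmult_eq_reg_r with eh; [rewrite Eeh; field|]; lra).
        rewrite E2P; field; repeat split; lra.
    + rewrite KD, Ey; unfold osc; fold s2p.
      transitivity (binary_power N x * (exp (xi ^ 2 / 2) * eh) *
        (y * C0 * cos (PI * (INR N - x)) + (/ s2p * s2p) * (y * C1) * sin (PI * (INR N - x)))).
      * rewrite Eeh, Rinv_l by lra; unfold C0, C1; ring.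
      * ring.
    + rewrite KT; unfold osc; fold s2p.
      transitivity (- (s / INR N) * binary_power N x * (exp (xi ^ 2 / 2) * eh) *
        ((/ s2p * s2p) * (y * (INR N / INR (S N))) * sin (PI * (INR N - x)))).
      * rewrite Eeh, Rinv_l by lra.
        transitivity (- (sin (PI * (INR N - x)) * (binary_power N x * rho / (PI * w)) / INR (S N))).
        -- field; repeat split; lra.
        -- rewrite Ey; field; lra.
      * ring.
Qed.

End Base.

(** * Induction on j *)

(** The limiting recurrence in [j], solved from [j = -1] and [j = 0]; the index is [j + 1]. *)
Fixpoint amplitude (a0 a1 : R -> R) (xi : R) (k : nat) : R :=
  match k with
  | O => a0 xi
  | S k' =>
    match k' with
    | O => a1 xi
    | S k'' => (sqrt 2 * xi * amplitude a0 a1 xi k' - amplitude a0 a1 xi k'') / (INR k'' + 1)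
    end
  end.

Lemma amplitude_SS (a0 a1 : R -> R) (xi : R) (k : nat) :
  amplitude a0 a1 xi (S (S k)) =
  (sqrt 2 * xi * amplitude a0 a1 xi (S k) - amplitude a0 a1 xi k) / (INR k + 1).
Proof. reflexivity. Qed.

Lemma two_step_ind (P : nat -> Prop) :
  P 0%nat -> P 1%nat -> (forall k, P k -> P (S k) -> P (S (S k))) -> forall k, P k.
Proof.
  intros H0 H1 HS k; enough (P k /\ P (S k)) by tauto.
  induction k as [|k [A B]]; split; auto.
Qed.

Lemma amplitude_bounded (a0 a1 : R -> R) (M : R) : 0 <= M ->
  (exists B, forall xi, Rabs xi <= M -> Rabs (a0 xi) <= B) ->
  (exists B, forall xi, Rabs xi <= M -> Rabs (a1 xi) <= B) ->
  forall k, exists B, forall xi, Rabs xi <= M -> Rabs (amplitude a0 a1 xi k) <= B.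
Proof.
  intros HM H0 H1; apply two_step_ind; [exact H0|exact H1|].
  intros k [B HB] [B' HB']; exists (2 * M * B' + B); intros xi Hxi.
  specialize (HB xi Hxi); specialize (HB' xi Hxi); rewrite amplitude_SS.
  set (u := amplitude a0 a1 xi (S k)) in *; set (v := amplitude a0 a1 xi k) in *.
  pose proof (pos_INR k); pose proof sqrt2_bounds; pose proof (Rabs_pos xi); pose proof (Rabs_pos u).
  assert (Hn : Rabs (sqrt 2 * xi * u - v) <= 2 * M * B' + B).
  { unfold Rminus; eapply Rle_trans; [apply Rabs_triang|]; rewrite Rabs_Ropp.
    apply Rplus_le_compat; [|exact HB].
    rewrite !Rabs_mult, (Rabs_pos_eq (sqrt 2)) by lra.
    apply Rmult_le_compat; [nra|lra| |exact HB']. apply Rmult_le_compat; lra. }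
  unfold Rdiv; rewrite Rabs_mult, Rabs_inv, (Rabs_pos_eq (INR k + 1)) by lra.
  eapply Rle_trans; [|exact Hn].
  rewrite <- (Rmult_1_r (Rabs (sqrt 2 * xi * u - v))) at 2.
  apply Rmult_le_compat_l; [apply Rabs_pos|].
  rewrite <- Rinv_1 at 2; apply Rinv_le_contravar; lra.
Qed.

(** One step of the recurrence is stable: [g] and [h] are the [O(1 / sqrt N)] and
    [O(1 / N)] corrections of its coefficients. *)
Lemma perturbed_step (k : nat) (M B d xi g h u v u' v' : R) :
  0 <= M -> 0 < d <= 1 -> Rabs xi <= M -> Rabs u <= B -> Rabs v <= B ->
  Rabs g <= d -> Rabs h <= d -> Rabs (u' - u) <= d -> Rabs (v' - v) <= d ->
  Rabs (((sqrt 2 * xi + g) * u' - (1 - h) * v') / (INR k + 1)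
        - (sqrt 2 * xi * u - v) / (INR k + 1)) <= (2 * M + 2 * B + 3) * d.
Proof.
  intros HM Hd Hxi Hu Hv Hg Hh Hu' Hv'.
  pose proof (pos_INR k); pose proof sqrt2_bounds; pose proof (Rabs_pos xi).
  assert (HB : 0 <= B) by (eapply Rle_trans; [apply Rabs_pos|exact Hu]).
  assert (Bu : Rabs u' <= B + 1) by (replace u' with (u + (u' - u)) by ring; eapply Rle_trans; [apply Rabs_triang|lra]).
  assert (Bv : Rabs v' <= B + 1) by (replace v' with (v + (v' - v)) by ring; eapply Rle_trans; [apply Rabs_triang|lra]).
  replace (((sqrt 2 * xi + g) * u' - (1 - h) * v') / (INR k + 1) - (sqrt 2 * xi * u - v) / (INR k + 1))
    with ((sqrt 2 * xi * (u' - u) + g * u' + h * v' + - (v' - v)) * / (INR k + 1)) by (field; lra).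
  rewrite Rabs_mult, Rabs_inv, (Rabs_pos_eq (INR k + 1)) by lra.
  rewrite <- (Rmult_1_r ((2 * M + 2 * B + 3) * d)).
  apply Rmult_le_compat; [apply Rabs_pos|left; apply Rinv_0_lt_compat; lra| |rewrite <- Rinv_1 at 2; apply Rinv_le_contravar; lra].
  assert (T1 : Rabs (sqrt 2 * xi * (u' - u)) <= 2 * M * d).
  { rewrite !Rabs_mult, (Rabs_pos_eq (sqrt 2)) by lra.
    apply Rmult_le_compat; [nra|apply Rabs_pos| |exact Hu']. apply Rmult_le_compat; lra. }
  assert (T2 : Rabs (g * u') <= d * (B + 1)) by (rewrite Rabs_mult; apply Rmult_le_compat; auto using Rabs_pos).
  assert (T3 : Rabs (h * v') <= d * (B + 1)) by (rewrite Rabs_mult; apply Rmult_le_compat; auto using Rabs_pos).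
  eapply Rle_trans; [apply Rabs_triang|]; rewrite Rabs_Ropp.
  eapply Rle_trans; [apply Rplus_le_compat_r; eapply Rle_trans; [apply Rabs_triang|apply Rplus_le_compat_r, Rabs_triang]|].
  lra.
Qed.

(** At index [j + 1], the coefficient [D j (sqrt 2 xi) / j!] of the cosine, see
    [pcf_cos_amp]. *)
Definition cos_amp : R -> nat -> R := amplitude (fun _ => 0) (fun xi => exp (- (xi ^ 2 / 2))).
(** At index [j + 1], the value [Lambda D j xi], see [Lambda_sin_amp]. *)
Definition sin_amp : R -> nat -> R :=
  amplitude (fun xi => 2 * exp (xi ^ 2 / 2)) (fun xi => 2 * sqrt 2 * exp (- (xi ^ 2 / 2)) * dawson xi).

Lemma cos_amp_bounded (M : R) : 0 <= M -> forall k, exists B, forall xi, Rabs xi <= M -> Rabs (cos_amp xi k) <= B.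
Proof.
  intros HM; apply amplitude_bounded; [exact HM| |].
  - exists 0; intros; rewrite Rabs_R0; lra.
  - exists 1; intros xi _; rewrite Rabs_pos_eq by (left; apply exp_pos); apply exp_neg_le_1.
    pose proof (pow2_ge_0 xi); lra.
Qed.

Lemma sin_amp_bounded (M : R) : 0 <= M -> forall k, exists B, forall xi, Rabs xi <= M -> Rabs (sin_amp xi k) <= B.
Proof.
  intros HM.
  assert (HE : forall xi, Rabs xi <= M -> exp (xi ^ 2 / 2) <= exp (M ^ 2 / 2)).
  { intros xi Hxi; apply exp_mono; rewrite <- (pow2_abs xi).
    assert (Rabs xi ^ 2 <= M ^ 2) by (apply pow_incr; split; [apply Rabs_pos|exact Hxi]); lra. }
  apply amplitude_bounded; [exact HM| |].
  - exists (2 * exp (M ^ 2 / 2)); intros xi Hxi; rewrite Rabs_pos_eq by (pose proof (exp_pos (xi ^ 2 / 2)); lra).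
    specialize (HE xi Hxi); lra.
  - exists (4 * (exp (M ^ 2 / 2) * M)); intros xi Hxi.
    replace (2 * sqrt 2 * exp (- (xi ^ 2 / 2)) * dawson xi) with
      (2 * sqrt 2 * (exp (xi ^ 2 / 2) * (exp (- xi ^ 2) * dawson xi))).
    2:{ rewrite <- (Rmult_assoc (exp (xi ^ 2 / 2))), <- exp_plus.
        replace (xi ^ 2 / 2 + - xi ^ 2) with (- (xi ^ 2 / 2)) by field; ring. }
    pose proof sqrt2_bounds; pose proof (dawson_bound xi).
    rewrite Rabs_mult, (Rabs_pos_eq (2 * sqrt 2)) by lra.
    apply Rmult_le_compat; [lra|apply Rabs_pos|lra|].
    rewrite Rabs_mult, Rabs_pos_eq by (left; apply exp_pos).
    apply Rmult_le_compat; [left; apply exp_pos|apply Rabs_pos|now apply HE|].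
    rewrite Rabs_mult, (Rabs_pos_eq (exp (- xi ^ 2))) by (left; apply exp_pos); lra.
Qed.

Section Induction.
Variables p q : R.
Hypotheses (hp : 0 < p) (hq : 0 < q) (hpq : p + q = 1).

(** The expansion for [n = N + 1 - k], that is [j = k - 1]. The quotient [scale / N] is
    [sqrt (p q / N)], whose powers balance the growth of the polynomials with [j]. The
    clause on [k = 0] is needed because [1 / j!] is [0] there and cannot absorb an error. *)
Definition amplitude_claim (k : nat) : Prop :=
  forall M eta, 0 <= M -> 0 < eta ->
  exists N0, forall N, (N0 <= N)%nat -> forall xi, Rabs xi <= M ->
  exists al be,
    Rabs (al - cos_amp xi k) <= eta /\ Rabs (be - sin_amp xi k) <= eta /\ (k = 0%nat -> al = 0) /\
    Krawtchouk (S N - k) (node p q N xi) N p q * (scale p q N / INR N) ^ k =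
      scale p q N / INR N * (binary_power p q N (node p q N xi) * exp (xi ^ 2 / 2)
        * osc al be (PI * (INR N - node p q N xi))).

Lemma amplitude_claim_0 : amplitude_claim 0.
Proof.
  intros M eta HM He.
  destruct (base_amplitudes p q hp hq hpq M eta HM He) as [N0 H0].
  exists N0; intros N HN xi Hxi.
  destruct (H0 N HN xi Hxi) as [al [be [be1 [_ [_ [H3 [_ H5]]]]]]].
  exists 0, be1; repeat split.
  - unfold cos_amp; simpl; rewrite Rminus_diag, Rabs_R0; lra.
  - exact H3.
  - rewrite Nat.sub_0_r, H5; simpl; ring.
Qed.

Lemma amplitude_claim_1 : amplitude_claim 1.
Proof.
  intros M eta HM He.
  destruct (base_amplitudes p q hp hq hpq M eta HM He) as [N0 H0].
  exists N0; intros N HN xi Hxi.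
  destruct (H0 N HN xi Hxi) as [al [be [be1 [H1 [H2 [_ [H4 _]]]]]]].
  exists al, be; repeat split; [exact H1|exact H2|discriminate|].
  replace (S N - 1)%nat with N by lia; rewrite H4, pow_1; ring.
Qed.

(** Multiplied by [sqrt (p q / N) ^ (k + 2) / (p q)], the three-term recurrence of the
    Krawtchouk polynomials is the recurrence of [amplitude] with coefficients perturbed
    by [g] and [h]. It is linear, so it acts on the cosine and the sine amplitude
    separately. *)
Lemma amplitude_claim_step (k : nat) :
  amplitude_claim k -> amplitude_claim (S k) -> amplitude_claim (S (S k)).
Proof.
  intros Hk HSk M eta HM He.
  destruct (cos_amp_bounded M HM k) as [B1 HB1]; destruct (cos_amp_bounded M HM (S k)) as [B2 HB2].
  destruct (sin_amp_bounded M HM k) as [B3 HB3]; destruct (sin_amp_bounded M HM (S k)) as [B4 HB4].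
  set (B := Rabs B1 + Rabs B2 + Rabs B3 + Rabs B4).
  assert (HB : 0 <= B /\ B1 <= B /\ B2 <= B /\ B3 <= B /\ B4 <= B).
  { unfold B; pose proof (Rle_abs B1); pose proof (Rle_abs B2); pose proof (Rle_abs B3); pose proof (Rle_abs B4).
    pose proof (Rabs_pos B1); pose proof (Rabs_pos B2); pose proof (Rabs_pos B3); pose proof (Rabs_pos B4).
    repeat split; lra. }
  set (c := 2 * M + 2 * B + 3); assert (Hc : 0 < c) by (unfold c; lra).
  set (d := Rmin 1 (eta / c)).
  assert (Hd : 0 < d <= 1) by (split; [apply Rmin_glb_lt; [lra|apply Rdiv_lt_0_compat; lra]|apply Rmin_l]).
  assert (Hcd : c * d <= eta).
  { replace eta with (c * (eta / c)) by (field; lra); apply Rmult_le_compat_l; [lra|apply Rmin_r]. }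
  destruct (Hk M d HM ltac:(lra)) as [N1 H1]; destruct (HSk M d HM ltac:(lra)) as [N2 H2].
  destruct (scale_large p q (pq_pos p q hp hq) ((INR k + 1) / d)) as [N3 H3].
  destruct (INR_unbounded ((INR k + 1) / d)) as [N4 H4].
  exists (N1 + N2 + N3 + N4 + k + 2)%nat; intros N HN xi Hxi.
  destruct (H1 N ltac:(lia) xi Hxi) as [al [be [A1 [A2 [_ A4]]]]].
  destruct (H2 N ltac:(lia) xi Hxi) as [al' [be' [A1' [A2' [_ A4']]]]].
  specialize (H3 N ltac:(lia)).
  assert (H4' : (INR k + 1) / d <= INR N) by (assert (HN4 : (N4 <= N)%nat) by lia; apply le_INR in HN4; lra).
  pose proof (scale_sq p q hp hq N) as Hs2.
  pose proof (pos_INR k) as Pk.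
  assert (Hkd : 0 < (INR k + 1) / d) by (apply Rdiv_lt_0_compat; lra).
  set (x := node p q N xi) in *.
  assert (Ex : x - q * INR N = sqrt 2 * xi * scale p q N) by (unfold x, node; ring).
  set (s := scale p q N) in *.
  assert (Hs : 0 < s) by lra. assert (HNp : 0 < INR N) by lra.
  set (g := (q - p) * INR k / s); set (h := (INR k - 1) / INR N).
  assert (Hfrac : forall r t, Rabs r <= INR k + 1 -> (INR k + 1) / d <= t -> Rabs (r / t) <= d).
  { intros r t Hr Ht; unfold Rdiv; rewrite Rabs_mult, Rabs_inv, (Rabs_pos_eq t) by lra.
    apply Rmult_le_reg_r with t; [lra|]. rewrite Rmult_assoc, Rinv_l, Rmult_1_r by lra.
    eapply Rle_trans; [exact Hr|].
    replace (INR k + 1) with (d * ((INR k + 1) / d)) at 1 by (field; lra).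
    apply Rmult_le_compat_l; lra. }
  assert (Hg : Rabs g <= d).
  { apply Hfrac; [|exact H3].
    rewrite Rabs_mult, (Rabs_pos_eq (INR k)) by lra.
    apply Rle_trans with (1 * INR k); [|lra].
    apply Rmult_le_compat_r; [lra|apply Rabs_le; lra]. }
  assert (Hh : Rabs h <= d) by (apply Hfrac; [apply Rabs_le; lra|exact H4']).
  exists (((sqrt 2 * xi + g) * al' - (1 - h) * al) / (INR k + 1)),
    (((sqrt 2 * xi + g) * be' - (1 - h) * be) / (INR k + 1)).
  specialize (HB1 xi Hxi); specialize (HB2 xi Hxi); specialize (HB3 xi Hxi); specialize (HB4 xi Hxi).
  repeat split.
  - eapply Rle_trans; [|exact Hcd]; unfold cos_amp; rewrite amplitude_SS.
    apply perturbed_step; try assumption; fold (cos_amp xi k); fold (cos_amp xi (S k)); lra.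
  - eapply Rle_trans; [|exact Hcd]; unfold sin_amp; rewrite amplitude_SS.
    apply perturbed_step; try assumption; fold (sin_amp xi k); fold (sin_amp xi (S k)); lra.
  - discriminate.
  - pose proof (Krawtchouk_recurrence x p q N (N - k - 2) hpq) as Rec.
    replace (S (S (S (N - k - 2)))) with (S N - k)%nat in Rec by lia.
    replace (S (S (N - k - 2))) with (S N - S k)%nat in Rec by lia.
    replace (S (N - k - 2)) with (S N - S (S k))%nat in Rec by lia.
    rewrite !minus_INR, !S_INR in Rec by lia.
    set (K0 := Krawtchouk (S N - k) x N p q) in *; set (K1 := Krawtchouk (S N - S k) x N p q) in *.
    set (K2 := Krawtchouk (S N - S (S k)) x N p q) in *.
    set (E := binary_power p q N x * exp (xi ^ 2 / 2)) in *; set (th := PI * (INR N - x)) in *.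
    set (r := s / INR N) in *.
    assert (Er : r ^ 2 = p * q / INR N).
    { unfold r; replace ((s / INR N) ^ 2) with (s ^ 2 / INR N ^ 2) by (field; lra); rewrite Hs2; field; lra. }
    assert (Er2 : r / (p * q) = / s).
    { unfold r; apply Rmult_eq_reg_r with (s * (p * q * INR N)); [|apply Rgt_not_eq; rewrite <- Hs2; apply Rmult_lt_0_compat; [|apply pow_lt]; exact Hs].
      transitivity (s ^ 2); [field; repeat split; lra|rewrite Hs2; field; lra]. }
    assert (E2 : (INR k + 1) * K2 = ((sqrt 2 * xi * s + (q - p) * INR k) * K1 - (INR N + 1 - INR k) * K0) / (p * q)).
    { replace ((sqrt 2 * xi * s + (q - p) * INR k) * K1 - (INR N + 1 - INR k) * K0) with ((INR k + 1) * K2 * (p * q)).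
      - field; lra.
      - rewrite <- Ex.
        rewrite Rec; replace q with (1 - p) by lra; ring. }
    transitivity (((INR k + 1) * K2) * r ^ S (S k) / (INR k + 1)); [field; lra|].
    rewrite E2.
    transitivity (((sqrt 2 * xi * s + (q - p) * INR k) * (r / (p * q)) * (K1 * r ^ S k)
       - (INR N + 1 - INR k) * (r ^ 2 / (p * q)) * (K0 * r ^ k)) / (INR k + 1)); [simpl; field; lra|].
    rewrite A4, A4', Er, Er2; unfold osc.
    replace ((sqrt 2 * xi * s + (q - p) * INR k) * / s) with (sqrt 2 * xi + g) by (unfold g; field; lra).
    replace ((INR N + 1 - INR k) * (p * q / INR N / (p * q))) with (1 - h) by (unfold h; field; lra).
    assert (0 < sqrt (2 * PI)) by (pose proof PI_RGT_0; apply sqrt_lt_R0; lra).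
    field; lra.
Qed.

Lemma amplitude_claim_all (k : nat) : amplitude_claim k.
Proof.
  revert k; apply two_step_ind; [exact amplitude_claim_0|exact amplitude_claim_1|exact amplitude_claim_step].
Qed.

Lemma amplitude_claim_uniform (K : nat) (M eta : R) : 0 <= M -> 0 < eta ->
  exists N0, forall N, (N0 <= N)%nat -> forall k xi, (k <= K)%nat -> Rabs xi <= M ->
  exists al be,
    Rabs (al - cos_amp xi k) <= eta /\ Rabs (be - sin_amp xi k) <= eta /\ (k = 0%nat -> al = 0) /\
    Krawtchouk (S N - k) (node p q N xi) N p q * (scale p q N / INR N) ^ k =
      scale p q N / INR N * (binary_power p q N (node p q N xi) * exp (xi ^ 2 / 2)
        * osc al be (PI * (INR N - node p q N xi))).
Proof.
  intros HM He; induction K as [|K [N1 H1]].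
  - destruct (amplitude_claim_0 M eta HM He) as [N0 H0]; exists N0; intros N HN k xi Hk Hxi.
    replace k with 0%nat by lia; now apply H0.
  - destruct (amplitude_claim_all (S K) M eta HM He) as [N2 H2].
    exists (N1 + N2)%nat; intros N HN k xi Hk Hxi.
    destruct (Nat.eq_dec k (S K)) as [->|Hne]; [apply H2; [lia|exact Hxi]|apply H1; [lia|lia|exact Hxi]].
Qed.

End Induction.

Section Identify.
Variable D : R -> C -> C.
Hypothesis hD : forall nu : R, is_parabolic_cylinder nu (D nu).

Lemma pcf_cos_amp (xi : R) (k : nat) :
  D (INR k) (RtoC (sqrt 2 * xi)) = RtoC (INR (fact k) * cos_amp xi (S k)).
Proof.
  enough (H : forall k, D (INR k) (RtoC (sqrt 2 * xi)) = RtoC (INR (fact k) * cos_amp xi (S k)) /\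
     D (INR (S k)) (RtoC (sqrt 2 * xi)) = RtoC (INR (fact (S k)) * cos_amp xi (S (S k)))) by apply H.
  assert (E0 : D (INR 0) (RtoC (sqrt 2 * xi)) = RtoC (INR (fact 0) * cos_amp xi 1)).
  { simpl INR; rewrite (pcf_0_real D hD); unfold cos_amp; simpl amplitude.
    f_equal; rewrite Rmult_1_l; f_equal.
    replace ((sqrt 2 * xi) ^ 2) with ((sqrt 2 * sqrt 2) * xi ^ 2) by ring; rewrite sqrt2_sq; field. }
  assert (ES : forall k z, D (INR (S k)) z = (z * D (INR k) z - RtoC (INR k) * D (INR k - 1) z)%C)
    by (intros; rewrite S_INR; apply (pcf_recurrence D hD)).
  induction k0 as [|k0 [IH1 IH2]]; split.
  - exact E0.
  - rewrite ES, E0; unfold cos_amp; rewrite amplitude_SS; simpl INR; simpl (amplitude _ _ _ 0).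
    transitivity (RtoC (sqrt 2 * xi) * RtoC (1 * amplitude (fun _ => 0) (fun xi => exp (- (xi ^ 2 / 2))) xi 1))%C; [ring|].
    rewrite <- RtoC_mult; f_equal; field.
  - exact IH2.
  - rewrite ES, IH2; rewrite S_INR at 2; replace (INR k0 + 1 - 1) with (INR k0) by ring; rewrite IH1.
    rewrite <- !RtoC_mult, <- RtoC_minus; f_equal.
    unfold cos_amp; rewrite (amplitude_SS _ _ _ (S k0)).
    rewrite (fact_simpl (S k0)), (fact_simpl k0), !mult_INR, !S_INR.
    pose proof (pos_INR k0); field; lra.
Qed.

Lemma Lambda_sin_amp (xi : R) (k : nat) :
  Lambda D (Z.of_nat k - 1) xi = RtoC (sin_amp xi k).
Proof.
  revert k; apply two_step_ind.
  - change (Z.of_nat 0 - 1)%Z with (-1)%Z; apply (Lambda_m1 D hD).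
  - change (Z.of_nat 1 - 1)%Z with 0%Z; apply (Lambda_0 D hD).
  - intros k H0 H1.
    replace (Z.of_nat (S (S k)) - 1)%Z with (Z.of_nat k + 1)%Z by lia.
    replace (Z.of_nat (S k) - 1)%Z with (Z.of_nat k) in H1 by lia.
    pose proof (Lambda_recurrence D hD k xi) as Rec; rewrite H0, H1, <- RtoC_mult, <- RtoC_minus in Rec.
    unfold sin_amp at 1; rewrite amplitude_SS; fold (sin_amp xi k); fold (sin_amp xi (S k)).
    pose proof (pos_INR k).
    assert (Hk := RtoC_nonzero (INR k + 1) ltac:(lra)).
    rewrite RtoC_div, <- Rec by lra; field; exact Hk.
Qed.
End Identify.

(* The right-hand side oscillates, and its zeros in xi are in general not zeros
   of the Krawtchouk polynomial, so the quotient of the two sides does not tend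
   to 1 there.  The relation ~ is therefore stated for the amplitudes: the
   coefficients D_j and Lambda_j of the cosine and the sine are each correct up
   to an error tending to 0, uniformly for bounded j and xi. *)
Theorem mainTheorem12
    (p q : R) (hp : 0 < p < 1) (hq : 0 < q < 1) (hpq : p + q = 1)
    (D : R -> C -> C) (hD : forall nu : R, is_parabolic_cylinder nu (D nu)) :
  (forall (j : Z) (xi : R), (-1 <= j)%Z -> Im (Lambda D j xi) = 0) /\
  (forall (J : Z) (M eta : R), 0 < eta ->
   exists N0 : nat, forall N : nat, (N0 <= N)%nat ->
   forall (n : nat) (j : Z) (xi : R),
     (-1 <= j <= J)%Z -> Z.of_nat n = (Z.of_nat N - j)%Z -> Rabs xi <= M ->
     let eps := 1 / INR N in
     let y := q + xi * sqrt (2 * p * q * eps) in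
     let x := y * INR N in
     let theta := p * PI / eps - xi * PI * sqrt (2 * p * q / eps) in
     exists a b : R, Rabs a <= eta /\ Rabs b <= eta /\
     RtoC (Krawtchouk n x N p q) =
       (RtoC (exp ((p * ln p + q * ln q) / eps
                   + xi * sqrt (2 * p * q / eps) * ln (q / p)
                   - IZR j / 2 * ln (p * q * eps)))
        * RtoC (exp (xi ^ 2 / 2))
        * (RtoC (inv_fact j) * (D (IZR j) (RtoC (sqrt 2 * xi)) + RtoC a)
             * RtoC (cos theta)
           - RtoC (1 / sqrt (2 * PI)) * (Lambda D j xi + RtoC b)
             * RtoC (sin theta)))%C).
Proof.
  split.
  { intros j xi Hj; replace j with (Z.of_nat (Z.to_nat (j + 1)) - 1)%Z by lia.
    rewrite (Lambda_sin_amp D hD); reflexivity. }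
  intros J M eta He.
  destruct hp as [hp0 _]; destruct hq as [hq0 _].
  set (F := INR (fact (Z.to_nat J))).
  assert (HF : 1 <= F) by (change 1 with (INR 1); apply le_INR; apply lt_O_fact).
  destruct (amplitude_claim_uniform p q hp0 hq0 hpq (Z.to_nat (J + 1)) (Rabs M) (eta / F)
    (Rabs_pos M) ltac:(apply Rdiv_lt_0_compat; lra)) as [N0 H0].
  exists (S N0); intros N HN n j xi Hj Hn Hxi eps y x theta.
  specialize (H0 N ltac:(lia) (Z.to_nat (j + 1)) xi ltac:(lia)
    ltac:(eapply Rle_trans; [exact Hxi|apply Rle_abs])).
  set (k := Z.to_nat (j + 1)) in *.
  destruct H0 as [al [be [H1 [H2 [H3 H4]]]]].
  assert (HNp : 0 < INR N) by (apply lt_0_INR; lia).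
  pose proof (scale_sq p q hp0 hq0 N) as Hs2.
  pose proof (pq_pos p q hp0 hq0) as Hpq.
  assert (Hs : 0 < scale p q N) by (unfold scale; apply sqrt_lt_R0; nra).
  assert (Eps1 : sqrt (2 * p * q / eps) = sqrt 2 * scale p q N).
  { unfold scale, eps; rewrite <- sqrt_mult by nra; f_equal; field; lra. }
  assert (Eps2 : sqrt (2 * p * q * eps) * INR N = sqrt 2 * scale p q N).
  { rewrite <- Eps1; rewrite <- (sqrt_pow2 (INR N)) at 1 by lra.
    rewrite <- sqrt_mult.
    - f_equal; unfold eps; field; lra.
    - unfold eps; apply Rmult_le_pos; [lra|left; apply Rdiv_lt_0_compat; lra].
    - nra. }
  assert (Ex : x = node p q N xi).
  { unfold x, y, node; rewrite Rmult_plus_distr_r, Rmult_assoc, Eps2; ring. }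
  assert (Eth : theta = PI * (INR N - node p q N xi)).
  { unfold theta, node; rewrite Eps1; unfold eps; replace p with (1 - q) at 1 by lra; field; lra. }
  replace n with (S N - k)%nat by (unfold k; lia).
  rewrite Ex, Eth.
  set (s := scale p q N) in *; set (r := s / INR N) in *.
  assert (Hr : 0 < r) by (apply Rdiv_lt_0_compat; lra).
  assert (Elnr : 2 * ln r = ln (p * q * eps)).
  { replace (p * q * eps) with (r * r).
    - rewrite ln_mult by lra; ring.
    - unfold r, eps; replace (s / INR N * (s / INR N)) with (s ^ 2 / INR N ^ 2) by (field; lra); rewrite Hs2; field; lra. }
  assert (Hjk : IZR j = INR k - 1).
  { unfold k; rewrite INR_IZR_INZ, Z2Nat.id, plus_IZR by lia; ring. }
  assert (Epow : exp ((p * ln p + q * ln q) / eps + xi * sqrt (2 * p * q / eps) * ln (q / p)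
       - IZR j / 2 * ln (p * q * eps)) = binary_power p q N (node p q N xi) * (r / r ^ k)).
  { replace (r / r ^ k) with (exp (ln r - INR k * ln r)).
    - unfold binary_power; rewrite <- exp_plus; f_equal.
      rewrite Eps1, <- Elnr, Hjk, ln_div by lra.
      unfold node; fold s; unfold eps; replace (INR N) with (p * INR N + q * INR N) at 3
        by (rewrite <- Rmult_plus_distr_r, hpq; ring).
      field; lra.
    - unfold Rminus; rewrite exp_plus, exp_ln, exp_Ropp by exact Hr.
      fold (Rpower r (INR k)); rewrite Rpower_pow by exact Hr; reflexivity. }
  rewrite Epow.
  pose proof (pow_lt r k Hr) as Hrk.
  assert (EK : Krawtchouk (S N - k) (node p q N xi) N p q =
    binary_power p q N (node p q N xi) * (r / r ^ k) * exp (xi ^ 2 / 2) *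
    osc al be (PI * (INR N - node p q N xi))).
  { apply Rmult_eq_reg_r with (r ^ k); [rewrite H4; field|]; lra. }
  rewrite EK; unfold osc.
  set (th := PI * (INR N - node p q N xi)).
  set (E := binary_power p q N (node p q N xi) * (r / r ^ k)).
  assert (Hpi : 0 < sqrt (2 * PI)) by (pose proof PI_RGT_0; apply sqrt_lt_R0; lra).
  assert (EL : Lambda D j xi = RtoC (sin_amp xi k)).
  { replace j with (Z.of_nat k - 1)%Z by (unfold k; lia); apply (Lambda_sin_amp D hD). }
  assert (HeF : eta / F <= eta).
  { apply Rmult_le_reg_r with F; [lra|]; unfold Rdiv; rewrite Rmult_assoc, Rinv_l by lra; nra. }
  destruct (Z.eq_dec j (-1)) as [Hj1|Hj1].
  - exists 0, (be - sin_amp xi k); rewrite Rabs_R0; repeat split; [lra|lra|].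
    assert (Ek : k = 0%nat) by (unfold k; lia).
    rewrite (H3 Ek), EL, Hj1; unfold inv_fact; simpl (_ <? _)%Z.
    rewrite <- RtoC_plus, Cmult_0_l, Cmult_0_l, <- !RtoC_mult, <- RtoC_minus, <- RtoC_mult.
    f_equal; field; lra.
  - assert (Hj0 : (0 <= j)%Z) by lia.
    set (k' := Z.to_nat j).
    assert (Ek : k = S k') by (unfold k, k'; lia).
    assert (Ej : IZR j = INR k') by (unfold k'; rewrite INR_IZR_INZ, Z2Nat.id by lia; reflexivity).
    assert (Hf : 1 <= INR (fact k') <= F).
    { split; [change 1 with (INR 1); apply le_INR, lt_O_fact|].
      apply le_INR, fact_le; unfold k'; lia. }
    (* The error in the cosine amplitude is divided by j! in the statement. *)
    exists (INR (fact k') * (al - cos_amp xi k)), (be - sin_amp xi k); repeat split; [|lra|].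
    + rewrite Rabs_mult, Rabs_pos_eq by lra.
      apply Rle_trans with (F * (eta / F)); [|right; field; lra].
      apply Rmult_le_compat; [lra|apply Rabs_pos|lra|exact H1].
    + rewrite EL, Ej, (pcf_cos_amp D hD), <- Ek; unfold inv_fact.
      destruct (Z.ltb_spec j 0) as [Hlt|_]; [lia|]; fold k'.
      rewrite <- !RtoC_plus, <- !RtoC_mult, <- RtoC_minus, <- RtoC_mult.
      f_equal; field; lra.
Qed.
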